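(* Let $s\ge 1$, $k\ge 1$, $d\ge 1$ be integers and $\lambda>0$, $\delta>0$. Suppose that the data $\{(t_i,y_i)\}_{i\ge 1}$ satisfy Assumptions 1, 2 and 3 (listed in the context), and let $f_n,f_\infty:\Theta\to\mathbb{R}$ be the functionals $$f_n(\mu)=\frac1n\sum_{i=1}^n\min_{1\le j\le k}|y_i-\mu_j(t_i)|^2+\lambda\sum_{j=1}^k\|\nabla^s\mu_j\|_{L^2}^2,$$ $$f_\infty(\mu)=\int_0^1\int_{\mathbb{R}^d}\min_{1\le j\le k}|y-\mu_j(t)|^2\,\phi_Y(y|t)\,\phi_T(t)\,\mathrm{d}y\,\mathrm{d}t+\lambda\sum_{j=1}^k\|\nabla^s\mu_j\|_{L^2}^2,$$ where $\Theta\subset(H^s)^k$ is the set of $k$-tuples of trajectories with minimum separation $\delta$ defined in the context. Then any sequence $(\mu^n)_{n\in\mathbb{N}}\subset\Theta$, with $\mu^n$ a minimizer of $f_n$ over $\Theta$, is, with probability one, weakly compact in $(H^s)^k$ (every subsequence has a further subsequence converging weakly in $(H^s)^k$), and any weak limit $\mu^\infty$ of a subsequence of $(\mu^n)$ is a minimizer of $f_\infty$ over $\Theta$.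
   Context: Function spaces. $H^s$ is the Sobolev space of functions $\mu:[0,1]\to\mathbb{R}^d$ such that $\nabla^i\mu$ is absolutely continuous for $i=0,1,\dots,s-1$ and $\nabla^s\mu\in L^2$, where $\nabla^i$ is the $i$-th derivative in $t$, with its usual Sobolev norm (up to equivalence). $(H^s)^k$ is the $k$-fold product. $|\cdot|$ is the Euclidean norm on $\mathbb{R}^d$. For fixed $\delta>0$, $$\Theta=\{\mu=(\mu_1,\dots,\mu_k)\in(H^s)^k:\ |\mu_j(t)-\mu_l(t)|\ge\delta\ \text{ for all } t\in[0,1] \text{ and all } j\ne l\}.$$ Assumptions on the data. All random variables live on a common probability space $(\Omega,\mathcal{F},\mathbb{P})$. Assumption 1: there are $\mu^\dagger=(\mu_1^\dagger,\dots,\mu_k^\dagger)\in(L^\infty)^k$ (functions $[0,1]\to\mathbb{R}^d$) and a probability vector $p=(p_1,\dots,p_k)$ such that $y_i=\mu^\dagger_{\varphi(i)}(t_i)+\epsilon_i$ for every $i\ge1$, where $\varphi(i)\in\{1,\dots,k\}$ with $\mathbb{P}(\varphi(i)=j)=p_j$, $\epsilon_i\in\mathbb{R}^d$ has density $\phi_0$, $t_i\in[0,1]$ has density $\phi_T$; $\varphi(i),\epsilon_i,t_i$ are mutually independent and the triples $(\varphi(i),\epsilon_i,t_i)$, $i\ge1$, are independent and identically distributed; $\phi_0$ and $\phi_T$ are continuous densities with respect to Lebesgue measure on $\mathbb{R}^d$ and $[0,1]$ respectively. Assumption 2: $\phi_0$ is centered (mean zero) and has finite second moments. Assumption 3: $\phi_0(\epsilon)>0$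 for all $\epsilon\in\mathbb{R}^d$. The conditional density of $y$ given $t$ is $\phi_Y(y|t)=\sum_{j=1}^k p_j\,\phi_0(y-\mu_j^\dagger(t))$. *)

(* Defs.v *)
From HB Require Import structures.
From mathcomp Require Import all_boot all_order all_algebra finmap.
From mathcomp Require Import all_classical all_reals all_analysis.

Set Implicit Arguments.
Unset Strict Implicit.
Unset Printing Implicit Defensive.

Import Order.TTheory GRing.Theory Num.Theory.
Import numFieldNormedType.Exports.

Local Open Scope classical_set_scope.
Local Open Scope ring_scope.

(* The library's own instance of this fact is shadowed by the one for products
   of subprobabilities. *)
Lemma product_sigma_finite (R : realType) d1 d2 (T1 : measurableType d1)
    (T2 : measurableType d2) (m1 : {sigma_finite_measure set T1 -> \bar R})
    (m2 : {sigma_finite_measure set T2 -> \bar R}) :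
  sigma_finite setT (m1 \x m2)%E.
Proof.
have /sigma_finiteP[F [TF ndF Foo]] := sigma_finiteT m1.
have /sigma_finiteP[G [TG ndG Goo]] := sigma_finiteT m2.
exists (fun n => F n `*` G n).
  rewrite -setXTT TF TG predeqE => -[x y]; split.
    move=> [/= [n _ Fnx] [k _ Gky]]; exists (maxn n k) => //; split.
    - by move: x Fnx; exact/subsetPset/ndF/leq_maxl.
    - by move: y Gky; exact/subsetPset/ndG/leq_maxr.
  by move=> [n _ []/= ? ?]; split; exists n.
move=> k; have [? ?] := Foo k; have [? ?] := Goo k.
split; first exact: measurableX.
by rewrite product_measure1E// lte_mul_pinfty// ge0_fin_numE.
Qed.

(* The sigma-algebra generated by the coordinates, that is, the Borel one. *)
Section measurable_rV.
Context {R : realType} {d : nat}.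

Let coord (i : 'I_d) (v : 'rV[R]_d) : R := v ord0 i.

Let rV_set0 : g_sigma_preimage coord set0.
Proof. exact: sigma_algebra0. Qed.

Let rV_setC A : g_sigma_preimage coord A -> g_sigma_preimage coord (~` A).
Proof. exact: sigma_algebraC. Qed.

Let rV_bigcup (F : (set _)^nat) : (forall i, g_sigma_preimage coord (F i)) ->
  g_sigma_preimage coord (\bigcup_i (F i)).
Proof. exact: sigma_algebra_bigcup. Qed.

HB.instance Definition _ := @isMeasurable.Build
  (measure_tuple_display default_measure_display) 'rV[R]_d
  (g_sigma_preimage coord) rV_set0 rV_setC rV_bigcup.

Lemma measurable_coord (i : 'I_d) :
  measurable_fun [set: 'rV[R]_d] (fun v => v ord0 i).
Proof.
move=> _ Y mY; rewrite setTI; apply: sub_sigma_algebra => /=.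
rewrite -bigcup_seq/=; exists i => /=; first by rewrite mem_index_enum.
by exists Y => //; rewrite setTI.
Qed.

Lemma measurable_fun_rV d' (T : measurableType d') (f : T -> 'rV[R]_d) :
  (forall i, measurable_fun [set: T] (fun x => f x ord0 i)) ->
  measurable_fun [set: T] f.
Proof.
move=> mf _ Y; rewrite setTI.
rewrite {1}/measurable /=.
apply: (smallest_sub (X := [set A | measurable (f @^-1` A)])).
  split => /=.
  - by rewrite preimage_set0.
  - by move=> A mA; rewrite setTD preimage_setC; exact: measurableC.
  - by move=> F mF; rewrite preimage_bigcup; exact: bigcup_measurable.
move=> A; rewrite -bigcup_seq/= => -[i _ [B mB <-]] /=.
by rewrite setTI; have := mf i measurableT B mB; rewrite setTI.
Qed.

End measurable_rV.

Definition cons_rV (R : realType) n (p : measurableTypeR R * 'rV[R]_n) :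
    'rV[R]_n.+1 :=
  row_mx (p.1%:M : 'rV[R]_1) p.2.

Section lebesgue_rV.
Context {R : realType}.
Local Notation M := (measurableTypeR R).

Lemma cons_rVE0 n (p : M * 'rV[R]_n) : cons_rV p ord0 ord0 = p.1.
Proof.
have -> : (ord0 : 'I_n.+1) = lshift n (ord0 : 'I_1) by exact/val_inj.
by rewrite /cons_rV (row_mxEl (p.1%:M : 'rV[R]_1) p.2 ord0 ord0) mxE mulr1n.
Qed.

Lemma cons_rVES n (p : M * 'rV[R]_n) i :
  cons_rV p ord0 (lift ord0 i) = p.2 ord0 i.
Proof.
have -> : lift ord0 i = rshift 1 i by exact/val_inj.
exact: (row_mxEr (p.1%:M : 'rV[R]_1) p.2 ord0 i).
Qed.

Let uncons_rV n (v : 'rV[R]_n.+1) : M * 'rV[R]_n :=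
  (v ord0 ord0, \row_i v ord0 (lift ord0 i)).

Let consK n : cancel (@cons_rV R n) (@uncons_rV n).
Proof.
move=> [x v]; rewrite /uncons_rV cons_rVE0; congr pair.
by apply/rowP => i; rewrite mxE cons_rVES.
Qed.

Lemma measurable_cons_rV n : measurable_fun [set: M * 'rV[R]_n] (@cons_rV R n).
Proof.
apply: measurable_fun_rV => i.
have [j ->|->] := unliftP ord0 i.
- have -> : (fun x : M * 'rV[R]_n => cons_rV x ord0 (lift ord0 j)) =
      (fun v : 'rV[R]_n => v ord0 j) \o snd.
    by apply/funext => p /=; rewrite cons_rVES.
  exact: (measurableT_comp (measurable_coord j) measurable_snd).
- have -> : (fun x : M * 'rV[R]_n => cons_rV x ord0 ord0) = fst.
    by apply/funext => p /=; rewrite cons_rVE0.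
  exact: measurable_fst.
Qed.

Let measurable_uncons n : measurable_fun [set: 'rV[R]_n.+1] (@uncons_rV n).
Proof.
apply/measurable_fun_pairP; split; first exact: measurable_coord.
apply: measurable_fun_rV => i /=.
rewrite (_ : (fun _ => _) = (fun v : 'rV[R]_n.+1 => v ord0 (lift ord0 i))).
  exact: measurable_coord.
by apply/funext => v; rewrite /= mxE.
Qed.


HB.instance Definition _ n := isMeasurableFun.Build _ _ _ _
  (@cons_rV R n) (@measurable_cons_rV n).

Section step.
Local Open Scope ereal_scope.
Variables (n : nat) (m : {sigma_finite_measure set 'rV[R]_n -> \bar R}).

Definition lebesgue_rV_step : set 'rV[R]_n.+1 -> \bar R :=
  pushforward (@lebesgue_measure R \x m) (@cons_rV R n).

Let step0 : lebesgue_rV_step set0 = 0.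
Proof. exact: measure0. Qed.

Let step_ge0 A : 0 <= lebesgue_rV_step A.
Proof. exact: measure_ge0. Qed.

Let step_sigma_additive : semi_sigma_additive lebesgue_rV_step.
Proof.
by apply: measure_semi_sigma_additive; exact: measurable_cons_rV.
Qed.

HB.instance Definition _ := isMeasure.Build _ _ _ lebesgue_rV_step
  step0 step_ge0 step_sigma_additive.

Let step_sigma_finite : sigma_finite setT lebesgue_rV_step.
Proof.
have [F FT Foo] := product_sigma_finite (@lebesgue_measure R) m.
exists (fun i => @uncons_rV n @^-1` F i).
  by rewrite -preimage_bigcup -FT preimage_setT.
move=> i; have [mF Fi] := Foo i; split.
  by rewrite -[X in measurable X]setTI; exact: measurable_uncons.
rewrite /lebesgue_rV_step /pushforward -comp_preimage.
rewrite (_ : _ \o _ = id) ?preimage_id//.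
by apply/funext => p; exact: consK.
Qed.

HB.instance Definition _ := @Measure_isSigmaFinite.Build _ _ _ lebesgue_rV_step
  step_sigma_finite.

End step.

Fixpoint lebesgue_rV d : {sigma_finite_measure set 'rV[R]_d -> \bar R} :=
  match d with
  | 0 => \d_(0 : 'rV[R]_0)
  | n.+1 => lebesgue_rV_step (lebesgue_rV n)
  end.

Lemma lebesgue_rV_box d (A : 'I_d -> set R) :
  (forall i, measurable (A i)) ->
  (lebesgue_rV d [set v | forall i, A i (v ord0 i)] =
   \prod_(i < d) @lebesgue_measure R (A i))%E.
Proof.
elim: d A => [|d IH] A mA /=.
  rewrite big_ord0 diracE mem_set//=; by case.
rewrite big_ord_recl -IH//.
have mB : measurable [set v : 'rV[R]_d | forall i, A (lift ord0 i) (v ord0 i)].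
  have -> : [set v : 'rV[R]_d | forall i, A (lift ord0 i) (v ord0 i)] =
      \bigcap_(i in [set: 'I_d])
        ((fun v : 'rV[R]_d => v ord0 i) @^-1` A (lift ord0 i)).
    by apply/seteqP; split=> v /= h; [move=> i _|move=> i]; exact: h.
  apply: fin_bigcap_measurable => // i _.
  by rewrite -[X in measurable X]setTI; exact: measurable_coord.
rewrite -(product_measure1E (@lebesgue_measure R) (lebesgue_rV d) (mA ord0) mB).
congr (product_measure1 _ _ _).
apply/seteqP; split=> -[x v] /=.
- move=> h; split; first by have := h ord0; rewrite cons_rVE0.
  by move=> i; have := h (lift ord0 i); rewrite cons_rVES.
- move=> [h0 h] i; have [j ->|->] := unliftP ord0 i.
    by rewrite cons_rVES; exact: h.
  by rewrite cons_rVE0.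
Qed.

End lebesgue_rV.

HB.instance Definition _ n := isPointed.Build 'I_n.+1 ord0.

HB.instance Definition _ n := @isMeasurable.Build default_measure_display
  'I_n.+1 discrete_measurable discrete_measurable0
  discrete_measurableC discrete_measurableU.

Definition I01 {R : realType} : set R := `[0, 1]%classic.

Section sobolev.
Context {R : realType} {d : nat}.
Implicit Types (f g : R -> 'rV[R]_d) (t : R).

(* `|v| on 'rV[R]_d is the library's maximum norm. *)
Definition enorm (v : 'rV[R]_d) : R := Num.sqrt (\sum_(i < d) v ord0 i ^+ 2).

(* Derivatives on [0, 1], one-sided at 0 and 1; the values of a trajectory
   outside [0, 1] are irrelevant throughout. *)
Definition quotient01 f t : set_system 'rV[R]_d :=
  (t' - t)^-1 *: (f t' - f t) @[t' --> within I01 t^'].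

Definition derivable01 f t : Prop := cvg (quotient01 f t).

Definition deriv01 f t : 'rV[R]_d := lim (quotient01 f t).

Definition nderiv01 (i : nat) f : R -> 'rV[R]_d := iter i deriv01 f.

Definition abs_continuous01 f : Prop :=
  forall e : R, 0 < e -> exists2 h : R, 0 < h &
    forall (n : nat) (a b : 'I_n -> R),
      (forall i, 0 <= a i /\ a i <= b i /\ b i <= 1) ->
      trivIset setT (fun i => `]a i, b i[%classic) ->
      \sum_(i < n) (b i - a i) < h ->
      \sum_(i < n) enorm (f (b i) - f (a i)) < e.

Definition square_integrable01 g : Prop :=
  measurable_fun I01 g /\
  (\int[@lebesgue_measure R]_(t in I01) (enorm (g t) ^+ 2)%:E < +oo)%E.

(* The squared L^2 norm. *)
Definition sqnorm2 g : R :=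
  \int[@lebesgue_measure R]_(t in I01) (enorm (g t) ^+ 2).

(* [deriv01] is total; the second clause says that the iterated derivatives
   are genuine ones (almost everywhere). *)
Definition sobolev (s : nat) f : Prop :=
  [/\ forall i, (i < s)%N -> abs_continuous01 (nderiv01 i f),
      forall i, (i < s)%N -> {ae @lebesgue_measure R,
        forall t, I01 t -> derivable01 (nderiv01 i f) t}
    & square_integrable01 (nderiv01 s f)].

Definition bounded_measurable01 f : Prop :=
  measurable_fun I01 f /\
  exists M : R, {ae @lebesgue_measure R,
    forall t, I01 t -> enorm (f t) <= M}.

End sobolev.

Section trajectories.
Context {R : realType} {k d : nat}.
(* k.+1 trajectories, so that there is at least one. *)
Local Notation traj := ('I_k.+1 -> R -> 'rV[R]_d).

Definition sobolevk (s : nat) : set traj :=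
  [set u | forall j, sobolev s (u j)].

Definition sobolevk_norm (s : nat) (u : traj) : R :=
  Num.sqrt (\sum_j \sum_(i < s.+1) sqnorm2 (nderiv01 i (u j))).

Definition Theta (s : nat) (delta : R) : set traj :=
  [set u | sobolevk s u /\
    forall t, I01 t -> forall j l, j != l ->
      delta <= enorm (u j t - u l t)].

Definition sobolevk_dual (s : nat) (L : traj -> R) : Prop :=
  (forall (a : R) (u v : traj), sobolevk s u -> sobolevk s v ->
     L (fun j t => a *: u j t + v j t) = a * L u + L v) /\
  exists C : R, forall u : traj, sobolevk s u -> `|L u| <= C * sobolevk_norm s u.

Definition weak_cvg (s : nat) (u : nat -> traj) (v : traj) : Prop :=
  sobolevk s v /\
  forall L, sobolevk_dual s L -> L (u n) @[n --> \oo] --> L v.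

Definition is_subsequence (u u' : nat -> traj) : Prop :=
  exists h : nat -> nat, {homo h : m n / (m < n)%N} /\ u' = u \o h.

Definition weakly_compact (s : nat) (u : nat -> traj) : Prop :=
  forall u', is_subsequence u u' ->
  exists u'' v, is_subsequence u' u'' /\ weak_cvg s u'' v.

Definition min_cost (u : traj) (t : R) (y : 'rV[R]_d) : R :=
  \big[Num.min/enorm (y - u ord0 t) ^+ 2]_(j < k.+1) enorm (y - u j t) ^+ 2.

Definition penalty (s : nat) (lambda : R) (u : traj) : R :=
  lambda * \sum_j sqnorm2 (nderiv01 s (u j)).

(* The data are indexed from 0 instead of 1. *)
Definition f_n (s : nat) (lambda : R) (t : nat -> R) (y : nat -> 'rV[R]_d)
    (n : nat) (u : traj) : R :=
  n%:R^-1 * \sum_(i < n) min_cost u (t i) (y i) + penalty s lambda u.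

Definition phiY (p : 'I_k.+1 -> R) (mudag : traj) (phi0 : 'rV[R]_d -> R)
    (y : 'rV[R]_d) (t : R) : R :=
  \sum_j p j * phi0 (y - mudag j t).

Definition f_infty (s : nat) (lambda : R) (p : 'I_k.+1 -> R) (mudag : traj)
    (phi0 : 'rV[R]_d -> R) (phiT : R -> R) (u : traj) : \bar R :=
  (\int[@lebesgue_measure R]_(t in I01)
     \int[lebesgue_rV d]_y
       (min_cost u t y * phiY p mudag phi0 y t * phiT t)%:E
   + (penalty s lambda u)%:E)%E.

Definition is_minimizer {disp} {U : porderType disp} (A : set traj)
    (f : traj -> U) (u : traj) : Prop :=
  A u /\ forall v, A v -> (f u <= f v)%O.

End trajectories.

Section independence.
Context {R : realType} {d : measure_display} {T : measurableType d}.
Variable P : probability T R.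

(* Mutual independence of a family of classes of events; for random variables
   the classes are the sigma-algebras [g_sigma_algebra_preimage X]. *)
Definition mutually_independent {I : choiceType} (G : I -> set (set T)) : Prop :=
  forall (J : {fset I}) (E : I -> set T), (forall i, i \in J -> G i (E i)) ->
  P (\bigcap_(i in [set` J]) E i) = (\prod_(i <- J) P (E i))%E.

Definition identically_distributed {d'} {U : measurableType d'}
    (X : nat -> T -> U) : Prop :=
  forall i A, measurable A -> P (X i @^-1` A) = P (X 0%N @^-1` A).

End independence.

Definition has_density {d} {T : measurableType d} {R : realType}
    (nu mu : set T -> \bar R) (D : set T) (f : T -> R) : Prop :=
  (forall x, D x -> 0 <= f x) /\
  forall A, measurable A -> nu A = (\int[mu]_(x in A `&` D) (f x)%:E)%E.

Section assumptions.
Context {R : realType} {k d : nat} {dO : measure_display}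
  {Omega : measurableType dO} (P : probability Omega R).
Variables (mudag : 'I_k.+1 -> R -> 'rV[R]_d) (p : 'I_k.+1 -> R)
  (phi0 : 'rV[R]_d -> R) (phiT : R -> R)
  (phi : nat -> {RV P >-> 'I_k.+1}) (eps : nat -> {RV P >-> 'rV[R]_d})
  (t : nat -> {RV P >-> R}) (y : nat -> Omega -> 'rV[R]_d).

Let triple (i : nat) (w : Omega) := (phi i w, eps i w, t i w).

Record assumption1 : Prop := {
  mudag_bounded : forall j, bounded_measurable01 (mudag j) ;
  p_ge0 : forall j, 0 <= p j ;
  p_sum1 : \sum_j p j = 1 ;
  data_model : forall i w, y i w = mudag (phi i w) (t i w) + eps i w ;
  label_law : forall i j, P [set w | phi i w = j] = (p j)%:E ;
  noise_law : forall i,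
    has_density (distribution P (eps i)) (lebesgue_rV d) setT phi0 ;
  time_in01 : forall i w, I01 (t i w) ;
  time_law : forall i,
    has_density (distribution P (t i)) (@lebesgue_measure R) I01 phiT ;
  components_independent : forall i,
    mutually_independent P (tnth [tuple g_sigma_algebra_preimage (phi i);
      g_sigma_algebra_preimage (eps i); g_sigma_algebra_preimage (t i)]) ;
  triples_independent :
    mutually_independent P (fun i => g_sigma_algebra_preimage (triple i)) ;
  triples_identically_distributed : identically_distributed P triple ;
  phi0_continuous : continuous phi0 ;
  phiT_continuous : {within I01, continuous phiT} }.

End assumptions.

Definition assumption2 {R : realType} {d : nat} (phi0 : 'rV[R]_d -> R) : Prop :=
  (forall i, \int[lebesgue_rV d]_x (x ord0 i * phi0 x)%:E = 0)%E /\
  (\int[lebesgue_rV d]_x (enorm x ^+ 2 * phi0 x)%:E < +oo)%E.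

Definition assumption3 {R : realType} {d : nat} (phi0 : 'rV[R]_d -> R) : Prop :=
  forall x, 0 < phi0 x.

(* Main.v *)
(* The integrands are not uniformly coercive, so the point is to bound the
   minimizers, for samples in an event of probability one. Comparison with a
   tuple of constants bounds the penalties. Suppose that of the trajectories of
   [mu n] those in [J] are bounded while the others are not. A trajectory with
   bounded penalty that is moderate at sufficiently many separated times is
   bounded everywhere, so the trajectories outside [J] are large except on few
   small time cells, which receive few samples. Replacing them by far away
   constants then costs almost nothing, and gains a fixed amount on the positive
   fraction of samples whose noise is close to one of the constants (the noise
   density is positive), contradicting minimality; induction on the cardinality
   of [J] bounds all of them. Weak compactness then follows from a Hilbert space
   argument. Weak limits are uniform limits, by the Hoelder bound, so that the
   empirical costs of the minimizers converge to the expected cost of the limit,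
   the penalty being weakly lower semicontinuous. The empirical cost converges
   to the expected cost for all equicontinuous tuples simultaneously, since the
   strong law applies to the countably many rational step functions. *)

Require Import Defs.
From HB Require Import structures.
From mathcomp Require Import all_boot all_order all_algebra finmap.
From mathcomp Require Import all_classical all_reals all_analysis.
From mathcomp Require Import measurable_realfun.
From mathcomp Require Import zify ring lra.

Set Implicit Arguments.
Unset Strict Implicit.
Unset Printing Implicit Defensive.

Import Order.TTheory GRing.Theory Num.Theory.
Import numFieldNormedType.Exports.

Local Open Scope classical_set_scope.
Local Open Scope ring_scope.

(** The minimizers are quantified inside the event of probability one, which therefore has to be
    fixed before them. Probability is confined to [regular_data], a list of deterministic properties
    that almost every sample has; everything about minimizers is deduced from it sample by sample.
    The law of large numbers must hold for all tuples at once, and since the cost is quadratic in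
    unbounded noise, nearby tuples are compared up to a factor [1 + e] instead of by a difference.
    Derivatives are limits of quotients, total by a default value and at the top order meaningful
    almost everywhere only, so that neither their linearity nor their measurability is formal. A
    function is replaced by its chain of derivatives, each a primitive of the next: initial values
    and an L^2 function determine a chain, which reduces completeness to that of the reals and of
    L^2. Functions equal almost everywhere are not identified, hence the Hilbert space arguments are
    made for semidefinite forms on a subset of a module of functions. *)

Section sequences.
Context {R : realType}.
Implicit Types (u v : nat -> R) (l : R).

Lemma cvg_seqP u l : u @ \oo --> l <->
  forall e, 0 < e -> exists N, forall n, (N <= n)%N -> `|u n - l| <= e.
Proof.
split.
  move=> /cvgrPdist_le h e e0; have [N _ hN] := h e e0.
  by exists N => n Nn; rewrite distrC; exact: hN.
move=> h; apply/cvgrPdist_le => e e0; have [N hN] := h e e0.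
by exists N => // n /= Nn; rewrite distrC; exact: hN.
Qed.

Lemma homo_ge_id (h : nat -> nat) : {homo h : m n / (m < n)%N} ->
  forall n, (n <= h n)%N.
Proof.
by move=> hh; elim=> // n IH; apply: leq_ltn_trans IH _; exact: hh.
Qed.

Lemma increasing_selection (P : nat -> nat -> Prop) :
  (forall n N, exists2 m, (N <= m)%N & P n m) ->
  exists h : nat -> nat, {homo h : m n / (m < n)%N} /\ forall n, P n (h n).
Proof.
move=> hP.
pose g n N := projT1 (cid2 (hP n N)).
have gN n N : (N <= g n N)%N by rewrite /g; case: cid2.
have gP n N : P n (g n N) by rewrite /g; case: cid2.
pose h := fix h n := if n is m.+1 then g n (h m).+1 else g 0%N 0%N.
exists h; split; last by case=> [|n] /=; exact: gP.
apply: homo_ltn; first by move=> a b c; exact: ltn_trans.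
by move=> n /=; exact: gN.
Qed.

(** The rows of [a] live in a product of segments, compact by Tychonoff. Every neighbourhood of a
    cluster point is visited at arbitrarily large indices; the [n]-th one constrains the first [n]
    coordinates up to [n.+1%:R^-1]. *)
Lemma diagonal_extraction (a : nat -> nat -> R) (M : nat -> R) :
  (forall n m, `|a n m| <= M m) ->
  exists h : nat -> nat, {homo h : m n / (m < n)%N} /\
    exists l : nat -> R, forall m, a (h n) m @[n --> \oo] --> l m.
Proof.
move=> aM.
have cK : compact [set f : prod_topology (fun _ : nat => R^o) |
    forall i, `[- M i, M i]%classic (f i)].
  have := @tychonoff nat (fun _ => R^o) (fun i => `[- M i, M i]%classic).
  by apply => i; exact: segment_compact.
have [|x [_ clx]] := cK ((a : nat -> prod_topology (fun _ : nat => R^o)) @ \oo).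
  exists 0%N => // n _ i /=; rewrite in_itv/= -ler_norml; exact: aM.
have [n N|h [hh hP]] := @increasing_selection
    (fun n k => forall m, (m < n)%N -> `|x m - a k m| < n.+1%:R^-1).
  pose U := [set f : prod_topology (fun _ : nat => R^o) |
    forall m, (m < n)%N -> `|x m - f m| < n.+1%:R^-1].
  have nU : nbhs x U.
    rewrite /U; elim: {1}n => [|j IH]; first exact: filterS filterT.
    have Hj : nbhs x [set f : prod_topology (fun _ : nat => R^o) |
        `|x j - f j| < n.+1%:R^-1].
      have := @proj_continuous nat (fun _ => R^o) j x.
      move=> /(_ [set y | `|x j - y| < n.+1%:R^-1]); apply.
      by apply: nbhsx_ballx; rewrite invr_gt0.
    apply: filterS (filterI IH Hj) => f [h1 h2] m /=.
    by rewrite ltnS leq_eqVlt => /orP[/eqP ->//|]; exact: h1.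
  have [|y [[k Nk <-] Uy]] := clx [set a k | k in [set k | (N <= k)%N]] U _ nU.
    by exists N => // k /= Nk; exists k.
  by exists k.
exists h; split=> //; exists x => m; apply/cvg_seqP => e e0.
pose N := Num.bound e^-1.
exists (maxn N m.+1) => n; rewrite geq_max => /andP[Nn mn].
rewrite distrC; apply/ltW/(lt_le_trans (hP n m mn)).
rewrite invf_ple ?posrE//; apply/ltW/(lt_le_trans (archi_boundP _)).
  by rewrite invr_ge0 ltW.
by rewrite ler_nat ltnW.
Qed.

End sequences.

(** * Weak compactness in semi-inner-product spaces *)

Section semi_inner_product.
Context {R : realType} {V : lmodType R}.

(** The laws are required on [S] only, because [V] will be a module of all functions, where
    integrals of products are meaningful on [S] alone; [B] is semidefinite because functions equal
    almost everywhere stay distinct. *)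
Record semi_inner_product (S : set V) (B : V -> V -> R) : Prop := {
  sip_closed : forall a u v, S u -> S v -> S (a *: u + v) ;
  sip_sym : forall u v, S u -> S v -> B u v = B v u ;
  sip_lin : forall a u v w, S u -> S v -> S w ->
    B (a *: u + v) w = a * B u w + B v w ;
  sip_ge0 : forall u, S u -> 0 <= B u u }.

Variables (S : set V) (B : V -> V -> R).
Hypothesis HB : semi_inner_product S B.

Let closed := sip_closed HB.
Let sym := sip_sym HB.
Let lin := sip_lin HB.
Let ge0 := sip_ge0 HB.

Lemma sip_subr u v : S u -> S v -> S (u - v).
Proof. by move=> Su Sv; rewrite addrC -scaleN1r; exact: closed. Qed.

Lemma sipBl u v w : S u -> S v -> S w -> B (u - v) w = B u w - B v w.
Proof.
by move=> Su Sv Sw; rewrite addrC -scaleN1r lin// mulN1r addrC.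
Qed.

Lemma sipBr u v w : S u -> S v -> S w -> B w (u - v) = B w u - B w v.
Proof.
move=> Su Sv Sw; rewrite sym//; last exact: sip_subr.
by rewrite sipBl// (sym Su)// (sym Sv).
Qed.

Lemma sip_sqrB u v : S u -> S v ->
  B (u - v) (u - v) = B u u - 2 * B u v + B v v.
Proof.
move=> Su Sv; have Suv := sip_subr Su Sv.
rewrite sipBl// !sipBr// (sym Sv Su); ring.
Qed.

Lemma sip_CS2 u v : S u -> S v -> B u v ^+ 2 <= B u u * B v v.
Proof.
move=> Su Sv; pose a := B u u; pose b := B u v; pose c := B v v.
have H t : 0 <= t ^+ 2 * c + 2 * t * b + a.
  have Suv : S (t *: v + u) by exact: closed.
  have := ge0 Suv; rewrite lin// (sym Sv Suv) (sym Su Suv) !lin//.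
  rewrite (sym Sv Su) -/a -/b -/c.
  by have -> : t * (t * c + b) + (t * b + a) = t ^+ 2 * c + 2 * t * b + a by ring.
have [c0|c0] := eqVneq c 0.
  suff b0 : b = 0 by rewrite -/a -/b -/c b0 c0 expr0n/= mulr0.
  apply/eqP/negPn/negP => b0.
  (* With [c = 0] the polynomial is affine; at this [t] its value is -1. *)
  have := H (- (a + 1) / (2 * b)); rewrite c0 mulr0 add0r.
  rewrite (_ : 2 * _ * b = - (a + 1)); last by field.
  lra.
have cp : 0 < c by rewrite lt_neqAle eq_sym c0 ge0.
have := H (- b / c).
have -> : (- b / c) ^+ 2 * c + 2 * (- b / c) * b + a = (a * c - b ^+ 2) / c.
  by field.
by rewrite pmulr_lge0 ?invr_gt0// subr_ge0.
Qed.

Lemma sip_CS u v : S u -> S v ->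
  `|B u v| <= Num.sqrt (B u u) * Num.sqrt (B v v).
Proof.
move=> Su Sv; rewrite -sqrtrM ?ge0// -sqrtr_sqr.
by apply: ler_wsqrtr; exact: sip_CS2.
Qed.

(** Written in the shape [a *: u + v], the one under which [S] is assumed closed. *)
Definition midpoint (u v : V) := 2^-1 *: (u - v) + v.

Lemma midpoint_closed u v : S u -> S v -> S (midpoint u v).
Proof. by move=> Su Sv; apply: closed => //; exact: sip_subr. Qed.

Lemma sip_midpointl u v w : S u -> S v -> S w ->
  B (midpoint u v) w = (B u w + B v w) / 2.
Proof.
move=> Su Sv Sw; rewrite lin ?sipBl//; last exact: sip_subr.
by field.
Qed.

Lemma sip_midpointr u v w : S u -> S v -> S w ->
  B w (midpoint u v) = (B w u + B w v) / 2.
Proof.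
move=> Su Sv Sw; rewrite sym//; last exact: midpoint_closed.
by rewrite sip_midpointl// (sym Su)// (sym Sv).
Qed.

Lemma sip_parallelogram u v : S u -> S v ->
  B (u - v) (u - v) =
  2 * B u u + 2 * B v v - 4 * B (midpoint u v) (midpoint u v).
Proof.
move=> Su Sv; have Sm := midpoint_closed Su Sv.
by rewrite sip_sqrB// sip_midpointl// !sip_midpointr// (sym Sv Su); field.
Qed.

Lemma sip_sqrD_le u v : S u -> S v ->
  B (u - v) (u - v) <= 2 * B u u + 2 * B v v.
Proof.
move=> Su Sv; rewrite sip_parallelogram// lerBlDr lerDl mulr_ge0//.
exact/ge0/midpoint_closed.
Qed.

(** The convex hull of the tail from [n] with dyadic weights: midpoints are all that the
    parallelogram identity asks for. Being an intersection, it comes with its induction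
    principle. *)
Definition midpoint_hull (w : nat -> V) (n : nat) : set V :=
  [set v | forall C : set V, (forall m, (n <= m)%N -> C (w m)) ->
    (forall u v, C u -> C v -> C (midpoint u v)) -> C v].

Lemma midpoint_hull_in w n m : (n <= m)%N -> midpoint_hull w n (w m).
Proof. by move=> nm C hC _; exact: hC. Qed.

Lemma midpoint_hull_mid w n u v : midpoint_hull w n u -> midpoint_hull w n v ->
  midpoint_hull w n (midpoint u v).
Proof. by move=> hu hv C h1 h2; apply: (h2); [apply: hu|apply: hv]. Qed.

Lemma midpoint_hull_mono w n m : (n <= m)%N ->
  midpoint_hull w m `<=` midpoint_hull w n.
Proof.
by move=> nm v hv C h1 h2; apply: hv => // k mk; apply: h1; exact: leq_trans mk.
Qed.

Lemma midpoint_hull_sub w n : (forall m, S (w m)) -> midpoint_hull w n `<=` S.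
Proof.
by move=> Sw v; apply => // u u'; exact: midpoint_closed.
Qed.

Definition sip_complete := forall u : nat -> V, (forall n, S (u n)) ->
  (forall e : R, 0 < e -> exists N, forall m n, (N <= m)%N -> (N <= n)%N ->
    B (u m - u n) (u m - u n) <= e) ->
  exists v, S v /\ forall e : R, 0 < e -> exists N, forall n, (N <= n)%N ->
    B (u n - v) (u n - v) <= e.

Hypothesis complete : sip_complete.

(* Near-minimisers of the norm on the decreasing hulls form a Cauchy sequence
   by the parallelogram identity. *)
Lemma mazur w C : (forall n, S (w n)) -> (forall n, B (w n) (w n) <= C) ->
  exists x v, [/\ forall n, midpoint_hull w n (x n), S v &
    forall e : R, 0 < e -> exists N, forall n, (N <= n)%N ->
      B (x n - v) (x n - v) <= e].
Proof.
move=> Sw wC.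
pose E n := [set B u u | u in midpoint_hull w n].
have Enz n : E n !=set0 by exists (B (w n) (w n)); exists (w n) => //; exact: midpoint_hull_in.
have Elb n : has_lbound (E n).
  by exists 0 => _ [u hu <-]; apply: ge0; exact: midpoint_hull_sub hu.
pose dd n := inf (E n).
have dmin n u : midpoint_hull w n u -> dd n <= B u u.
  by move=> hu; apply: ge_inf => //; exists u.
have dnd n m : (n <= m)%N -> dd n <= dd m.
  move=> nm; apply: lb_le_inf => // _ [u hu <-]; apply: dmin.
  exact: midpoint_hull_mono hu.
have dC n : dd n <= C.
  by apply: le_trans (wC n); apply: dmin; exact: midpoint_hull_in.
have dcvg : cvgn dd.
  apply: nondecreasing_is_cvgn; first by move=> n m nm; exact: dnd.
  by exists C => _ [n _ <-].
have hx n : {u | midpoint_hull w n u & B u u < dd n + n.+1%:R^-1}.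
  apply: cid2.
  have i0 : 0 < n.+1%:R^-1 :> R by rewrite invr_gt0.
  by have [_ [u hu <-] hlt] := inf_adherent i0 (conj (Enz n) (Elb n)); exists u.
pose x n := s2val (hx n).
have xh n : midpoint_hull w n (x n) by exact: s2valP.
have xd n : B (x n) (x n) < dd n + n.+1%:R^-1 by exact: (s2valP' (hx n)).
have Sx n : S (x n) by exact: midpoint_hull_sub (xh n).
(* The midpoint lies in the hull of index [n], so its square is at least [dd n]; the parallelogram
   identity leaves [dd m - dd n] and the slack of the two near-minimisers. *)
have key n m : (n <= m)%N -> B (x n - x m) (x n - x m) <=
    2 * (dd m - dd n) + 4 * n.+1%:R^-1.
  move=> nm; rewrite sip_parallelogram//.
  have h1 := dmin n (midpoint (x n) (x m)) (midpoint_hull_mid (xh n) (midpoint_hull_mono nm (xh m))).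
  have h2 := xd n; have h3 := xd m.
  have h4 : m.+1%:R^-1 <= n.+1%:R^-1 :> R by rewrite lef_pV2 ?posrE// ler_nat.
  by move: h2 h3 h4; move: (n.+1%:R^-1) (m.+1%:R^-1) => a b; lra.
have [|v [Sv hv]] := complete Sx; last by exists x, v.
move=> e e0.
have /cvg_seqP hl := dcvg.
have [N1 hN1] := hl (e / 8) (divr_gt0 e0 (ltr0n _ 8)).
pose N := maxn N1 (Num.bound (e / 8)^-1).
have kN n m : (N <= n)%N -> (n <= m)%N -> B (x n - x m) (x n - x m) <= e.
  move=> Nn nm; apply: le_trans (key _ _ nm) _.
  have Nn1 : (N1 <= n)%N by apply: leq_trans Nn; rewrite leq_maxl.
  have := hN1 _ Nn1; have := hN1 _ (leq_trans Nn1 nm).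
  rewrite !ler_norml => /andP[a1 a2] /andP[a3 a4].
  have : n.+1%:R^-1 <= e / 8.
    rewrite invf_ple ?posrE ?divr_gt0//.
    apply/ltW/(lt_le_trans (archi_boundP _)).
      by rewrite invr_ge0 ltW// divr_gt0.
    rewrite ler_nat; apply: leqW; apply: leq_trans Nn; exact: leq_maxr.
  by move: (n.+1%:R^-1) => a; lra.
exists N => m n Nm Nn; have [mn|/ltnW nm] := leqP m n; first exact: kN.
have -> : B (x m - x n) (x m - x n) = B (x n - x m) (x n - x m).
  by rewrite !sip_sqrB// (sym (Sx m) (Sx n)); ring.
exact: kN.
Qed.

(** An interval is stable under midpoints, so a bound valid on the tail survives on its hull. *)
Lemma sip_hull_le w n (c : V -> R) l e :
  (forall m, S (w m)) ->
  (forall u v, S u -> S v -> c (midpoint u v) = (c u + c v) / 2) ->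
  (forall m, (n <= m)%N -> `|c (w m) - l| <= e) ->
  forall u, midpoint_hull w n u -> `|c u - l| <= e.
Proof.
move=> Sw cmid cw u hu.
suff [] : S u /\ `|c u - l| <= e by [].
apply: (hu [set u | S u /\ `|c u - l| <= e]) => [m nm|x y [Sx cx] [Sy cy]].
  by split => //; exact: cw.
split; first exact: midpoint_closed.
rewrite cmid//; move: cx cy; rewrite !ler_norml => /andP[? ?] /andP[? ?].
lra.
Qed.

(** The [z n] being bounded, Cauchy-Schwarz makes the set of [x] for which [B (z n) x] tends to 0
    closed. *)
Lemma sip_le_cvg (z : nat -> V) C : (forall n, S (z n)) ->
  (forall n, B (z n) (z n) <= C) ->
  forall x, S x -> (forall e, 0 < e -> exists2 y, S y & B (y - x) (y - x) <= e /\
    B (z n) y @[n --> \oo] --> 0) ->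
  B (z n) x @[n --> \oo] --> 0.
Proof.
move=> Sz zC x Sx H; apply/cvg_seqP => e e0.
have C0 : 0 <= C by apply: le_trans (zC 0%N); exact: ge0.
have C1 : 0 < Num.sqrt C + 1 by rewrite ltr_wpDl ?sqrtr_ge0.
pose f := (e / 2 / (Num.sqrt C + 1)).
have f0 : 0 < f by rewrite !divr_gt0.
have [y Sy [yx /cvg_seqP zy]] := H (f ^+ 2) (exprn_gt0 _ f0).
have [N hN] := zy (e / 2) (divr_gt0 e0 (ltr0n _ 2)).
exists N => n /hN; rewrite !subr0 => h1.
have -> : B (z n) x = B (z n) y - B (z n) (y - x) by rewrite sipBr//; ring.
apply: (le_trans (ler_normB _ _)).
rewrite (splitr e) lerD//.
apply: (le_trans (sip_CS (Sz n) (sip_subr Sy Sx))).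
have h2 : Num.sqrt (B (y - x) (y - x)) <= f.
  by rewrite -(ger0_norm (ltW f0)) -sqrtr_sqr ler_wsqrtr.
apply: (@le_trans _ _ ((Num.sqrt C + 1) * f)).
  apply: ler_pM; rewrite ?sqrtr_ge0//.
  by apply: le_trans (ler_wsqrtr (zC n)) _; rewrite lerDl.
by rewrite /f mulrC divfK// gt_eqF.
Qed.

Definition sip_dual (L : V -> R) :=
  (forall a u v, S u -> S v -> L (a *: u + v) = a * L u + L v) /\
  exists C : R, forall u, S u -> `|L u| <= C * Num.sqrt (B u u).

(* The Banach-Saks argument: hulls of the [z n] contain elements of small norm,
   on which [L] is small. *)
Lemma sip_weak_cvg0 (z : nat -> V) C : (forall n, S (z n)) ->
  (forall n, B (z n) (z n) <= C) ->
  (forall m, B (z n) (z m) @[n --> \oo] --> 0) ->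
  forall L, sip_dual L -> L (z n) @[n --> \oo] --> 0.
Proof.
move=> Sz zC zz L [Llin [K LK]]; apply/cvg_seqP => e e0.
apply: contrapT => /forallNP hN.
have {}hN N : exists n, (N <= n)%N /\ e < `|L (z n)|.
  have /existsNP[n /not_implyP[Nn /negP]] := hN N.
  by rewrite subr0 -ltNge => ?; exists n.
pose h N := projT1 (cid (hN N)).
have hh N : (N <= h N)%N by rewrite /h; case: cid => ? [].
have hL N : e < `|L (z (h N))| by rewrite /h; case: cid => ? [].
have S0 : S 0 by rewrite -(subrr (z 0%N)); exact: sip_subr.
have SZ a u : S u -> S (a *: u) by move=> Su; rewrite -[_ *: _]addr0; exact: closed.
have L0 : L 0 = 0.
  have := Llin (-1) _ _ S0 S0; rewrite scaleN1r addNr => ->.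
  by rewrite mulN1r addNr.
have LZ a u : S u -> L (a *: u) = a * L u.
  by move=> Su; rewrite -[a *: u]addr0 Llin// L0 addr0.
have B0l u : S u -> B 0 u = 0.
  by move=> Su; rewrite -(subrr u) sipBl// subrr.
have BZl a u v : S u -> S v -> B (a *: u) v = a * B u v.
  by move=> Su Sv; rewrite -[a *: u]addr0 lin// B0l// addr0.
have BZr a u v : S u -> S v -> B v (a *: u) = a * B v u.
  move=> Su Sv; rewrite sym//; last exact: SZ.
  by rewrite BZl// sym.
(* The signs make [L] at least [e] on every [y N], a bound that survives on hulls; for fixed [m],
   [B (y k) (y m)] still tends to 0. *)
pose y N := Num.sg (L (z (h N))) *: z (h N).
have Sy N : S (y N) by exact: SZ.
have Ly N : e <= L (y N) by rewrite LZ// -normrEsg ltW.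
have sg1 N : Num.sg (L (z (h N))) ^+ 2 = 1.
  by rewrite sqr_sg; have := lt_trans e0 (hL N); rewrite normr_gt0 => ->.
have yC N : B (y N) (y N) <= C.
  by rewrite BZl// BZr// mulrA -expr2 sg1 mul1r.
have [x [v [xh Sv xv]]] := mazur Sy yC.
have Sx n : S (x n) by apply: midpoint_hull_sub (xh n).
have vy m : B v (y m) = 0.
  apply/eqP; rewrite -normr_le0; apply/ler_addgt0Pl => f f0; rewrite addr0.
  suff H : B (x n) (y m) @[n --> \oo] --> 0.
    suff H2 : B (x n) (y m) @[n --> \oo] --> B v (y m).
      by rewrite (cvg_unique _ H2 H)// normr0 ltW.
    apply/cvg_seqP => g g0.
    have D0 : 0 < Num.sqrt C + 1 by rewrite ltr_wpDl ?sqrtr_ge0.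
    have [N hNx] := xv ((g / (Num.sqrt C + 1)) ^+ 2) (exprn_gt0 _ (divr_gt0 g0 D0)).
    exists N => n /hNx h1; rewrite -sipBl//.
    apply: (le_trans (sip_CS (sip_subr (Sx n) Sv) (Sy m))).
    have h2 : Num.sqrt (B (x n - v) (x n - v)) <= g / (Num.sqrt C + 1).
      rewrite -(ger0_norm (ltW (divr_gt0 g0 D0))) -sqrtr_sqr; exact: ler_wsqrtr.
    apply: (@le_trans _ _ (g / (Num.sqrt C + 1) * (Num.sqrt C + 1))).
      apply: ler_pM; rewrite ?sqrtr_ge0//.
      by apply: le_trans (ler_wsqrtr (yC m)) _; rewrite lerDl.
    by rewrite divfK// gt_eqF.
  apply/cvg_seqP => g g0.
  have /cvg_seqP/(_ g g0)[N hNz] := zz (h m).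
  exists N => n Nn.
  apply: (@sip_hull_le y n (fun u => B u (y m))) (xh n) => //.
    by move=> u u' Su Su'; rewrite sip_midpointl.
  move=> k nk; rewrite subr0 BZl// BZr// mulrA normrM.
  have := hNz (h k) (leq_trans Nn (leq_trans nk (hh k))); rewrite subr0.
  apply: le_trans; rewrite ler_piMl// normrM !normr_sg.
  by rewrite -natrM -[1]/1%:R ler_nat; case: (_ != 0); case: (_ != 0).
(* [v] is orthogonal to each [y m], hence to the hulls, hence to their limit [v]. So the [x n]
   become small, against [e <= L (x n)]. *)
have vv : B v v = 0.
  have Hx n : B v (x n) = 0.
    apply/eqP; rewrite -normr_le0 -(subr0 (B _ _)).
    apply: (@sip_hull_le y n (fun u => B v u)) (xh n) => //.
      by move=> u u' Su Su'; rewrite sip_midpointr.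
    by move=> m _; rewrite subr0 vy normr0.
  apply/eqP; rewrite eq_le ge0// andbT; apply/ler_addgt0Pl => f f0; rewrite addr0.
  have [N hNx] := xv f f0.
  have := hNx N (leqnn N); rewrite sip_sqrB// (sym (Sx N) Sv) Hx.
  by have := ge0 (Sx N); lra.
have Lx n : e <= L (x n).
  suff [] : S (x n) /\ e <= L (x n) by [].
  apply: (xh n [set u | S u /\ e <= L u]) => [m _|u u' [Su Lu] [Su' Lu']]; first by [].
  split; first exact: midpoint_closed.
  have Suu : S (u - u') by exact: sip_subr.
  have LB : L (u - u') = L u - L u'.
    by rewrite [u - u']addrC -scaleN1r Llin// mulN1r addrC.
  by rewrite /midpoint Llin// LB; lra.
have K0 : 0 < `|K| + 1 by rewrite ltr_wpDl.
have [N hNx] := xv ((e / 2 / (`|K| + 1)) ^+ 2) (exprn_gt0 _ (divr_gt0 (divr_gt0 e0 (ltr0n _ 2)) K0)).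
have := hNx N (leqnn N); rewrite sip_sqrB// vv.
have /eqP -> : B (x N) v == 0.
  rewrite -normr_le0; apply: le_trans (sip_CS (Sx N) Sv) _.
  by rewrite vv sqrtr0 mulr0.
rewrite mulr0 subr0 addr0 => hx.
have hx2 : Num.sqrt (B (x N) (x N)) <= e / 2 / (`|K| + 1).
  rewrite -(ger0_norm (ltW (divr_gt0 (divr_gt0 e0 (ltr0n _ 2)) K0))) -sqrtr_sqr.
  exact: ler_wsqrtr.
have := LK _ (Sx N); rewrite ler_norml => /andP[_ h1].
have h2 : K * Num.sqrt (B (x N) (x N)) <= (`|K| + 1) * (e / 2 / (`|K| + 1)).
  apply: (@le_trans _ _ ((`|K| + 1) * Num.sqrt (B (x N) (x N)))).
    rewrite ler_wpM2r ?sqrtr_ge0//; have := ler_norm K; lra.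
  by rewrite ler_wpM2l// ltW.
have h3 : (`|K| + 1) * (e / 2 / (`|K| + 1)) = e / 2.
  by rewrite mulrC divfK// gt_eqF.
have := Lx N; lra.
Qed.

(** Along a subsequence every column of the Gram matrix converges. The strong limit [v] of hull
    elements has these limits as its products with the sequence; hence the products of the
    differences [u (h n) - v] with any fixed one of them tend to 0 and [sip_weak_cvg0] applies. *)
Theorem sip_weak_compact (u : nat -> V) C : (forall n, S (u n)) ->
  (forall n, B (u n) (u n) <= C) ->
  exists h : nat -> nat, {homo h : m n / (m < n)%N} /\
  exists v, S v /\ forall L, sip_dual L -> L (u (h n)) @[n --> \oo] --> L v.
Proof.
move=> Su uC.
have [|h [hh [l hl]]] := @diagonal_extraction _ (fun n m => B (u n) (u m)) (fun=> C).
  move=> n m; apply: le_trans (sip_CS (Su n) (Su m)) _.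
  rewrite -sqrtrM ?ge0//.
  have C0 : 0 <= C by apply: le_trans (uC 0%N); exact: ge0.
  rewrite -[leRHS](ger0_norm C0) -sqrtr_sqr ler_wsqrtr// expr2 ler_pM ?ge0//.
exists h; split => //.
pose w n := u (h n).
have Sw n : S (w n) by exact: Su.
have wC n : B (w n) (w n) <= C by exact: uC.
have [x [v [xh Sv xv]]] := mazur Sw wC.
have Sx n : S (x n) by apply: midpoint_hull_sub (xh n).
have vw m : B v (w m) = l (h m).
  have H : B (x n) (w m) @[n --> \oo] --> l (h m).
    apply/cvg_seqP => g g0.
    have /cvg_seqP/(_ g g0)[N hNz] := hl (h m).
    exists N => n Nn.
    apply: (@sip_hull_le w n (fun u => B u (w m))) (xh n) => //.
      by move=> a b Sa Sb; rewrite sip_midpointl.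
    by move=> k nk; apply: hNz; exact: leq_trans nk.
  apply: cvg_unique H => //.
  rewrite -[B v (w m)]add0r; apply/cvg_seqP => g g0.
  have D0 : 0 < Num.sqrt C + 1 by rewrite ltr_wpDl ?sqrtr_ge0.
  have [N hNx] := xv ((g / (Num.sqrt C + 1)) ^+ 2) (exprn_gt0 _ (divr_gt0 g0 D0)).
  exists N => n /hNx h1; rewrite add0r -sipBl//.
  apply: (le_trans (sip_CS (sip_subr (Sx n) Sv) (Sw m))).
  have h2 : Num.sqrt (B (x n - v) (x n - v)) <= g / (Num.sqrt C + 1).
    rewrite -(ger0_norm (ltW (divr_gt0 g0 D0))) -sqrtr_sqr; exact: ler_wsqrtr.
  apply: (@le_trans _ _ (g / (Num.sqrt C + 1) * (Num.sqrt C + 1))).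
    apply: ler_pM; rewrite ?sqrtr_ge0//.
    by apply: le_trans (ler_wsqrtr (wC m)) _; rewrite lerDl.
  by rewrite divfK// gt_eqF.
exists v; split => // L dL.
pose z n := w n - v.
have Sz n : S (z n) by exact: sip_subr.
have zC n : B (z n) (z n) <= 2 * C + 2 * B v v.
  by apply: le_trans (sip_sqrD_le (Sw n) Sv) _; rewrite lerD2r ler_wpM2l.
have zw m : B (z n) (w m) @[n --> \oo] --> 0.
  rewrite -(subrr (l (h m))) -{2}vw.
  rewrite (_ : (fun n => _) = (fun n => B (w n) (w m) - B v (w m))).
    by apply: cvgB; [exact: hl|exact: cvg_cst].
  by apply/funext => n; rewrite sipBl.
have zx k : B (z n) (x k) @[n --> \oo] --> 0.
  suff [] : S (x k) /\ B (z n) (x k) @[n --> \oo] --> 0 by [].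
  apply: (xh k [set x | S x /\ B (z n) x @[n --> \oo] --> 0]) => //.
  move=> a b [Sa Ha] [Sb Hb]; split; first exact: midpoint_closed.
  rewrite (_ : (fun n => _) = (fun n => (B (z n) a + B (z n) b) * 2^-1)).
    rewrite -(mul0r 2^-1) -[X in X * _](addr0 0).
    by apply: cvgMl; apply: cvgD.
  by apply/funext => n; rewrite sip_midpointr.
have zv : B (z n) v @[n --> \oo] --> 0.
  apply: (sip_le_cvg Sz zC Sv) => e e0.
  have [N hN] := xv e e0; exists (x N) => //; split; last exact: zx.
  exact: hN.
have zz m : B (z n) (z m) @[n --> \oo] --> 0.
  rewrite (_ : (fun n => _) = (fun n => B (z n) (w m) - B (z n) v)).
    by rewrite -(subrr 0); apply: cvgB.
  by apply/funext => n; rewrite sipBr.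
have := sip_weak_cvg0 Sz zC zz dL => H.
have [Llin _] := dL.
have LB n : L (w n) = L (z n) + L v.
  have := Llin 1 (z n) v (Sz n) Sv; rewrite scale1r mul1r /z subrK; exact.
rewrite (_ : (fun n => _) = (fun n => L (z n) + L v)); last exact/funext.
by rewrite -[X in _ --> X]add0r; apply: cvgD => //; exact: cvg_cst.
Qed.

End semi_inner_product.

(** * Lower limits and the completeness of L^2 *)

Lemma le_limn_einf {R : realType} (u : nat -> \bar R) c :
  (forall n, c <= u n)%E -> (c <= limn_einf u)%E.
Proof.
move=> cu; rewrite limn_einf_lim; apply: lime_ge; first exact: is_cvg_einfs.
by apply: nearW => n; apply: le_ereal_inf_tmp => _ [m _ <-].
Qed.

Lemma limn_einf_le {R : realType} (u : nat -> \bar R) c N :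
  (forall n, (N <= n)%N -> u n <= c)%E -> (limn_einf u <= c)%E.
Proof.
move=> uc; rewrite limn_einf_lim; apply: lime_le; first exact: is_cvg_einfs.
apply: nearW => n; apply: le_trans (uc (maxn N n) (leq_maxl _ _)).
by apply: ereal_inf_lbound; exists (maxn N n) => //=; exact: leq_maxr.
Qed.

Lemma cvg_geometric_increments {R : realType} (a : nat -> R) N :
  (forall k, (N <= k)%N -> `|a k.+1 - a k| <= 2^-1 ^+ k) -> cvgn a.
Proof.
move=> ha.
have H k j : (N <= k)%N -> `|a (k + j)%N - a k| <= 2 * 2^-1 ^+ k - 2 * 2^-1 ^+ (k + j).
  move=> Nk; elim: j => [|j IH]; first by rewrite addn0 !subrr normr0.
  have -> : a (k + j.+1)%N - a k =
      (a (k + j).+1 - a (k + j)%N) + (a (k + j)%N - a k) by rewrite addnS; ring.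
  apply: le_trans (ler_normD _ _) _.
  apply: le_trans (lerD (ha _ (leq_trans Nk (leq_addr j k))) IH) _.
  by rewrite addnS exprS; move: (_ ^+ (k + j)) (_ ^+ k) => x y; lra.
apply/cauchy_cvgP/cauchy_exP => e e0.
have : (2^-1 : R) ^+ n @[n --> \oo] --> 0.
  by apply: cvg_expr; rewrite ger0_norm; lra.
move=> /cvg_seqP/(_ (e / 4) (divr_gt0 e0 (ltr0n _ 4)))[M hM].
exists (a (maxn N M)); exists (maxn N M) => // n /= Mn.
rewrite /ball/= distrC -(subnKC Mn).
apply: le_lt_trans (H _ _ (leq_maxl _ _)) _.
have := hM _ (leq_maxr N M); rewrite subr0 ger0_norm ?exprn_ge0//.
have : (0 : R) <= 2^-1 ^+ (maxn N M + (n - maxn N M)) by rewrite exprn_ge0.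
by move: (_ ^+ (maxn N M)) (_ ^+ (_ + _)) => x y; lra.
Qed.

Section integration.
Context {d : measure_display} {T : measurableType d} {R : realType}.
Variable mu : {measure set T -> \bar R}.
Implicit Types (D : set T) (f g : T -> R).

(** The sum of the series has integral at most [C], hence is finite almost everywhere, and the terms
    of a convergent series tend to 0. It serves both the completeness of L^2 and the strong law. *)
Lemma ae_cvg0_summable D (f : nat -> T -> R) (C : R) : measurable D ->
  (forall n, measurable_fun D (f n)) -> (forall n x, D x -> 0 <= f n x) ->
  (forall N, \sum_(n < N) \int[mu]_(x in D) (f n x)%:E <= C%:E)%E ->
  {ae mu, forall x, D x -> f n x @[n --> \oo] --> 0}.
Proof.
move=> mD mf f0 fC.
pose g : T -> \bar R := fun x => (\sum_(0 <= n <oo) (f n x)%:E)%E.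
have g0 x : D x -> (0 <= g x)%E.
  by move=> Dx; apply: nneseries_ge0 => n _ _; rewrite lee_fin f0.
have mg : measurable_fun D g.
  by apply: ge0_emeasurable_sum => // [k x Dx _|k _]; rewrite ?lee_fin ?f0//; exact/measurable_EFinP.
have ig : mu.-integrable D g.
  apply/integrableP; split=> //.
  rewrite (eq_integral g); last by move=> x /[!inE] Dx; rewrite gee0_abs// g0.
  rewrite integral_nneseries//; last by move=> n; exact/measurable_EFinP.
  apply: (@le_lt_trans _ _ C%:E); last exact: ltry.
  apply: lime_le.
    by apply: is_cvg_nneseries => n _ _; apply: integral_ge0 => x Dx; rewrite lee_fin f0.
  by apply: nearW => N; rewrite big_mkord; exact: fC.
have := integrable_ae mD ig.
apply: filterS => x gx Dx; have {}gx := gx Dx.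
apply: cvg_series_cvg_0; apply: nondecreasing_is_cvgn.
  apply/nondecreasing_seqP => n; rewrite /series/= big_nat_recr//= lerDl; exact: f0.
exists (fine (g x)) => _ [n _ <-]; rewrite -lee_fin fineK//.
rewrite /series/= -sumEFin; apply: nneseries_lim_ge => k _ _.
by rewrite lee_fin f0.
Qed.

Definition sqint D f := measurable_fun D f /\
  (\int[mu]_(x in D) (f x ^+ 2)%:E < +oo)%E.

Lemma sqintP D f : measurable D -> sqint D f <->
  measurable_fun D f /\ mu.-integrable D (EFin \o (fun x => f x ^+ 2)).
Proof.
move=> mD; split=> -[mf h]; split=> //.
  apply/integrableP; split; first exact/measurable_EFinP/measurable_funX.
  by under eq_integral do rewrite gee0_abs ?lee_fin ?sqr_ge0//.
case/integrableP : h => _.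
by under eq_integral do rewrite gee0_abs ?lee_fin ?sqr_ge0//.
Qed.

Lemma sqint_integrable D f : measurable D -> sqint D f ->
  mu.-integrable D (EFin \o (fun x => f x ^+ 2)).
Proof. by move=> mD /(sqintP _ mD)[]. Qed.

Lemma sqint_integralE D f : measurable D -> sqint D f ->
  (\int[mu]_(x in D) (f x ^+ 2)%:E)%E = (\int[mu]_(x in D) (f x ^+ 2))%:E.
Proof.
move=> mD /(sqint_integrable mD) h; rewrite /Rintegral fineK//.
exact: integrable_fin_num.
Qed.

Lemma sqint_mul D f g : measurable D -> sqint D f -> sqint D g ->
  mu.-integrable D (EFin \o (fun x => f x * g x)).
Proof.
move=> mD hf hg; have [mf _] := hf; have [mg _] := hg.
have /= := integrableD mD (sqint_integrable mD hf) (sqint_integrable mD hg).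
apply: le_integrable => //; first exact/measurable_EFinP/measurable_funM.
move=> x Dx /=; rewrite lee_fin normrM [leRHS]ger0_norm ?addr_ge0 ?sqr_ge0//.
rewrite -(real_normK (num_real (f x))) -(real_normK (num_real (g x))).
have := sqr_ge0 (`|f x| - `|g x|); have := sqr_ge0 `|f x|; have := sqr_ge0 `|g x|.
rewrite sqrrB; lra.
Qed.

Lemma sqint_lin D a f g : measurable D -> sqint D f -> sqint D g ->
  sqint D (fun x => a * f x + g x).
Proof.
move=> mD hf hg; have [mf _] := hf; have [mg _] := hg.
apply/sqintP => //; split.
  by apply: measurable_funD => //; apply: measurable_funM.
have /= := integrableD mD (integrableZl mD (2 * a ^+ 2) (sqint_integrable mD hf))
  (integrableZl mD 2 (sqint_integrable mD hg)).
apply: le_integrable => //.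
  apply/measurable_EFinP/measurable_funX.
  by apply: measurable_funD => //; apply: measurable_funM.
move=> x Dx /=; rewrite lee_fin [leLHS]ger0_norm ?sqr_ge0//.
have h0 : 0 <= 2 * a ^+ 2 * f x ^+ 2 + 2 * g x ^+ 2.
  by have := sqr_ge0 (a * f x); have := sqr_ge0 (g x); rewrite exprMn; lra.
rewrite (ger0_norm h0).
have := sqr_ge0 (a * f x - g x); rewrite sqrrB sqrrD exprMn; lra.
Qed.

Lemma sqint_sip D : measurable D -> semi_inner_product (V := T -> R) (sqint D)
  (fun f g => \int[mu]_(x in D) (f x * g x)).
Proof.
move=> mD; split.
- by move=> a f g hf hg; exact: sqint_lin.
- by move=> f g _ _; apply: eq_Rintegral => x _; rewrite mulrC.
- move=> a f g h hf hg hh.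
  have -> : \int[mu]_(x in D) ((a *: f + g) x * h x) =
      \int[mu]_(x in D) (a * (f x * h x) + g x * h x).
    by apply: eq_Rintegral => x _; rewrite mulrA -mulrDl.
  rewrite RintegralD//; last exact: sqint_mul.
    by rewrite RintegralZl//; exact: sqint_mul.
  exact: (integrableZl mD a (sqint_mul mD hf hh)).
- by move=> f _; apply: Rintegral_ge0 => x _; rewrite -expr2 sqr_ge0.
Qed.

Lemma sqint_CS D f g : measurable D -> sqint D f -> sqint D g ->
  `|\int[mu]_(x in D) (f x * g x)| <=
  Num.sqrt (\int[mu]_(x in D) (f x ^+ 2)) * Num.sqrt (\int[mu]_(x in D) (g x ^+ 2)).
Proof. by move=> mD hf hg; exact: (sip_CS (sqint_sip mD)). Qed.

Lemma sqintB D f g : measurable D -> sqint D f -> sqint D g ->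
  sqint D (fun x => f x - g x).
Proof.
move=> mD hf hg; have := sqint_lin (-1) mD hg hf.
by congr (sqint D _); apply/funext => x; rewrite mulN1r addrC.
Qed.

(** Riesz-Fischer. Along a subsequence with squared distances at most [8%:R ^- k] the increments are
    almost everywhere eventually below [2^-1 ^+ k]; Fatou's lemma then bounds the distance of the
    full sequence to the pointwise limit. *)
Lemma sqint_complete D (u : nat -> T -> R) : measurable D ->
  (forall n, sqint D (u n)) ->
  (forall e : R, 0 < e -> exists N, forall m n, (N <= m)%N -> (N <= n)%N ->
    \int[mu]_(x in D) ((u m x - u n x) ^+ 2) <= e) ->
  exists v, sqint D v /\ forall e : R, 0 < e -> exists N, forall n, (N <= n)%N ->
    \int[mu]_(x in D) ((u n x - v x) ^+ 2) <= e.
Proof.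
move=> mD hu hC.
have mu_ n : measurable_fun D (u n) by have [] := hu n.
have [h hh] : exists h : nat -> nat, {homo h : m n / (m < n)%N} /\
    forall k, forall m n, (h k <= m)%N -> (h k <= n)%N ->
      \int[mu]_(x in D) ((u m x - u n x) ^+ 2) <= 8%:R ^- k.
  pose P k N := forall m n, (N <= m)%N -> (N <= n)%N ->
      \int[mu]_(x in D) ((u m x - u n x) ^+ 2) <= 8%:R ^- k.
  have [|h [h1 h2]] := @increasing_selection P; last by exists h.
  move=> k N; have [|N' hN'] := hC (8%:R ^- k).
    by rewrite invr_gt0 exprn_gt0.
  exists (maxn N N'); rewrite ?leq_maxl// => m n; rewrite !geq_max.
  by move=> /andP[_ ?] /andP[_ ?]; exact: hN'.
have [hinc hk] := hh.
have hS k : (h k <= h k.+1)%N by rewrite ltnW// hinc.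
have sB m n : sqint D (fun x => u m x - u n x) by exact: sqintB.
(* The integral of [f k] is at most [4 ^+ k * 8%:R ^- k], which is summable; where [f k x] is at
   most 1, the increment is at most [2^-1 ^+ k]. *)
pose f k x := 4 ^+ k * (u (h k) x - u (h k.+1) x) ^+ 2.
have f0 k x : 0 <= f k x by rewrite mulr_ge0 ?sqr_ge0 ?exprn_ge0.
have fE k : (\int[mu]_(x in D) (f k x)%:E)%E =
    (4 ^+ k * \int[mu]_(x in D) ((u (h k) x - u (h k.+1) x) ^+ 2))%:E.
  under eq_integral do rewrite EFinM.
  rewrite ge0_integralZl_EFin//.
  - by rewrite sqint_integralE.
  - by move=> x _; rewrite lee_fin sqr_ge0.
  - by apply/measurable_EFinP/measurable_funX; have [] := sB (h k) (h k.+1).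
have : {ae mu, forall x, D x -> f n x @[n --> \oo] --> 0}.
  apply: (@ae_cvg0_summable D f 2) => //.
    move=> k; apply: measurable_funM => //; apply: measurable_funX.
    by have [] := sB (h k) (h k.+1).
  move=> N; under eq_bigr do rewrite fE; rewrite sumEFin lee_fin.
  apply: (@le_trans _ _ (\sum_(i < N) (2^-1 : R) ^+ i)).
    apply: ler_sum => i _.
    apply: (@le_trans _ _ (4 ^+ i * 8%:R ^- i)).
      by rewrite ler_wpM2l ?exprn_ge0// hk.
    rewrite -exprVn -exprMn; apply: lerXn2r; rewrite ?nnegrE//; lra.
  elim: N => [|N IH]; first by rewrite big_ord0.
  have H n : \sum_(i < n) (2^-1 : R) ^+ i = 2 - 2 * 2^-1 ^+ n.
    elim: n => [|n IHn]; first by rewrite big_ord0 expr0; lra.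
    by rewrite big_ord_recr/= IHn exprS; move: (_ ^+ n) => a; lra.
  by rewrite H lerBlDr lerDl mulr_ge0// exprn_ge0.
move=> aecvg.
(* An upper limit is measurable whether or not the subsequence converges; where it diverges, a null
   set, the value of [v] does not matter. *)
pose v x := fine (limn_esup (fun k => (u (h k) x)%:E)).
have mv : measurable_fun D v.
  apply: measurableT_comp => //.
  by apply: measurable_fun_limn_esup => k; exact/measurable_EFinP.
have uv : {ae mu, forall x, D x -> u (h k) x @[k --> \oo] --> v x}.
  apply: filterS aecvg => x H Dx; have {}H := H Dx.
  suff /cvg_ex[l hl] : cvgn (fun k => u (h k) x).
    suff -> : v x = l by [].
    have hl' : (u (h k) x)%:E @[k --> \oo] --> l%:E by apply: cvg_EFin => //; exact: nearW.
    by rewrite /v (cvg_limn_einf_sup hl').2.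
  have /cvg_seqP/(_ 1 ltr01)[N hN] := H.
  apply: (@cvg_geometric_increments _ _ N) => k /hN.
  rewrite subr0 ger0_norm// /f distrC => h1.
  rewrite -(@ler_pXn2r _ 2) ?nnegrE ?exprn_ge0// real_normK ?num_real//.
  rewrite -exprM mulnC exprM (_ : 2^-1 ^+ 2 = 4^-1); last by field.
  by rewrite exprVn -[leRHS]mulr1 ler_pdivlMl// exprn_gt0.
have key e n N : (h N <= n)%N -> 8%:R ^- N <= e ->
    (\int[mu]_(x in D) ((u n x - v x) ^+ 2)%:E <= e%:E)%E.
  move=> Nn eN.
  pose F k x := ((u n x - u (h k) x) ^+ 2)%:E.
  have mF k : measurable_fun D (F k).
    by apply/measurable_EFinP/measurable_funX; have [] := sB n (h k).
  have F0 k x : D x -> (0 <= F k x)%E by move=> _; rewrite lee_fin sqr_ge0.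
  apply: (@le_trans _ _ (\int[mu]_(x in D) limn_einf (F^~ x))%E).
    apply: ae_ge0_le_integral => //.
    - by move=> x _; rewrite lee_fin sqr_ge0.
    - by apply/measurable_EFinP/measurable_funX/measurable_funB.
    - by move=> x Dx; apply: le_limn_einf => k; exact: F0.
    - apply: (@eq_measurable_fun _ _ _ _ _ (fun x => - limn_esup (fun k => - F k x)))%E => //.
      apply: measurableT_comp => //; apply: measurable_fun_limn_esup => k.
      exact: measurableT_comp.
    apply: filterS uv => x H Dx; have {}H := H Dx.
    rewrite le_eqVlt; apply/orP; left; apply/eqP.
    have hF : F k x @[k --> \oo] --> ((u n x - v x) ^+ 2)%:E.
      apply: cvg_EFin; first exact: nearW.
      rewrite expr2; under eq_cvg do rewrite /F/= expr2.
      by apply: cvgM; apply: cvgB => //; exact: cvg_cst.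
    by rewrite (cvg_limn_einf_sup hF).1.
  apply: le_trans (fatou mu mD mF F0) _.
  apply: (@limn_einf_le _ _ _ N) => k Nk; rewrite /F sqint_integralE// lee_fin.
  apply: le_trans eN; apply: hk => //.
  by elim: k Nk => [|k IH]; [rewrite leqn0 => /eqP ->|rewrite leq_eqVlt ltnS => /orP[/eqP <-//|/IH/leq_trans]; apply].
have Hs N : sqint D (fun x => u (h N) x - v x).
  split; first by apply: measurable_funB.
  by apply: le_lt_trans (key _ _ N _ (lexx _)) _; rewrite ?leqnn// ltry.
have sv : sqint D v.
  have := sqintB mD (hu (h 0%N)) (Hs 0%N).
  by congr (sqint D _); apply/funext => x; ring.
exists v; split=> // e e0.
have : (2^-1 : R) ^+ n @[n --> \oo] --> 0.
  by apply: cvg_expr; rewrite ger0_norm; lra.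
move=> /cvg_seqP/(_ e e0)[N hN]; exists (h N) => n Nn.
rewrite -lee_fin -sqint_integralE//; last exact: sqintB.
apply: key Nn _; have := hN _ (leqnn N).
rewrite subr0 ger0_norm ?exprn_ge0//; apply: le_trans.
by rewrite -exprVn; apply: lerXn2r; rewrite ?nnegrE//; lra.
Qed.

End integration.

(** * Absolutely continuous functions on the unit interval *)

Section unit_interval.
Context {R : realType}.
Local Notation mu := (@lebesgue_measure R).
Implicit Types (f g : R -> R) (t : R).

Lemma I01P t : I01 t <-> 0 <= t <= 1.
Proof. by rewrite /I01/= in_itv. Qed.

Lemma measurable_I01 : measurable (I01 : set (measurableTypeR R)).
Proof. exact: measurable_itv. Qed.

(** Multiplied out, so that [x = t] is no exception, and relative to [[0, 1]], so that it is
    one-sided at the endpoints. *)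
Definition deriv_at f t (l : R) := forall e : R, 0 < e -> exists2 r, 0 < r &
  forall x, I01 x -> `|x - t| < r -> `|f x - f t - l * (x - t)| <= e * `|x - t|.

Lemma deriv_atD f g t l m : deriv_at f t l -> deriv_at g t m ->
  deriv_at (fun x => f x + g x) t (l + m).
Proof.
move=> hf hg e e0.
have [r r0 hr] := hf (e / 2) (divr_gt0 e0 (ltr0n _ 2)).
have [q q0 hq] := hg (e / 2) (divr_gt0 e0 (ltr0n _ 2)).
exists (Num.min r q); first by rewrite lt_min r0.
move=> x x01; rewrite lt_min => /andP[xr xq].
have := hr x x01 xr; have := hq x x01 xq; move: `|x - t| => a h1 h2.
have -> : f x + g x - (f t + g t) - (l + m) * (x - t) =
  (f x - f t - l * (x - t)) + (g x - g t - m * (x - t)) by ring.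
apply: le_trans (ler_normD _ _) _; lra.
Qed.

Lemma deriv_atZ a f t l : deriv_at f t l -> deriv_at (fun x => a * f x) t (a * l).
Proof.
move=> hf e e0; have a0 : 0 < `|a| + 1 by rewrite ltr_wpDl.
have [r r0 hr] := hf (e / (`|a| + 1)) (divr_gt0 e0 a0).
exists r => // x x01 xr.
have -> : a * f x - a * f t - a * l * (x - t) = a * (f x - f t - l * (x - t)) by ring.
rewrite normrM; apply: le_trans (ler_wpM2l (normr_ge0 _) (hr x x01 xr)) _.
rewrite mulrA; apply: ler_wpM2r => //.
rewrite mulrCA -[leRHS]mulr1 ler_wpM2l ?(ltW e0)// ler_pdivrMr// mul1r lerDl//.
Qed.

Lemma eq_deriv_at f g t l : I01 t -> {in I01, f =1 g} ->
  deriv_at f t l -> deriv_at g t l.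
Proof.
move=> t01 fg hf e /hf[r r0 hr]; exists r => // x x01 xr.
by rewrite -!fg ?inE//; exact: hr.
Qed.

Definition ac01 f := forall e : R, 0 < e -> exists2 h : R, 0 < h &
  forall (n : nat) (a b : 'I_n -> R),
    (forall i, 0 <= a i /\ a i <= b i /\ b i <= 1) ->
    trivIset setT (fun i => `]a i, b i[%classic) ->
    \sum_(i < n) (b i - a i) < h ->
    \sum_(i < n) `|f (b i) - f (a i)| < e.

Lemma ac01_lin c f g : ac01 f -> ac01 g -> ac01 (fun x => c * f x + g x).
Proof.
move=> hf hg e e0; have c0 : 0 < `|c| + 1 by rewrite ltr_wpDl.
have [r r0 hr] := hf (e / 2 / (`|c| + 1)) (divr_gt0 (divr_gt0 e0 (ltr0n _ 2)) c0).
have [q q0 hq] := hg (e / 2) (divr_gt0 e0 (ltr0n _ 2)).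
exists (Num.min r q); first by rewrite lt_min r0.
move=> n a b ab tab; rewrite lt_min => /andP[hr' hq'].
have h1 := hr n a b ab tab hr'; have h2 := hq n a b ab tab hq'.
apply: (@le_lt_trans _ _ ((`|c| + 1) * \sum_(i < n) `|f (b i) - f (a i)| +
    \sum_(i < n) `|g (b i) - g (a i)|)).
  rewrite mulr_sumr -big_split/=; apply: ler_sum => i _.
  have -> : c * f (b i) + g (b i) - (c * f (a i) + g (a i)) =
    c * (f (b i) - f (a i)) + (g (b i) - g (a i)) by ring.
  apply: le_trans (ler_normD _ _) _; rewrite lerD2r normrM.
  by rewrite ler_wpM2r// lerDl.
rewrite [ltRHS]splitr ltrD//.
by rewrite mulrC -ltr_pdivlMr.
Qed.

Lemma eq_ac01 f g : {in I01, f =1 g} -> ac01 f -> ac01 g.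
Proof.
move=> fg hf e /hf[r r0 hr]; exists r => // n a b ab tab /(hr n a b ab tab).
have A i : g (b i) = f (b i) /\ g (a i) = f (a i).
  have [? [? ?]] := ab i; split; rewrite fg// inE; apply/I01P; apply/andP; split; lra.
by under eq_bigr do rewrite -(A _).1 -(A _).2.
Qed.

Lemma ac01_continuous f t : I01 t -> ac01 f -> forall e : R, 0 < e ->
  exists2 r, 0 < r & forall x, I01 x -> `|x - t| < r -> `|f x - f t| <= e.
Proof.
move=> /I01P/andP[t0 t1] hf e /hf[r r0 hr]; exists r => // x /I01P/andP[x0 x1] xr.
have [xt|tx] := leP x t.
- have := hr 1%N (fun=> x) (fun=> t); rewrite !big_ord1 => H; apply/ltW.
  rewrite distrC; apply: H => //.
    by apply/trivIsetP => i j _ _; rewrite !ord1 eqxx.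
  by move: xr; rewrite ler0_norm; lra.
- have := hr 1%N (fun=> t) (fun=> x); rewrite !big_ord1 => H; apply/ltW.
  apply: H => //.
  + by move=> _; split=> //; split=> //; exact: ltW.
  + by apply/trivIsetP => i j _ _; rewrite !ord1 eqxx.
  by move: xr; rewrite ger0_norm; lra.
Qed.

(* Cousin's argument: a gauge is chosen from the derivative off the null set,
   and from a small open cover of it elsewhere. *)
Lemma ac01_deriv0_const f : ac01 f ->
  {ae mu, forall t, I01 t -> deriv_at f t 0} ->
  forall t, I01 t -> f t = f 0.
Proof.
move=> fac [N [mN N0 hN]] t /I01P/andP[t0 t1].
apply/eqP; rewrite -subr_eq0 -normr_le0; apply/ler_addgt0Pl => e0 e00; rewrite addr0.
pose e := e0 / 2; have ep : 0 < e by rewrite divr_gt0.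
have [h h0 hf] := fac e ep.
have [U [oU NU Uh]] : exists U : set R, [/\ open U, N `<=` U & (mu U < h%:E)%E].
  have [|U [oU NU Uh]] := @lebesgue_regularity_outer R N h mN _ h0.
    exact: (eq_ind_r (fun x => (x < +oo)%E) (ltry (0 : R)) N0).
  exists U; split=> //; apply: le_lt_trans Uh.
  have mUN : measurable (U `\` N) by apply: measurableD => //; exact: open_measurable.
  have H0 : (mu (U `\` N) + 0 <= mu (U `\` N))%E by rewrite adde0.
  apply: (le_trans _ (le_trans (measureU2 mu mUN mN)
    (eq_ind_r (fun x => mu (U `\` N) + x <= mu (U `\` N))%E H0 N0))).
  apply: le_measure; rewrite ?inE; [exact: open_measurable|exact: measurableU|].
  by move=> x Ux; have [|] := pselect (N x); [right|left].
have gauge z : I01 z -> exists2 r : R, 0 < r & (forall x, `|x - z| < r -> U x) \/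
    (forall x, I01 x -> `|x - z| < r -> `|f x - f z| <= e * `|x - z|).
  move=> z01; have [zN|zN] := pselect (N z).
    have : nbhs z U by apply: open_nbhs_nbhs; split => //; exact: NU.
    move=> /nbhs_ballP[r /= r0 hr]; exists r => //; left => x xr.
    by apply: hr; rewrite /ball/= distrC.
  have zd : deriv_at f z 0.
    by apply: contrapT => H; apply: zN; apply: hN => /= /(_ z01).
  have [r r0 hr] := zd e ep; exists r => //; right => x x01 /(hr x x01).
  by rewrite mul0r subr0.
(* [Good c] remembers of a partition of [[0, c]] only the pieces chosen for the null set: they are
   ordered and their interiors lie in [U]. All other pieces together contribute at most [e * c]. *)
pose Good c := exists n (a b : nat -> R), [/\
  forall i, (i < n)%N -> [/\ 0 <= a i, a i <= b i, b i <= c &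
     forall x, a i < x < b i -> U x],
  forall i j, (i < j < n)%N -> b i <= a j &
  `|f c - f 0| <= e * c + \sum_(i < n) `|f (b i) - f (a i)| ].
have good0 : Good 0.
  exists 0%N, (fun=> 0), (fun=> 0); split=> //.
  by rewrite big_ord0 subrr normr0 mulr0 addr0.
have step c c' : Good c -> 0 <= c -> c <= c' ->
    (forall x, c < x < c' -> U x) \/ `|f c' - f c| <= e * (c' - c) -> Good c'.
  move=> [n [a [b [h1 h2 h3]]]] c0 cc' [cU|cf].
    exists n.+1, (fun i => if (i < n)%N then a i else c),
      (fun i => if (i < n)%N then b i else c'); split.
    - move=> i; rewrite ltnS leq_eqVlt => /orP[/eqP ->|iN].
        by rewrite ltnn; split.
      by rewrite iN; have [? ? bc ?] := h1 i iN; split=> //; exact: le_trans cc'.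
    - move=> i j /andP[ij]; rewrite ltnS leq_eqVlt => /orP[/eqP jn|jN].
        by rewrite jn ltnn -jn ij; have [] := h1 i; rewrite -?jn.
      by rewrite jN (ltn_trans ij jN); apply: h2; rewrite ij.
    - rewrite big_ord_recr/= ltnn.
      have -> : \sum_(i < n) `|f (if (i < n)%N then b i else c') -
          f (if (i < n)%N then a i else c)| = \sum_(i < n) `|f (b i) - f (a i)|.
        by apply: eq_bigr => i _; rewrite ltn_ord.
      have -> : f c' - f 0 = (f c' - f c) + (f c - f 0) by ring.
      apply: le_trans (ler_normD _ _) _.
      have : e * c <= e * c' by rewrite ler_pM2l.
      by move: h3; move: (\sum_(i < n) _) => S; lra.
  exists n, a, b; split=> //.
    by move=> i /h1[? ? bc ?]; split=> //; exact: le_trans cc'.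
  have -> : f c' - f 0 = (f c' - f c) + (f c - f 0) by ring.
  apply: le_trans (ler_normD _ _) _.
  by move: h3; move: (\sum_(i < n) _) => S; rewrite mulrBr in cf; lra.
pose Z := [set c | 0 <= c /\ c <= t /\ Good c].
have Z0 : Z 0 by split.
have Zub : has_ubound Z by exists t => c [_ []].
have Zsup : has_sup Z by split => //; exists 0.
pose z := sup Z.
have z0 : 0 <= z by exact: sup_upper_bound Zsup _ Z0.
have zt : z <= t by apply: ge_sup => [|c [_ []]//]; exists 0.
have z01 : I01 z by apply/I01P; rewrite z0 (le_trans zt).
have [r r0 hr] := gauge z z01.
(* The gauge at the supremum [z] reaches back to a good point at or below [z], and beyond [z] unless
   [z = t]. *)
have Goodz : Good z.
  have [c [c0 [ct Gc]] zrc] := sup_adherent r0 Zsup.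
  have cz : c <= z by exact: sup_upper_bound Zsup _ (conj c0 (conj ct Gc)).
  have czr : `|c - z| < r by rewrite ler0_norm ?subr_le0// -/z in zrc *; lra.
  apply: (step c) => //; case: hr => hr.
    left => x /andP[cx xz]; apply: hr; rewrite ltr0_norm ?subr_lt0//.
    by rewrite -/z in zrc; lra.
  right; rewrite distrC; apply: le_trans (hr c _ czr) _.
    by apply/I01P; rewrite c0 (le_trans ct).
  by rewrite ler0_norm ?subr_le0// opprB.
have Goodt : Good t.
  have [zlt|] := ltP z t; last by move=> tz; have <- : z = t by apply/le_anti/andP.
  pose c := Num.min t (z + r / 2).
  have zc : z < c by rewrite lt_min zlt/= ltrDl divr_gt0.
  have ct : c <= t by rewrite ge_min lexx.
  have czr : c - z < r by rewrite ltrBlDl gt_min; apply/orP; right; lra.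
  suff Gc : Good c.
    have : c <= z by apply: (sup_upper_bound Zsup); split=> //; rewrite (le_trans z0)// ltW.
    by rewrite leNgt zc.
  apply: (step z) => //; first exact: ltW.
  case: hr => hr.
    by left => x /andP[zx xc]; apply: hr; rewrite gtr0_norm ?subr_gt0//; lra.
  right; apply: le_trans (hr c _ _) _.
  - by apply/I01P; rewrite (le_trans z0 (ltW zc)) (le_trans ct).
  - by rewrite gtr0_norm ?subr_gt0.
  - by rewrite gtr0_norm ?subr_gt0.
have [n [a [b [h1 h2 h3]]]] := Goodt.
apply: le_trans h3 _.
have -> : e0 = e + e by rewrite /e -splitr.
apply: lerD; first by rewrite ler_piMr// ltW.
have tI : trivIset [set: 'I_n] (fun i : 'I_n => `]a i, b i[%classic).
  apply/trivIsetP => i j _ _ ij; rewrite -subset0 => x [/=].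
  rewrite !in_itv/= => /andP[aix xbi] /andP[ajx xbj].
  move: ij; rewrite -(inj_eq val_inj)/= neq_ltn => /orP[ij|ji].
    by have := h2 i j; rewrite ij ltn_ord => /(_ isT); lra.
  by have := h2 j i; rewrite ji ltn_ord => /(_ isT); lra.
apply/ltW/(hf n (fun i => a i) (fun i => b i)) => //.
  by move=> i; have [? ? ? ?] := h1 i (ltn_ord i); split=> //; split=> //; exact: le_trans t1.
rewrite -lte_fin; apply: le_lt_trans Uh.
have -> : (\sum_(i < n) (b i - a i))%:E = mu (\big[setU/set0]_(i < n) `]a i, b i[%classic).
  rewrite measure_bigsetU_ord//.
  rewrite -sumEFin; apply: eq_bigr => i _.
  apply: esym; apply: (eq_trans (lebesgue_measure_itv `]a i, b i[)).
  rewrite /= lte_fin; case: ltP => // ba.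
  by have [_ ab _ _] := h1 i (ltn_ord i); rewrite (@le_anti _ _ (b i) (a i)) ?subrr// ba ab.
apply: le_measure; rewrite ?inE.
- by apply: bigsetU_measurable => i _; exact: measurable_itv.
- exact: open_measurable.
- rewrite -bigcup_seq/= => x [i _ /=]; rewrite in_itv/= => xab.
  by have [_ _ _] := h1 i (ltn_ord i); apply.
Qed.

End unit_interval.

(** * Primitives and the fundamental theorem of calculus *)

Section primitive.
Context {R : realType}.
Local Notation mu := (@lebesgue_measure R).
Implicit Types (f g G : R -> R) (t : R).

Lemma lebesgue_I01 : mu I01 = 1%E.
Proof.
by apply: (eq_trans (lebesgue_measure_itv `[0, 1])); rewrite /= lte_fin ltr01 -EFinB subr0.
Qed.

Lemma sqint_cst (c : R) : sqint mu I01 (fun=> c).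
Proof.
split=> //; rewrite integral_cst; last exact: measurable_I01.
by rewrite [X in (_ * X)%E]lebesgue_I01 mule1 ltry.
Qed.

Lemma sqint_I01_integrable G : sqint mu I01 G -> mu.-integrable I01 (EFin \o G).
Proof.
move=> hG; have := sqint_mul measurable_I01 (sqint_cst 1) hG.
by under eq_fun do rewrite mul1r.
Qed.

Definition primitive G t := \int[mu]_(x in `[0, t]) G x.

Lemma primitive0 G : primitive G 0 = 0.
Proof. by rewrite /primitive set_itv1 Rintegral_set1. Qed.

Lemma integrable_sub_I01 G (A : set R) : measurable A -> A `<=` I01 ->
  mu.-integrable I01 (EFin \o G) -> mu.-integrable A (EFin \o G).
Proof. by move=> mA AI; apply: integrableS => //; exact: measurable_I01. Qed.

Lemma primitiveB G a b : mu.-integrable I01 (EFin \o G) ->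
  0 <= a -> a <= b -> b <= 1 ->
  primitive G b - primitive G a = \int[mu]_(x in `]a, b]) G x.
Proof.
move=> iG a0 ab b1; rewrite /primitive Rintegral_itvB//.
apply: integrable_sub_I01 iG => // x /=; rewrite in_itv/= => /andP[x0 xb].
by apply/I01P; rewrite x0 (le_trans xb).
Qed.

(** The absolute continuity of the integral of the absolute value of [G], applied to the union of
    the intervals. *)
Lemma ac01_primitive G : mu.-integrable I01 (EFin \o G) -> ac01 (primitive G).
Proof.
move=> iG e e0.
have iG' : mu.-integrable setT (EFin \o (G \_ I01)).
  by rewrite -restrict_EFin; apply/(integrable_mkcond _ measurable_I01).
have [h [h0 hG]] := integral_normr_continuous iG' e0.
exists h => // n a b ab tI sh.
pose U := \big[setU/set0]_(i < n) `]a i, b i[%classic.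
have mU : measurable U by apply: bigsetU_measurable => i _; exact: measurable_itv.
have abi i : 0 <= a i /\ a i <= b i /\ b i <= 1 by exact: ab.
have oI i : `]a i, b i[ `<=` (I01 : set R).
  move=> x /=; rewrite in_itv/= => /andP[? ?]; have [? [? ?]] := abi i; apply/I01P; apply/andP; lra.
apply: le_lt_trans (hG U mU _); last first.
  rewrite measure_bigsetU_ord//; apply: le_lt_trans (_ : ((\sum_(i < n) (b i - a i))%:E < h%:E)%E).
    rewrite -sumEFin; apply: lee_sum => i _.
    apply: (@le_trans _ _ (@lebesgue_measure R `]a i, b i[)) => //.
    rewrite lebesgue_measure_itv/= lte_fin; case: ltP => // _.
    by rewrite lee_fin subr_ge0; have [? []] := abi i.
  by rewrite lte_fin.
have iU (A : set R) : measurable A -> mu.-integrable A (EFin \o (fun x => `|(G \_ I01) x|)).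
  by move=> mA; apply: (integrableS measurableT) => //; exact: (integrable_abse iG').
rewrite -lee_fin fineK; last by apply: integrable_fin_num => //; exact: iU.
rewrite /U ge0_integral_bigsetU//; last 3 first.
- by rewrite index_enum_uniq.
- exact: sub_trivIset tI.
- by apply: (measurable_int mu); exact: iU.
rewrite -sumEFin; apply: lee_sum => i _.
have [ai [abii bi]] := abi i.
rewrite primitiveB// -Rintegral_itv_bndo_bndc; last first.
  exact: integrable_sub_I01 iG.
rewrite -[leRHS]fineK; last by apply: integrable_fin_num => //; exact: iU.
rewrite lee_fin.
have iGi := integrable_sub_I01 (measurable_itv _) (oI i) iG.
apply: le_trans (le_normr_Rintegral _ iGi) _ => //.
rewrite le_eqVlt; apply/orP; left; apply/eqP; apply: eq_Rintegral => x xi.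
by rewrite patchE mem_set//; apply: (oI i); rewrite inE in xi.
Qed.

(** Derivatives below the top order have to be obtained at every point of [[0, 1]], endpoints
    included, for which the almost everywhere statement is too weak; there the integrand is
    continuous. *)
Lemma deriv_at_primitive_continuous G t : mu.-integrable I01 (EFin \o G) ->
  I01 t ->
  (forall e : R, 0 < e -> exists2 r : R, 0 < r &
    forall x, I01 x -> `|x - t| < r -> `|G x - G t| <= e) ->
  deriv_at (primitive G) t (G t).
Proof.
move=> iG t01 hG e e0; have [r r0 hr] := hG e e0; exists r => // x x01 xr.
have key u v : 0 <= u -> u <= v -> v <= 1 -> (forall y, u < y <= v -> `|y - t| < r) ->
    `|primitive G v - primitive G u - G t * (v - u)| <= e * (v - u).
  move=> u0 uv v1 huv; rewrite primitiveB//.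
  have sI : `]u, v] `<=` (I01 : set R).
    move=> y /=; rewrite in_itv/= => /andP[? ?]; apply/I01P; apply/andP; lra.
  have muv : fine (mu `]u, v]) = v - u.
    have -> : mu `]u, v] = (if u%:E < v%:E then v%:E + - u%:E else 0)%E :=
      lebesgue_measure_itv `]u, v].
    rewrite lte_fin; case: ltP => //= vu; have -> : u = v by apply/le_anti/andP.
    by rewrite subrr.
  have ic (c : R) : mu.-integrable `]u, v] (EFin \o (fun=> c)).
    apply: integrable_sub_I01 => //; exact/sqint_I01_integrable/sqint_cst.
  have iGu := integrable_sub_I01 (measurable_itv _) sI iG.
  rewrite -{1}muv -Rintegral_cst// -RintegralB//.
  apply: le_trans (le_normr_Rintegral _ _) _ => //.
    exact: (integrableB _ iGu (ic (G t))).
  rewrite -{1}muv -Rintegral_cst//; apply: le_Rintegral => //.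
    exact: (integrable_abse (integrableB _ iGu (ic (G t)))).
  move=> y uvy; apply: hr; first exact: sI.
  by apply: huv; move: uvy; rewrite /= in_itv.
have /I01P/andP[x0 x1] := x01; have /I01P/andP[t0 t1] := t01.
have [tx|/ltW xt] := leP t x.
  rewrite [X in e * X]ger0_norm ?subr_ge0//; apply: key => // y /andP[ty yx].
  by move: xr; rewrite !ger0_norm; lra.
have -> : primitive G x - primitive G t - G t * (x - t) =
  - (primitive G t - primitive G x - G t * (t - x)) by ring.
rewrite normrN.
rewrite [X in e * X]ler0_norm ?subr_le0// opprB; apply: key => // y /andP[xy yt].
by move: xr; rewrite !ler0_norm; lra.
Qed.

(** Lebesgue differentiation for the extension of [G] by zero to the line, whose primitive from
    minus infinity coincides with [primitive G] on [[0, 1]]. *)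
Lemma ae_deriv_at_primitive G : mu.-integrable I01 (EFin \o G) ->
  {ae mu, forall t, I01 t -> deriv_at (primitive G) t (G t)}.
Proof.
move=> iG.
have iG' : mu.-integrable setT (EFin \o (G \_ I01)).
  by rewrite -restrict_EFin; apply/(integrable_mkcond _ measurable_I01).
have lG := integrable_locally_restrict measurable_I01 iG.
have iGy (y : R) : mu.-integrable `]-oo, y] (EFin \o (G \_ I01)).
  exact: integrableS iG'.
pose F x := \int[mu]_(y in `]-oo, x]) (G \_ I01) y.
have FE x : I01 x -> F x = primitive G x.
  move=> /I01P/andP[x0 x1]; rewrite /F -Rintegral_mkcondr.
  congr Rintegral; apply/seteqP; split => y /=; rewrite !in_itv/=.
    by move=> [yx /I01P/andP[-> _]].
  by move=> /andP[y0 yx]; split => //; apply/I01P; rewrite y0 (le_trans yx).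
have := FTC1Ny iGy lG.
apply: filterS; first exact: (ae_filter_ringOfSetsType mu).
move=> t [dF dFE] t01; move: dFE; rewrite derive1E -/F => dFE.
have {dF} : h^-1 *: (F (h *: 1 + t) - F t) @[h --> 0^'] --> G t.
  have <- : 'D_1 F t = G t by rewrite dFE patchE mem_set.
  exact: dF.
move=> /cvgrPdist_le hd e e0.
have [r /= r0 hr] := hd e e0; exists r => // x x01 xr.
have [->|xt] := eqVneq x t; first by rewrite !subrr mulr0 subr0 normr0 mulr0.
have := hr (x - t); rewrite /ball/= sub0r normrN subr_eq0 => /(_ xr xt).
rewrite /GRing.scale/= mulr1 subrK !FE// => h1.
have xt0 : x - t != 0 by rewrite subr_eq0.
have -> : primitive G x - primitive G t - G t * (x - t) =
    - ((G t - (x - t)^-1 * (primitive G x - primitive G t)) * (x - t)) by field.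
by rewrite normrN normrM ler_wpM2r.
Qed.

(** The difference of [f] and [primitive G] is absolutely continuous with derivative 0 almost
    everywhere, hence constant. *)
Lemma ac01_FTC f G : ac01 f -> mu.-integrable I01 (EFin \o G) ->
  {ae mu, forall t, I01 t -> deriv_at f t (G t)} ->
  forall t, I01 t -> f t = f 0 + primitive G t.
Proof.
move=> fac iG fG t t01.
pose g x := -1 * primitive G x + f x.
have gac : ac01 g by apply: ac01_lin => //; exact: ac01_primitive.
have := @ac01_deriv0_const _ g gac _ t t01.
rewrite /g primitive0 mulr0 add0r => <-; first by ring.
have FF := ae_filter_ringOfSetsType mu.
apply: filterS2 fG (ae_deriv_at_primitive iG) => x h1 h2 x01.
have := deriv_atD (deriv_atZ (-1) (h2 x01)) (h1 x01).
by rewrite mulN1r addNr.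
Qed.

End primitive.

(** * Measurability of derivatives *)

Section derivative_measurability.
Context {R : realType}.
Local Notation mu := (@lebesgue_measure R).
Implicit Types (f g G : R -> R) (t : R).

Definition cont01 f := forall t, I01 t -> forall e : R, 0 < e ->
  exists2 r : R, 0 < r & forall x, I01 x -> `|x - t| < r -> `|f x - f t| <= e.

Lemma ac01_cont f : ac01 f -> cont01 f.
Proof. by move=> hf t t01; exact: ac01_continuous. Qed.

Lemma cont01_within f : cont01 f -> {within I01, continuous f}.
Proof.
move=> cf; apply/subspace_continuousP => t t01; apply/cvgrPdist_le => e e0.
have [r r0 hr] := cf t t01 e e0; exists r => // x /= xr x01.
by rewrite distrC hr// distrC.
Qed.

Lemma cont01_measurable f : cont01 f -> measurable_fun (I01 : set (measurableTypeR R)) f.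
Proof.
move=> /cont01_within cf; apply: subspace_continuous_measurable_fun => //.
exact: measurable_I01.
Qed.

Lemma rat_near_I01 t (e : R) : I01 t -> 0 < e ->
  exists q : rat, I01 (ratr q : R) /\ `|ratr q - t| < e.
Proof.
move=> /I01P/andP[t0 t1] e0.
have [|q] := @rat_in_itvoo R (Num.max 0 (t - e)) (Num.min 1 (t + e)).
  by rewrite gt_max !lt_min; apply/andP; split; apply/andP; split; lra.
rewrite in_itv/= gt_max lt_min => /andP[/andP[q0 tq] /andP[q1 qt]].
exists q; split; first by apply/I01P; rewrite !ltW.
by rewrite ltr_norml; apply/andP; split; lra.
Qed.

(** In the definition of [deriv_at], [e] and [r] may be restricted to inverses of integers and, [f]
    being continuous, [x] to rationals; only countable unions and intersections remain. *)
Lemma measurable_deriv_at f (l : R -> R) : cont01 f ->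
  measurable_fun (I01 : set (measurableTypeR R)) l ->
  measurable ((I01 : set (measurableTypeR R)) `&` [set t | deriv_at f t (l t)]).
Proof.
move=> cf ml; have mf := cont01_measurable cf.
pose q (i : nat) : R := ratr (odflt 0 (choice.unpickle i)).
pose C (n m i : nat) (t : R) : bool := (q i \in I01) && (`|q i - t| < m.+1%:R^-1).
pose E n m i : set (measurableTypeR R) := I01 `&`
  [set t | C n m i t ==> (`|f (q i) - f t - l t * (q i - t)| <= n.+1%:R^-1 * `|q i - t|)].
have mE n m i : measurable (E n m i).
  have -> : E n m i = I01 `&` (fun t => C n m i t ==>
     (`|f (q i) - f t - l t * (q i - t)| <= n.+1%:R^-1 * `|q i - t|)) @^-1` [set true].
    by [].
  have mq : measurable_fun (I01 : set (measurableTypeR R)) (fun t : R => `|q i - t|).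
    by apply: measurableT_comp => //; apply: measurable_funB.
  suff H : measurable_fun (I01 : set (measurableTypeR R)) (fun t => C n m i t ==>
     (`|f (q i) - f t - l t * (q i - t)| <= n.+1%:R^-1 * `|q i - t|)).
    exact: (H measurable_I01 [set true]).
  under eq_fun do rewrite implybE.
  apply: measurable_or; last first.
    apply: measurable_fun_ler; last exact: measurable_funM.
    apply: measurableT_comp => //; apply: measurable_funB.
      exact: measurable_funB.
    by apply: measurable_funM => //; exact: measurable_funB.
  apply: measurable_neg; apply: measurable_and => //.
  exact: measurable_fun_ltr.
suff -> : (I01 : set (measurableTypeR R)) `&` [set t | deriv_at f t (l t)] =
    \bigcap_n \bigcup_m \bigcap_i E n m i.
  by apply: bigcapT_measurable => n; apply: bigcup_measurable => m _;
    exact: bigcapT_measurable.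
apply/seteqP; split => t.
  move=> [t01 /= dt] n _.
  have n0 : 0 < n.+1%:R^-1 :> R by rewrite invr_gt0.
  have [r r0 hr] := dt _ n0.
  exists (Num.bound r^-1) => // i _; split=> //=; apply/implyP => /andP[+ qt].
  rewrite inE => q01; apply: hr => //; apply: (lt_trans qt).
  rewrite invf_plt ?posrE//; apply: (lt_trans (archi_boundP _)).
    by rewrite invr_ge0 ltW.
  by rewrite ltr_nat.
move=> H; have t01 : I01 t by have [m _ /(_ 0%N I)[]] := H 0%N I.
split=> //= e e0.
have [n hn] : exists n, n.+1%:R^-1 <= e.
  exists (Num.bound e^-1); rewrite invf_ple ?posrE//; apply/ltW.
  apply: (lt_trans (archi_boundP _)); first by rewrite invr_ge0 ltW.
  by rewrite ltr_nat.
have [m _ hm] := H n I.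
exists m.+1%:R^-1; first by rewrite invr_gt0.
move=> x x01 xt.
apply: (@le_trans _ _ (n.+1%:R^-1 * `|x - t|)); last exact: ler_wpM2r.
set c := n.+1%:R^-1; have c0 : 0 < c by rewrite invr_gt0.
apply/ler_addgt0Pl => g g0.
have K0 : 0 < 1 + `|l t| + c by have := normr_ge0 (l t); lra.
(* The inequality is known at rationals. Moving from [x] to one at distance below [d] costs at most
   [d] through [f], [d] times the absolute value of [l t] through the linear term, and [c * d] on
   the right-hand side: [g] in all. *)
pose d := g / (1 + `|l t| + c); have d0 : 0 < d by rewrite divr_gt0.
have [r r0 hr] := cf x x01 d d0.
have s0 : 0 < Num.min (Num.min r d) (m.+1%:R^-1 - `|x - t|).
  by rewrite !lt_min r0 d0 subr_gt0 xt.
have [p [p01 px]] := rat_near_I01 x01 s0.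
have {px} [pr pd pm] : [/\ `|ratr p - x| < r, `|ratr p - x| < d & `|ratr p - x| < m.+1%:R^-1 - `|x - t|].
  by move: px; rewrite !lt_min => /andP[/andP[? ?] ?].
have pE : q (choice.pickle p) = ratr p by rewrite /q choice.pickleK.
have [_ /=] := hm (choice.pickle p) I.
have ptm : `|ratr p - t| < m.+1%:R^-1.
  have -> : ratr p - t = (ratr p - x) + (x - t) by ring.
  by apply: le_lt_trans (ler_normD _ _) _; move: pm; move: (m.+1%:R^-1) => z; lra.
rewrite /C pE mem_set//= ptm/= => h1.
have h2 := hr _ p01 pr.
have -> : f x - f t - l t * (x - t) =
  - (f (ratr p) - f x) + (f (ratr p) - f t - l t * (ratr p - t)) + l t * (ratr p - x) by ring.
have h3 : `|ratr p - t| <= `|x - t| + d.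
  have -> : ratr p - t = (ratr p - x) + (x - t) by ring.
  by apply: le_trans (ler_normD _ _) _; lra.
have h4 : c * `|ratr p - t| <= c * `|x - t| + c * d by rewrite -mulrDr ler_pM2l.
have h5 : `|l t * (ratr p - x)| <= `|l t| * d by rewrite normrM ler_wpM2l// ltW.
have h6 : g = d + `|l t| * d + c * d by rewrite /d; field; rewrite gt_eqF.
apply: le_trans (ler_normD _ _) _.
apply: le_trans (lerD (ler_normD _ _) (lexx _)) _.
rewrite normrN -/c in h1 *; lra.
Qed.

Lemma measurable_derivative f : cont01 f ->
  exists2 l : R -> R, measurable_fun (I01 : set (measurableTypeR R)) l &
    forall t (m : R), I01 t -> deriv_at f t m -> l t = m.
Proof.
move=> cf; have mf := cont01_measurable cf.
(* The step points into [[0, 1]]: forward in the left half, backward in the right half, and of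
   length at most [2^-1] thanks to [n.+2]. Quotients along it converge to the derivative wherever
   that exists, so their upper limit is a measurable candidate. *)
pose h n (t : R) : R := if t < 2^-1 then n.+2%:R^-1 else - n.+2%:R^-1.
have h01 n t : I01 t -> I01 (t + h n t).
  move=> /I01P/andP[t0 t1]; apply/I01P.
  have n2 : n.+2%:R^-1 <= 2^-1 :> R by rewrite lef_pV2 ?posrE// ler_nat.
  have n0 : 0 < n.+2%:R^-1 :> R by rewrite invr_gt0.
  rewrite /h; move: (n.+2%:R^-1) n2 n0 => a n2 n0.
  by case: ltP => ?; apply/andP; split; lra.
have h0 n t : h n t != 0.
  by rewrite /h; case: ifP; rewrite ?oppr_eq0 gt_eqF// invr_gt0.
have hn n t : `|h n t| = n.+2%:R^-1.
  by rewrite /h; case: ifP => _; rewrite ?normrN ger0_norm// invr_ge0.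
pose F := f \_ I01.
have mF : measurable_fun [set: measurableTypeR R] F.
  by apply/(measurable_restrictT _ measurable_I01).
have mh n : measurable_fun [set: measurableTypeR R] (h n).
  apply: measurable_fun_ifT => //; exact: measurable_fun_ltr.
pose g n t := (F (t + h n t) - F t) / h n t.
have mg n : measurable_fun [set: measurableTypeR R] (g n).
  apply: measurable_funM.
    apply: measurable_funB => //; apply: measurableT_comp => //.
    exact: measurable_funD.
  have -> : (fun x => (h n x)^-1) = (fun t => if t < 2^-1 then (n.+2%:R^-1)^-1 else (- n.+2%:R^-1)^-1).
    by apply/funext => x; rewrite /h; case: ifP.
  apply: measurable_fun_ifT => //; exact: measurable_fun_ltr.
exists (fun t => fine (limn_esup (fun n => (g n t)%:E))).
  apply: measurableT_comp => //; apply: (@measurable_funS _ _ _ _ setT) => //.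
  by apply: measurable_fun_limn_esup => n; exact/measurable_EFinP.
move=> t m t01 dt.
have gm : g n t @[n --> \oo] --> m.
  apply/cvg_seqP => e e0; have [r r0 hr] := dt e e0.
  exists (Num.bound r^-1) => n bn.
  have H := hr (t + h n t) (h01 n t t01).
  rewrite /g /F !patchE !mem_set//; last exact: h01.
  have E1 : t + h n t - t = h n t by ring.
  rewrite E1 hn in H.
  have -> : (f (t + h n t) - f t) / h n t - m =
     (f (t + h n t) - f t - m * h n t) / h n t by field; exact: h0.
  rewrite normrM normfV hn ler_pdivrMr ?invr_gt0//; apply: H.
  rewrite invf_plt ?posrE//; apply: (lt_le_trans (archi_boundP _)).
    by rewrite invr_ge0 ltW.
  by rewrite ler_nat; apply: leq_trans bn _; exact: leqW.
have gm' : (g n t)%:E @[n --> \oo] --> m%:E by apply: cvg_EFin => //; exact: nearW.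
by rewrite (cvg_limn_einf_sup gm').2.
Qed.

End derivative_measurability.

Section vector_derivative.
Context {R : realType} {d : nat}.
Local Notation mu := (@lebesgue_measure R).
Implicit Types (f g : R -> 'rV[R]_d) (t : R) (v w : 'rV[R]_d).

Definition coord (i : 'I_d) f t : R := f t ord0 i.

(** The interval has no isolated point; this makes the limit that defines [deriv01] unique. *)
Lemma proper_within_I01 t : I01 t -> ProperFilter (within I01 t^').
Proof.
move=> /I01P/andP[t0 t1].
apply: Build_ProperFilter_ex => P [r /= r0 hr].
have [h [h0 hr2 h2]] : exists h : R, [/\ 0 < h, h < r & h < 2^-1].
  exists (Num.min (r / 2) 4^-1); split.
  - by rewrite lt_min divr_gt0//=; lra.
  - by rewrite gt_min; apply/orP; left; lra.
  - by rewrite gt_min; apply/orP; right; lra.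
have [tl|tl] := ltP t 2^-1.
  exists (t + h); apply: hr.
  - by rewrite /ball/= opprD addrA subrr sub0r normrN gtr0_norm.
  - by rewrite gt_eqF// ltrDl.
  - by apply/I01P; apply/andP; split; lra.
exists (t - h); apply: hr.
- by rewrite /ball/= opprB addrC subrK gtr0_norm.
- by rewrite lt_eqF// ltrBlDr ltrDl.
- by apply/I01P; apply/andP; split; lra.
Qed.

(** The balls of ['rV[R]_d] are those of the maximum norm, so that convergence of the quotient is
    coordinatewise. *)
Lemma quotient01_cvgP f t v : quotient01 f t --> v <->
  forall i, deriv_at (coord i f) t (v ord0 i).
Proof.
split.
  move=> /cvg_ballP H i e e0; have [r /= r0 hr] := H e e0.
  exists r => // x x01 xr; rewrite /coord.
  have [->|xt] := eqVneq x t; first by rewrite !subrr mulr0 subr0 normr0 mulr0.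
  have := hr x; rewrite /ball/= distrC => /(_ xr xt x01)[_ /(_ ord0 i)].
  rewrite /ball/= !mxE => h1.
  have xt0 : x - t != 0 by rewrite subr_eq0.
  have -> : f x ord0 i - f t ord0 i - v ord0 i * (x - t) =
    - ((v ord0 i - (x - t)^-1 * (f x ord0 i - f t ord0 i)) * (x - t)) by field.
  by rewrite normrN normrM ler_wpM2r// ltW.
move=> H; apply/cvg_ballP => e e0.
have e2 : 0 < e / 2 by rewrite divr_gt0.
have : \forall x \near t, forall i : 'I_d, I01 x ->
    `|coord i f x - coord i f t - v ord0 i * (x - t)| <= e / 2 * `|x - t|.
  have H' i : \forall x \near t, I01 x ->
      `|coord i f x - coord i f t - v ord0 i * (x - t)| <= e / 2 * `|x - t|.
    have [r r0 hr] := H i _ e2.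
    exists r => // x /=; rewrite /ball/= distrC => xr x01; exact: hr.
  exact: filter_forall H'.
case=> r /= r0 hr; exists r => // x xr xt x01; split=> // j i.
have := hr x xr i x01; rewrite !ord1 /coord /ball/= !mxE => h1.
have xt0 : x - t != 0 by rewrite subr_eq0.
have -> : v ord0 i - (x - t)^-1 * (f x ord0 i - f t ord0 i) =
  - ((f x ord0 i - f t ord0 i - v ord0 i * (x - t)) / (x - t)) by field.
rewrite normrN normrM normfV ltr_pdivrMr ?normr_gt0//.
apply: le_lt_trans h1 _; rewrite ltr_pM2r ?normr_gt0//; lra.
Qed.

Lemma deriv01E f t v : I01 t ->
  (forall i, deriv_at (coord i f) t (v ord0 i)) -> deriv01 f t = v.
Proof.
move=> t01 /quotient01_cvgP H.
by have PF := proper_within_I01 t01; apply: (@cvg_lim _ (@norm_hausdorff _ _)).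
Qed.

Lemma derivable01E f t v :
  (forall i, deriv_at (coord i f) t (v ord0 i)) -> derivable01 f t.
Proof. by move=> /quotient01_cvgP H; apply/cvg_ex; exists v. Qed.

Lemma derivable01_deriv_at f t i : derivable01 f t ->
  deriv_at (coord i f) t (deriv01 f t ord0 i).
Proof. by move=> H; apply/(quotient01_cvgP f t (deriv01 f t)): i. Qed.

Lemma eq_deriv01 f g t : I01 t -> {in I01, f =1 g} -> deriv01 f t = deriv01 g t.
Proof.
move=> t01 fg; rewrite /deriv01; congr (lim _).
apply/funext => U; rewrite /quotient01; apply/propext.
by split=> -[r r0 hr]; exists r => // x xr xt x01; have := hr x xr xt x01;
  rewrite /= !fg ?inE.
Qed.

Lemma measurable_fun_coord (D : set (measurableTypeR R)) f i : measurable_fun D f ->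
  measurable_fun D (coord i f).
Proof. by move=> mf; apply: (measurableT_comp (measurable_coord i)). Qed.

Lemma measurable_fun_rV_coord d' (T : measurableType d') (D : set T) (f : T -> 'rV[R]_d) :
  (forall i, measurable_fun D (fun x => f x ord0 i)) -> measurable_fun D f.
Proof.
move=> mf mD Y; rewrite {1}/measurable /=.
apply: (smallest_sub (X := [set A | measurable (D `&` f @^-1` A)])).
  split => /=.
  - by rewrite preimage_set0 setI0.
  - move=> A mA; rewrite setTD preimage_setC.
    rewrite (_ : D `&` _ = D `\` (D `&` f @^-1` A)); first exact: measurableD.
    by rewrite setDE setCI setIUr setICr set0U.
  - by move=> F mF; rewrite preimage_bigcup setI_bigcupr; exact: bigcup_measurable.
move=> A; rewrite -bigcup_seq/= => -[i _ [B mB <-]] /=.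
by rewrite setTI; exact: mf.
Qed.

(** [square_integrable01] asks for measurability of the top derivative on all of [[0, 1]], which
    agreement almost everywhere with a measurable function does not give. Hence the set of points of
    differentiability is shown to be measurable; off it [deriv01] is constant. *)
Lemma measurable_deriv01 f : (forall i, cont01 (coord i f)) ->
  measurable_fun (I01 : set (measurableTypeR R)) (deriv01 f).
Proof.
move=> cf.
have hl i : exists l : R -> R, measurable_fun (I01 : set (measurableTypeR R)) l /\
    forall t (m : R), I01 t -> deriv_at (coord i f) t m -> l t = m.
  by have [l ml hl] := measurable_derivative (cf i); exists l.
have [l hl'] := choice hl.
pose b t := `[< forall i, deriv_at (coord i f) t (l i t) >].
have mb : measurable_fun (I01 : set (measurableTypeR R)) b.
  apply: (measurable_fun_bool true).
  have -> : (I01 : set (measurableTypeR R)) `&` b @^-1` [set true] =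
      I01 `&` \bigcap_(i in [set: 'I_d]) (I01 `&` [set t | deriv_at (coord i f) t (l i t)]).
    apply/seteqP; split => t [t01] /=.
      by move=> bt; have /asboolP H : b t := bt; split => // i _; split => //; exact: H.
    by move=> H; split => //; apply/asboolP => i; have [] := H i I.
  apply: measurableI; first exact: measurable_I01.
  apply: fin_bigcap_measurable => // i _.
  by apply: measurable_deriv_at => //; have [] := hl' i.
(* The value of [lim] on a filter without limit. *)
pose c : 'rV[R]_d := point.
have E t : I01 t -> deriv01 f t = if b t then \row_i l i t else c.
  move=> t01; rewrite /b; case: ifPn => [/asboolP H|/asboolPn H].
    by apply: deriv01E => // i; rewrite mxE.
  have nd : ~ derivable01 f t.
    move=> dt; apply: H => i; have := derivable01_deriv_at i dt.
    by move=> h; rewrite ((hl' i).2 _ _ t01 h).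
  exact: dvgP.
apply: measurable_fun_rV_coord => i.
apply: (@eq_measurable_fun _ _ _ _ _ (fun t => if b t then l i t else c ord0 i)).
  by move=> t; rewrite inE => t01; rewrite E//; case: (b t); rewrite ?mxE.
apply: measurable_fun_if => //; first exact: measurable_I01.
apply: (@measurable_funS _ _ _ _ I01) => //; first exact: measurable_I01.
by have [] := hl' i.
Qed.

End vector_derivative.

(** * Sobolev functions as chains of primitives *)

Section enorm.
Context {R : realType} {d : nat}.
Implicit Types (u v w : 'rV[R]_d).

Definition dotv u v : R := \sum_(i < d) u ord0 i * v ord0 i.

Lemma dotv_sip : semi_inner_product (V := 'rV[R]_d) setT dotv.
Proof.
split=> //.
- by move=> u v _ _; apply: eq_bigr => i _; rewrite mulrC.
- move=> a u v w _ _ _; rewrite /dotv mulr_sumr -big_split; apply: eq_bigr => i _.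
  by rewrite !mxE /=; ring.
- by move=> u _; apply: sumr_ge0 => i _; rewrite -expr2 sqr_ge0.
Qed.

Lemma enorm_sqr u : enorm u ^+ 2 = \sum_(i < d) u ord0 i ^+ 2.
Proof. by rewrite sqr_sqrtr// sumr_ge0// => i _; exact: sqr_ge0. Qed.

Lemma enorm_ge0 u : 0 <= enorm u.
Proof. exact: sqrtr_ge0. Qed.

Lemma enorm_dotv u : dotv u u = enorm u ^+ 2.
Proof. by rewrite enorm_sqr; apply: eq_bigr => i _; rewrite expr2. Qed.

Lemma sqr_le_enorm u (a : R) : 0 <= a -> (enorm u <= a) = (enorm u ^+ 2 <= a ^+ 2).
Proof. by move=> a0; rewrite ler_sqr// nnegrE// enorm_ge0. Qed.

Lemma dotv_le u v : dotv u v <= enorm u * enorm v.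
Proof.
by apply: le_trans (ler_norm _) _; exact: (sip_CS dotv_sip).
Qed.

Lemma enormD u v : enorm (u + v) <= enorm u + enorm v.
Proof.
rewrite sqr_le_enorm ?addr_ge0 ?enorm_ge0// -enorm_dotv.
have -> : dotv (u + v) (u + v) = enorm u ^+ 2 + 2 * dotv u v + enorm v ^+ 2.
  rewrite -!enorm_dotv /dotv mulr_sumr -!big_split; apply: eq_bigr => i _.
  by rewrite !mxE /=; ring.
by have := dotv_le u v; rewrite sqrrD; lra.
Qed.

Lemma enormN u : enorm (- u) = enorm u.
Proof. by congr Num.sqrt; apply: eq_bigr => i _; rewrite mxE sqrrN. Qed.

Lemma enormB u v : enorm (u - v) = enorm (v - u).
Proof. by rewrite -enormN opprB. Qed.

Lemma enorm_triB u v w : enorm (u - w) <= enorm (u - v) + enorm (v - w).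
Proof. by have := enormD (u - v) (v - w); rewrite addrA subrK. Qed.

Lemma enorm_leB u v : enorm u <= enorm v + enorm (u - v).
Proof. by have := enormD v (u - v); rewrite addrC subrK. Qed.

Lemma coord_le_enorm u i : `|u ord0 i| <= enorm u.
Proof.
rewrite -sqrtr_sqr; apply: ler_wsqrtr.
by rewrite (bigD1 i)//= lerDl sumr_ge0// => j _; exact: sqr_ge0.
Qed.

Lemma enorm_le_sum_norm u : enorm u <= \sum_(i < d) `|u ord0 i|.
Proof.
rewrite sqr_le_enorm ?sumr_ge0// enorm_sqr [leRHS]expr2 mulr_suml.
apply: ler_sum => i _; rewrite -(real_normK (num_real (u ord0 i))) expr2.
by apply: ler_wpM2l => //; rewrite (bigD1 i)//= lerDl sumr_ge0.
Qed.

Lemma enorm_le_sum u (c : R) : (forall i, `|u ord0 i| <= c) -> enorm u <= d%:R * c.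
Proof.
move=> uc; apply: le_trans (enorm_le_sum_norm u) _.
by rewrite -[X in X%:R]card_ord mulr_natl -sumr_const; exact: ler_sum.
Qed.

End enorm.

Section chains.
Context {R : realType}.
Local Notation mu := (@lebesgue_measure R).

Lemma cont01_integrable (f : R -> R) : cont01 f -> mu.-integrable I01 (EFin \o f).
Proof.
move=> /cont01_within cf; apply: (@continuous_compact_integrable R f I01) => //.
exact: segment_compact.
Qed.

Lemma cont01_sqint (f : R -> R) : cont01 f -> sqint mu I01 f.
Proof.
move=> cf; apply/sqintP; first exact: measurable_I01.
split; first exact: cont01_measurable.
apply: (@continuous_compact_integrable R (fun x => f x ^+ 2) I01).
  exact: segment_compact.
by move=> x; apply: continuousM; exact: (cont01_within cf).
Qed.

(* [F i] plays the role of the [i]-th derivative of [F 0]. *)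
Record chain s (F : nat -> R -> R) : Prop := {
  chain_sqint : sqint mu I01 (F s) ;
  chain_step : forall i, (i < s)%N -> forall t, I01 t ->
    F i t = F i 0 + primitive (F i.+1) t }.

(** Downward induction: a primitive of an L^2 function is absolutely continuous, hence continuous,
    hence in L^2 again. *)
Lemma chain_regular s F : chain s F -> forall i, (i <= s)%N ->
  sqint mu I01 (F i) /\ ((i < s)%N -> ac01 (F i)).
Proof.
move=> [Fs Fst]; suff H n : (n <= s)%N -> sqint mu I01 (F (s - n)%N) /\
    ((0 < n)%N -> ac01 (F (s - n)%N)).
  move=> i is_; have [|h1 h2] := H (s - i)%N; first exact: leq_subr.
  by rewrite subKn// in h1 h2; split=> // lt_is; apply: h2; rewrite subn_gt0.
elim: n => [|n IH] ns; first by rewrite subn0.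
have [h _] := IH (ltnW ns).
have ac : ac01 (F (s - n.+1)%N).
  apply: (@eq_ac01 _ (fun t => 1 * primitive (F (s - n)%N) t + F (s - n.+1)%N 0)).
      move=> t; rewrite inE => t01; have lt : (s - n.+1 < s)%N.
      by rewrite ltn_subrL (leq_ltn_trans _ ns).
    by rewrite mul1r (Fst _ lt t t01) addrC -subSn// subSS.
  apply: ac01_lin; first exact/ac01_primitive/sqint_I01_integrable.
  move=> e e0; exists 1 => // m a b _ _ _; rewrite big1// => i _.
  by rewrite subrr normr0.
by split=> //; exact/cont01_sqint/ac01_cont.
Qed.

Lemma chain_integrable s F i : chain s F -> (i <= s)%N ->
  mu.-integrable I01 (EFin \o F i).
Proof. by move=> cF is_; apply: sqint_I01_integrable; have [] := chain_regular cF is_. Qed.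

Lemma chain_lin s F G a : chain s F -> chain s G ->
  chain s (fun i t => a * F i t + G i t).
Proof.
move=> cF cG; have [Fs Fst] := cF; have [Gs Gst] := cG.
split=> [|i is_ t t01]; first exact: (sqint_lin a measurable_I01 Fs Gs).
rewrite (Fst i)// (Gst i)//.
have /I01P/andP[t0 t1] := t01.
have sub : `[0, t] `<=` (I01 : set R).
  by move=> x /=; rewrite in_itv/= => /andP[x0 xt]; apply/I01P; rewrite x0 (le_trans xt).
have mt : measurable (`[0, t]%classic : set (measurableTypeR R)) by [].
have iF := integrable_sub_I01 mt sub (chain_integrable cF is_).
have iG := integrable_sub_I01 mt sub (chain_integrable cG is_).
rewrite /primitive RintegralD//; last exact: (integrableZl _ a iF).
by rewrite RintegralZl//; ring.
Qed.

End chains.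

Section sobolev_chain.
Context {R : realType} {d : nat}.
Local Notation mu := (@lebesgue_measure R).
Implicit Types (f g : R -> 'rV[R]_d).

Lemma abs_continuous01P f : abs_continuous01 f <-> forall l, ac01 (coord l f).
Proof.
split=> [H l e e0|H e e0].
  have [h h0 hh] := H e e0; exists h => // n a b ab tI sh.
  apply: le_lt_trans (hh n a b ab tI sh).
  by apply: ler_sum => i _; have := coord_le_enorm (f (b i) - f (a i)) l; rewrite !mxE.
(* Adding 1 keeps the division valid for [d = 0] and makes the final bound strict. *)
have d0 : 0 < d%:R + 1 :> R by rewrite ltr_wpDl.
have e1 : 0 < e / (d%:R + 1) by rewrite divr_gt0.
have [h h0 hh] : exists2 h : R, 0 < h & forall l (n : nat) (a b : 'I_n -> R),
    (forall i, 0 <= a i /\ a i <= b i /\ b i <= 1) ->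
    trivIset setT (fun i => `]a i, b i[%classic) ->
    \sum_(i < n) (b i - a i) < h ->
    \sum_(i < n) `|coord l f (b i) - coord l f (a i)| < e / (d%:R + 1).
  have hl l := H l _ e1.
  pose h l := s2val (cid2 (hl l)).
  have h0 l : 0 < h l := s2valP (cid2 (hl l)).
  exists (\big[Num.min/1]_l h l).
    by elim/big_ind : _ => // x y x0 y0; rewrite lt_min x0.
  move=> l n a b ab tI sh; apply: (s2valP' (cid2 (hl l))) => //.
  apply: lt_le_trans sh _; exact: bigmin_le.
exists h => // n a b ab tI sh.
apply: (@le_lt_trans _ _ (\sum_(l < d) \sum_(i < n) `|coord l f (b i) - coord l f (a i)|)).
  rewrite exchange_big/=; apply: ler_sum => i _.
  apply: le_trans (enorm_le_sum_norm _) _; apply: ler_sum => l _.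
  by rewrite !mxE.
apply: (@le_lt_trans _ _ (\sum_(l < d) (e / (d%:R + 1)))).
  by apply: ler_sum => l _; apply/ltW/hh.
rewrite sumr_const card_ord -[X in X < _]mulr_natl mulrCA -[ltRHS]mulr1 ltr_pM2l//.
by rewrite ltr_pdivrMr// mul1r ltrDl.
Qed.

Lemma ae_I01P (P Q : R -> Prop) :
  (forall t, I01 t -> P t -> Q t) ->
  {ae mu, forall t, I01 t -> P t} -> {ae mu, forall t, I01 t -> Q t}.
Proof.
move=> PQ; apply: filterS; first exact: (ae_filter_ringOfSetsType mu).
by move=> t H t01; apply: PQ => //; exact: H.
Qed.

Lemma square_integrable01P g : square_integrable01 g <->
  forall l, sqint mu I01 (coord l g).
Proof.
have E : (\int[mu]_(t in I01) (enorm (g t) ^+ 2)%:E)%E =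
    (\int[mu]_(t in I01) \sum_(l < d) (coord l g t ^+ 2)%:E)%E.
  by apply: eq_integral => t _; rewrite enorm_sqr sumEFin.
split=> [[mg ig] l|H].
  have mgl : measurable_fun (I01 : set (measurableTypeR R)) (coord l g).
    exact: measurable_fun_coord.
  split=> //; apply: le_lt_trans ig; apply: ge0_le_integral => //.
  - exact: measurable_I01.
  - by move=> t _; rewrite lee_fin sqr_ge0.
  - by apply/measurable_EFinP; exact: measurable_funX.
  - apply/measurable_EFinP.
    under eq_fun do rewrite enorm_sqr.
    apply: measurable_sum => i; apply: measurable_funX; exact: measurable_fun_coord.
  - move=> t _; rewrite lee_fin -(real_normK (num_real (coord l g t))).
    by rewrite lerXn2r ?nnegrE ?enorm_ge0//; exact: coord_le_enorm.
split; first by apply: measurable_fun_rV_coord => i; have [] := H i.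
rewrite E ge0_integral_sum//.
- by apply: lte_sum_pinfty => l _; have [] := H l.
- exact: measurable_I01.
- by move=> l; apply/measurable_EFinP/measurable_funX; have [] := H l.
- by move=> l t _; rewrite lee_fin sqr_ge0.
Qed.

Lemma sqnorm2E g : square_integrable01 g ->
  sqnorm2 g = \sum_(l < d) \int[mu]_(t in I01) (coord l g t ^+ 2).
Proof.
move=> /square_integrable01P H; rewrite /sqnorm2 /Rintegral.
have -> : (\int[mu]_(t in I01) (enorm (g t) ^+ 2)%:E)%E =
    (\int[mu]_(t in I01) \sum_(l < d) (coord l g t ^+ 2)%:E)%E.
  by apply: eq_integral => t _; rewrite enorm_sqr sumEFin.
rewrite ge0_integral_sum//.
- rewrite -[RHS]/(fine (\sum_(l < d) \int[mu]_(t in I01) (coord l g t ^+ 2))%:E) -sumEFin.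
  congr fine; apply: eq_bigr => l _; rewrite sqint_integralE//; exact: measurable_I01.
- exact: measurable_I01.
- by move=> l; apply/measurable_EFinP/measurable_funX; have [] := H l.
- by move=> l t _; rewrite lee_fin sqr_ge0.
Qed.

Lemma sobolev_chain s f : sobolev s f ->
  forall l, chain s (fun i => coord l (nderiv01 i f)).
Proof.
move=> [ac ad sq] l; split; first by move/square_integrable01P : sq; exact.
move=> i is_ t t01.
have iG : mu.-integrable I01 (EFin \o coord l (nderiv01 i.+1 f)).
  have [lt_is|] := ltnP i.+1 s.
    by apply/cont01_integrable/ac01_cont; have /abs_continuous01P := ac _ lt_is; exact.
  move=> si; have -> : i.+1 = s by apply/eqP; rewrite eqn_leq is_.
  by apply: sqint_I01_integrable; move/square_integrable01P : sq; exact.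
apply: ac01_FTC => //; first by have /abs_continuous01P := ac _ is_; exact.
by apply: ae_I01P (ad i is_) => x x01; exact: derivable01_deriv_at.
Qed.

(** Below order [s] the derivatives are recovered everywhere, since [F i] is then a primitive of a
    continuous function. [F s.-1] is a primitive of an L^2 function, differentiable almost
    everywhere only, whence the weaker conclusion at order [s]. *)
Lemma chain_sobolev s f (F : nat -> R -> 'rV[R]_d) : (0 < s)%N ->
  (forall l, chain s (fun i => coord l (F i))) -> {in I01, f =1 F 0%N} ->
  [/\ sobolev s f, forall i, (i < s)%N -> {in I01, nderiv01 i f =1 F i} &
    {ae mu, forall t, I01 t -> nderiv01 s f t = F s t}].
Proof.
move=> s0 cF fF.
have step i : (i < s)%N -> forall l t, I01 t -> coord l (F i) t =
    coord l (F i) 0 + primitive (coord l (F i.+1)) t.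
  by move=> is_ l t t01; exact: (chain_step (cF l)).
have dprim i l t (m : R) : (i < s)%N -> I01 t ->
    deriv_at (primitive (coord l (F i.+1))) t m -> deriv_at (coord l (F i)) t m.
  move=> is_ t01 h; apply: (@eq_deriv_at _ (fun x => primitive (coord l (F i.+1)) x + coord l (F i) 0)) => //.
    by move=> x; rewrite inE => x01; rewrite [RHS]step// addrC.
  rewrite -[m]addr0; apply: deriv_atD => //.
  by move=> e e0; exists 1 => // x _ _; rewrite subrr mul0r subr0 normr0 mulr_ge0// ltW.
have dF i : (i.+1 < s)%N -> forall t, I01 t ->
    forall l, deriv_at (coord l (F i)) t (F i.+1 t ord0 l).
  move=> is_ t t01 l; apply: dprim => //; first exact: ltnW.
  have [si ac] := chain_regular (cF l) (ltnW is_).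
  apply: deriv_at_primitive_continuous => //; first exact: sqint_I01_integrable.
  exact/(ac01_cont (ac is_)).
have nd i : (i < s)%N -> {in I01, nderiv01 i f =1 F i}.
  elim: i => [|i IH] is_; first exact: fF.
  move=> t; rewrite inE => t01; rewrite /nderiv01 iterS -/(nderiv01 i f).
  rewrite (eq_deriv01 t01 (IH (ltnW is_))); apply: deriv01E => //; exact: dF.
have acF i : (i < s)%N -> forall l, ac01 (coord l (nderiv01 i f)).
  move=> is_ l; apply: (@eq_ac01 _ (coord l (F i))).
    by move=> t t01; rewrite /coord nd.
  by have [_] := chain_regular (cF l) (ltnW is_); exact.
have s1s : (s.-1 < s)%N by rewrite prednK.
have ae1 : {ae mu, forall t, I01 t -> forall l, deriv_at (coord l (F s.-1)) t (F s t ord0 l)}.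
  have H l : {ae mu, forall t, I01 t -> deriv_at (coord l (F s.-1)) t (F s t ord0 l)}.
    have := ae_deriv_at_primitive (chain_integrable (cF l) (leqnn s)).
    apply: ae_I01P => t t01 h; apply: dprim => //.
    by rewrite prednK.
  have FF := ae_filter_ringOfSetsType mu.
  have {}H := @filter_forall _ _ _ _ FF H.
  by apply: filterS H => t h t01 l; exact: h.
have ae2 : {ae mu, forall t, I01 t -> derivable01 (nderiv01 s.-1 f) t /\ nderiv01 s f t = F s t}.
  apply: ae_I01P ae1 => t t01 H; split.
    apply: (@derivable01E _ _ _ _ (F s t)) => l.
    apply: eq_deriv_at (H l) => // x x01; by rewrite /coord nd.
  rewrite -{1}(prednK s0) /nderiv01 iterS -/(nderiv01 s.-1 f).
  by rewrite (eq_deriv01 t01 (nd _ s1s)); exact: deriv01E.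
have ae3 : {ae mu, forall t, I01 t -> nderiv01 s f t = F s t}.
  by apply: ae_I01P ae2 => t _ [].
split=> //; split.
- by move=> i is_; apply/abs_continuous01P; exact: acF.
- move=> i is_; have [lt_is|] := ltnP i.+1 s.
    apply: (@ae_I01P (fun=> True)).
      move=> t t01 _; apply: (@derivable01E _ _ _ _ (F i.+1 t)) => l.
      by apply: eq_deriv_at (dF i lt_is t t01 l) => // x x01; rewrite /coord nd.
    by apply: aeW.
  move=> si; have -> : i = s.-1 by apply/eqP; rewrite -eqSS prednK// eqn_leq is_.
  by apply: ae_I01P ae2 => t _ [].
- apply/square_integrable01P => l.
  have ms : measurable_fun (I01 : set (measurableTypeR R)) (coord l (nderiv01 s f)).
    apply: measurable_fun_coord; rewrite -(prednK s0) /nderiv01 iterS.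
    by apply: measurable_deriv01 => i; exact/ac01_cont/acF.
  split=> //; have [mF iF] := chain_sqint (cF l); apply: le_lt_trans iF.
  rewrite le_eqVlt; apply/orP; left; apply/eqP; apply: ae_eq_integral.
  + exact: measurable_I01.
  + exact/measurable_EFinP/measurable_funX.
  + exact/measurable_EFinP/measurable_funX.
  + by apply: ae_I01P ae3 => t t01 h; rewrite /coord h.
Qed.

(** [deriv01] is linear only where the derivatives exist, so linearity of its iterates cannot be
    obtained by rewriting; combining the chains and converting back gives it in the sharpest form
    available. *)
Lemma sobolev_lin s (a : R) f g : (0 < s)%N -> sobolev s f -> sobolev s g ->
  [/\ sobolev s (fun t => a *: f t + g t),
    forall i, (i < s)%N -> {in I01, nderiv01 i (fun t => a *: f t + g t) =1
       (fun t => a *: nderiv01 i f t + nderiv01 i g t)} &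
    {ae mu, forall t, I01 t -> nderiv01 s (fun t => a *: f t + g t) t =
        a *: nderiv01 s f t + nderiv01 s g t}].
Proof.
move=> s0 sf sg.
apply: (@chain_sobolev s _ (fun i t => a *: nderiv01 i f t + nderiv01 i g t)) => //.
move=> l; have := chain_lin a (sobolev_chain sf l) (sobolev_chain sg l).
by congr (chain s _); apply/funext => i; apply/funext => t; rewrite /coord !mxE.
Qed.

End sobolev_chain.

(** * Hilbert structure of chains and pointwise bounds *)

Section chain_inner_product.
Context {R : realType}.
Local Notation mu := (@lebesgue_measure R).
Implicit Types (F G H : nat -> R -> R).

(** The usual Sobolev product with the lower order integrals replaced by initial values. It controls
    those integrals by [chain_integral_le], and its completeness is that of the reals and of L^2. *)
Definition chainB s F G : R :=
  \sum_(i < s) F i 0 * G i 0 + \int[mu]_(t in I01) (F s t * G s t).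

Lemma chain_sip s : semi_inner_product (V := nat -> R -> R) (chain s) (chainB s).
Proof.
have L2 := sqint_sip mu measurable_I01.
split.
- by move=> a F G cF cG; exact: chain_lin.
- move=> F G cF cG; rewrite /chainB (sip_sym L2 (chain_sqint cF) (chain_sqint cG)).
  by congr (_ + _); apply: eq_bigr => i _; rewrite mulrC.
- move=> a F G H cF cG cH; rewrite /chainB.
  have := sip_lin L2 a (chain_sqint cF) (chain_sqint cG) (chain_sqint cH).
  rewrite /= => ->.
  rewrite mulrDr addrACA; congr (_ + _).
  by rewrite mulr_sumr -big_split; apply: eq_bigr => i _ /=; rewrite mulrDl mulrA.
- move=> F cF; apply: addr_ge0; last exact: (sip_ge0 L2 (chain_sqint cF)).
  by apply: sumr_ge0 => i _; rewrite -expr2 sqr_ge0.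
Qed.

Lemma chainB_sqr s F : chainB s F F =
  \sum_(i < s) F i 0 ^+ 2 + \int[mu]_(t in I01) (F s t ^+ 2).
Proof. by []. Qed.

Lemma chainB_sqr_ge s F : chain s F ->
  (forall i, (i < s)%N -> F i 0 ^+ 2 <= chainB s F F) /\
  \int[mu]_(t in I01) (F s t ^+ 2) <= chainB s F F.
Proof.
move=> cF; rewrite chainB_sqr; split.
  move=> i is_; rewrite (bigD1 (Ordinal is_))//= -addrA lerDl addr_ge0//.
    by apply: sumr_ge0 => j _; exact: sqr_ge0.
  by apply: Rintegral_ge0 => t _; exact: sqr_ge0.
by rewrite lerDr; apply: sumr_ge0 => j _; exact: sqr_ge0.
Qed.

Lemma eq_chainB s F F' G : chain s F -> chain s F' -> chain s G ->
  (forall i, (i < s)%N -> F i 0 = F' i 0) ->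
  {ae mu, forall t, I01 t -> F s t = F' s t} ->
  chainB s F G = chainB s F' G.
Proof.
move=> cF cF' cG h0 hae; rewrite /chainB; congr (_ + _).
  by apply: eq_bigr => i _; rewrite h0.
congr fine; apply: ae_eq_integral.
- exact: measurable_I01.
- by apply/measurable_EFinP/measurable_funM; [have [] := chain_sqint cF|have [] := chain_sqint cG].
- by apply/measurable_EFinP/measurable_funM; [have [] := chain_sqint cF'|have [] := chain_sqint cG].
- by apply: ae_I01P hae => t _ ->.
Qed.

Lemma cvg_sum_ord m (f : nat -> 'I_m -> R) (l : 'I_m -> R) :
  (forall i, f n i @[n --> \oo] --> l i) ->
  \sum_(i < m) f n i @[n --> \oo] --> \sum_(i < m) l i.
Proof.
elim: m f l => [|m IH] f l H.
  by under eq_fun do rewrite big_ord0; rewrite big_ord0; exact: cvg_cst.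
under eq_fun do rewrite big_ord_recr/=; rewrite big_ord_recr/=.
by apply: cvgD => //; exact: (IH (fun n i => f n (widen_ord (leqnSn m) i))).
Qed.

Lemma normr_le_sqr (x a : R) : 0 <= a -> x ^+ 2 <= a ^+ 2 -> `|x| <= a.
Proof.
move=> a0; rewrite -(real_normK (num_real x)) ler_sqr ?nnegrE//.
Qed.

Lemma sqr_cauchy_cvg (a : nat -> R) :
  (forall e : R, 0 < e -> exists N, forall m n, (N <= m)%N -> (N <= n)%N ->
    (a m - a n) ^+ 2 <= e) -> cvgn a.
Proof.
move=> H; apply/cauchy_cvgP/cauchy_exP => e e0.
have [N hN] := H ((e / 2) ^+ 2) (exprn_gt0 _ (divr_gt0 e0 (ltr0n _ 2))).
exists (a N), N => // n /= Nn; rewrite /ball/=.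
have /normr_le_sqr := hN N n (leqnn N) Nn.
by rewrite ltW ?divr_gt0// => /(_ isT) /le_lt_trans; apply; lra.
Qed.

(** [n] counts integrations from the top, so this is the derivative of order [s - n]. *)
Fixpoint chain_build (c : nat -> R) (g : R -> R) s (n : nat) : R -> R :=
  if n is m.+1 then fun t => c (s - n)%N + primitive (chain_build c g s m) t else g.

Lemma chain_of (c : nat -> R) (g : R -> R) s : sqint mu I01 g ->
  exists F, [/\ chain s F, F s = g & forall i, (i < s)%N -> F i 0 = c i].
Proof.
move=> hg; pose F i := chain_build c g s (s - i)%N.
have F0 i : (i < s)%N -> F i 0 = c i.
  move=> is_; rewrite /F; have := leq_subr i s; have : (0 < s - i)%N by rewrite subn_gt0.
  case E : (s - i)%N => [//|m] _ _ /=.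
  by rewrite primitive0 addr0 -E subKn// ltnW.
exists F; split => //; last by rewrite /F subnn.
split; first by rewrite /F subnn.
move=> i is_ t t01; rewrite F0//.
have -> : F i = chain_build c g s (s - i.+1).+1 by rewrite /F subnSK.
by rewrite /= subnSK// subKn// ltnW.
Qed.

(** The initial values converge in [R] and the top derivatives in L^2; the limit chain is rebuilt
    from these limits. *)
Lemma chain_complete s : sip_complete (V := nat -> R -> R) (chain s) (chainB s).
Proof.
move=> u cu hu.
have cB m n : chain s (u m - u n) by exact: (sip_subr (chain_sip s)).
have hc i : exists c : R, (i < s)%N -> u n i 0 @[n --> \oo] --> c.
  have [is_|] := boolP (i < s)%N; last by exists 0.
  suff : cvgn (fun n => u n i 0) by move=> /cvg_ex[c hc]; exists c.
  apply: sqr_cauchy_cvg => e e0; have [N hN] := hu e e0.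
  exists N => m n Nm Nn; apply: le_trans (hN m n Nm Nn).
  by have [+ _] := chainB_sqr_ge (cB m n); apply.
have [c hc'] := choice hc.
have [||g [hg ug]] := @sqint_complete _ _ _ mu I01 (fun n => u n s) measurable_I01.
- by move=> n; exact: chain_sqint (cu n).
- move=> e e0; have [N hN] := hu e e0.
  exists N => m n Nm Nn; apply: le_trans (hN m n Nm Nn).
  by have [_] := chainB_sqr_ge (cB m n); apply.
have [F [cF Fs F0]] := chain_of c s hg.
exists F; split => // e e0.
have e2 : 0 < e / 2 by rewrite divr_gt0.
have [N hN] := ug _ e2.
have : \sum_(i < s) (u n i 0 - F i 0) ^+ 2 @[n --> \oo] --> \sum_(i < s) (0 : R) ^+ 2.
  apply: cvg_sum_ord => i; rewrite F0// !expr2.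
  have H : u n i 0 - c i @[n --> \oo] --> 0.
    by rewrite -[X in _ --> X](subrr (c i)); apply: cvgB; [exact: hc'|exact: cvg_cst].
  exact: cvgM.
rewrite big1 => [|i _]; last by rewrite expr0n.
move=> /cvg_seqP/(_ _ e2)[M hM]; exists (maxn N M) => n; rewrite geq_max => /andP[Nn Mn].
rewrite (splitr e); apply: lerD; last first.
  by have := hN n Nn; rewrite -Fs.
by have := hM n Mn; rewrite subr0; apply: le_trans; exact: ler_norm.
Qed.

(** Cauchy-Schwarz for [G] and the constant 1 on the interval between the two times. *)
Lemma primitive_holder (G : R -> R) t t' : sqint mu I01 G -> I01 t -> I01 t' ->
  `|primitive G t - primitive G t'| <=
  Num.sqrt `|t - t'| * Num.sqrt (\int[mu]_(x in I01) (G x ^+ 2)).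
Proof.
move=> hG; wlog tt : t t' / t' <= t.
  move=> H t1 t2; have [|/ltW] := leP t' t; first by move=> ?; exact: H.
  by move=> ?; rewrite distrC (distrC t); exact: H.
move=> /I01P/andP[t0 t1] /I01P/andP[t'0 t'1].
have iG := sqint_I01_integrable hG.
have tt0 : 0 <= t - t' by rewrite subr_ge0.
rewrite primitiveB// (ger0_norm tt0).
pose D : set (measurableTypeR R) := `]t', t]%classic.
have mD : measurable D by exact: measurable_itv.
have DI : D `<=` I01.
  move=> x; rewrite /D/= in_itv/= => /andP[? ?]; apply/I01P; apply/andP; lra.
have muD : mu D = (t - t')%:E.
  have -> : mu D = (if t'%:E < t%:E then t%:E + - t'%:E else 0)%E :=
    lebesgue_measure_itv `]t', t].
  rewrite lte_fin; case: ltP => //= h; have -> : t = t' by apply/le_anti/andP.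
  by rewrite subrr.
have sub (g : R -> R) : sqint mu I01 g -> sqint mu D g.
  move=> [mg ig]; split; first exact: (measurable_funS measurable_I01 DI mg).
  apply: le_lt_trans ig; apply: ge0_subset_integral => //.
  - exact: measurable_I01.
  - by apply/measurable_EFinP/measurable_funX.
  - by move=> x _; rewrite lee_fin sqr_ge0.
have := sqint_CS mD (sub _ (sqint_cst 1)) (sub _ hG).
under eq_Rintegral do rewrite mul1r.
under [X in _ <= Num.sqrt X * _ -> _]eq_Rintegral do rewrite expr1n.
rewrite Rintegral_cst// mul1r [X in fine X]muD/= => h; apply: le_trans h _.
apply: ler_wpM2l; first exact: sqrtr_ge0.
apply: ler_wsqrtr; rewrite -lee_fin -!sqint_integralE//; first last.
- exact: sub.
- exact: measurable_I01.
have [mG _] := hG.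
apply: ge0_subset_integral => //.
- exact: measurable_I01.
- by apply/measurable_EFinP/measurable_funX.
- by move=> x _; rewrite lee_fin sqr_ge0.
Qed.

Lemma chain_holder s F i t t' : chain s F -> (i < s)%N -> I01 t -> I01 t' ->
  `|F i t - F i t'| <= Num.sqrt `|t - t'| * Num.sqrt (\int[mu]_(x in I01) (F i.+1 x ^+ 2)).
Proof.
move=> cF is_ t01 t'01; rewrite (chain_step cF is_ t01) (chain_step cF is_ t'01).
rewrite opprD addrACA subrr add0r; apply: primitive_holder => //.
by have [] := chain_regular cF is_.
Qed.

Lemma I01_dist_le1 t t' : I01 t -> I01 t' -> `|t - t'| <= 1 :> R.
Proof.
move=> /I01P/andP[? ?] /I01P/andP[? ?]; rewrite ler_norml; apply/andP; split; lra.
Qed.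

Lemma I01_0 : I01 (0 : R). Proof. by apply/I01P; rewrite lexx ler01. Qed.

Lemma chain_osc s F i t t' : chain s F -> (i < s)%N -> I01 t -> I01 t' ->
  `|F i t - F i t'| <= Num.sqrt (\int[mu]_(x in I01) (F i.+1 x ^+ 2)).
Proof.
move=> cF is_ t01 t'01; apply: le_trans (chain_holder cF is_ t01 t'01) _.
rewrite ler_piMl ?sqrtr_ge0// -sqrtr1; apply: ler_wsqrtr; exact: I01_dist_le1.
Qed.

Lemma sqint_le_cst (G : R -> R) (c : R) : sqint mu I01 G ->
  (forall t, I01 t -> G t ^+ 2 <= c) -> \int[mu]_(t in I01) (G t ^+ 2) <= c.
Proof.
move=> hG Gc.
have -> : c = \int[mu]_(t in I01) c.
  by rewrite Rintegral_cst ?[X in fine X]lebesgue_I01 ?mulr1//; exact: measurable_I01.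
apply: le_Rintegral => //; first exact: measurable_I01.
- exact: sqint_integrable measurable_I01 hG.
- exact/sqint_I01_integrable/sqint_cst.
Qed.

Lemma cst_le_sqint (G : R -> R) (c : R) : mu.-integrable I01 (EFin \o G) ->
  (forall t, I01 t -> c <= G t) -> c <= \int[mu]_(t in I01) G t.
Proof.
move=> hG Gc.
have -> : c = \int[mu]_(t in I01) c.
  by rewrite Rintegral_cst ?[X in fine X]lebesgue_I01 ?mulr1//; exact: measurable_I01.
apply: le_Rintegral => //; first exact: measurable_I01.
exact/sqint_I01_integrable/sqint_cst.
Qed.

Lemma sqrD_le2 (x y : R) : (x + y) ^+ 2 <= 2 * x ^+ 2 + 2 * y ^+ 2.
Proof. by have := sqr_ge0 (x - y); rewrite sqrrB sqrrD; lra. Qed.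

Lemma chain_step_sqr_le s F i t t' : chain s F -> (i < s)%N -> I01 t -> I01 t' ->
  F i t ^+ 2 <= 2 * F i t' ^+ 2 + 2 * \int[mu]_(x in I01) (F i.+1 x ^+ 2).
Proof.
move=> cF is_ t01 t'01; rewrite -[F i t](subrK (F i t')) [X in X ^+ 2]addrC.
apply: le_trans (sqrD_le2 _ _) _; rewrite lerD2l ler_pM2l//.
rewrite -(real_normK (num_real (F i t - _))).
have I0 : 0 <= \int[mu]_(x in I01) (F i.+1 x ^+ 2).
  by apply: Rintegral_ge0 => x _; exact: sqr_ge0.
rewrite -[leRHS](sqr_sqrtr I0) lerXn2r ?nnegrE ?sqrtr_ge0//.
exact: chain_osc cF is_ t01 t'01.
Qed.

(** Each integration multiplies the constant by 4: if the square integral of [F i.+1] is at most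
    [4 ^+ n] times the form, that of [F i] is at most [2 + 2 * 4 ^+ n] times it, by
    [chain_step_sqr_le] from time 0. *)
Lemma chain_integral_le s F i : chain s F -> (i <= s)%N ->
  \int[mu]_(x in I01) (F i x ^+ 2) <= 4 ^+ s * chainB s F F.
Proof.
move=> cF.
have B0 : 0 <= chainB s F F by exact: (sip_ge0 (chain_sip s)).
have [h1 h2] := chainB_sqr_ge cF.
suff H n : (n <= s)%N -> \int[mu]_(x in I01) (F (s - n)%N x ^+ 2) <= 4 ^+ n * chainB s F F.
  move=> is_; rewrite -(subKn is_); apply: le_trans (H _ (leq_subr _ _)) _.
  by apply: ler_wpM2r => //; rewrite ler_eXn2l ?leq_subr//; lra.
elim: n => [|n IH] ns; first by rewrite subn0 expr0 mul1r.
have lt : (s - n.+1 < s)%N by rewrite ltn_subrL (leq_ltn_trans _ ns).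
apply: sqint_le_cst => [|t t01].
  by have [] := chain_regular cF (ltnW lt).
apply: le_trans (chain_step_sqr_le cF lt t01 I01_0) _.
rewrite subnSK//; have := IH (ltnW ns); have := h1 _ lt.
have x1 : 1 <= 4 ^+ n :> R by rewrite exprn_ege1//; lra.
have h : chainB s F F <= 4 ^+ n * chainB s F F by rewrite ler_peMl.
by rewrite (exprS (4 : R) n) -mulrA; move: (4 ^+ n * _) h => y; lra.
Qed.

(** [F i.+1] is continuous and does not vanish on [[a, b]], so by the intermediate value theorem it
    stays positive, and [F i] grows at rate at least [M]. *)
Lemma chain_growth s F i a b (M : R) : chain s F -> (i.+1 < s)%N ->
  0 <= a -> a <= b -> b <= 1 -> 0 < F i.+1 a -> 0 <= M ->
  (forall t, a <= t -> t <= b -> M < `|F i.+1 t|) ->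
  M * (b - a) <= F i b - F i a.
Proof.
move=> cF is_ a0 ab b1 Fa M0 H.
have [si ac] := chain_regular cF (ltnW is_).
have F0 t : a <= t -> t <= b -> 0 < F i.+1 t.
  move=> at_ tb; rewrite ltNge; apply/negP => Ft.
  have cw : {within `[a, t], continuous (F i.+1)}.
    apply: continuous_subspaceW (cont01_within (ac01_cont (ac is_))).
    by move=> x /=; rewrite in_itv/= => /andP[? ?]; apply/I01P; apply/andP; lra.
  have [|x] := @IVT _ (F i.+1) a t 0 at_ cw.
    by rewrite ge_min le_max Ft (ltW Fa) orbT.
  rewrite in_itv/= => /andP[ax xt] Fx.
  by have := H x ax (le_trans xt tb); rewrite Fx normr0; lra.
have a01 : I01 a by apply/I01P; rewrite a0 (le_trans ab).
have b01 : I01 b by apply/I01P; rewrite (le_trans a0 ab).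
rewrite (chain_step cF (ltnW is_) a01) (chain_step cF (ltnW is_) b01).
rewrite opprD addrACA subrr add0r primitiveB//; last exact: sqint_I01_integrable.
pose D : set (measurableTypeR R) := `]a, b]%classic.
have mD : measurable D by exact: measurable_itv.
have DI : D `<=` I01.
  move=> x; rewrite /D/= in_itv/= => /andP[? ?]; apply/I01P; apply/andP; lra.
have muD : mu D = (b - a)%:E.
  have -> : mu D = (if a%:E < b%:E then b%:E + - a%:E else 0)%E :=
    lebesgue_measure_itv `]a, b].
  rewrite lte_fin; case: ltP => //= h; have -> : a = b by apply/le_anti/andP.
  by rewrite subrr.
have <- : \int[mu]_(x in D) M = M * (b - a).
  by rewrite Rintegral_cst// [X in fine X]muD.
apply: le_Rintegral => //.
- exact/(integrable_sub_I01 mD DI)/sqint_I01_integrable/sqint_cst.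
- exact/(integrable_sub_I01 mD DI)/sqint_I01_integrable.
move=> x; rewrite /D/= in_itv/= => /andP[ax xb].
by have := H x (ltW ax) xb; rewrite gtr0_norm ?F0 ?(ltW ax)//; exact: ltW.
Qed.

(** If the bound failed throughout [[a, b]], [F i.+1] would keep its sign and [F i] would vary by at
    least [2 * K + 1], whereas its end values allow [2 * K]; the added 1 makes the contradiction
    strict. *)
Lemma chain_mean_value s F i a b (K c : R) : chain s F -> (i.+1 < s)%N ->
  I01 a -> I01 b -> 0 < c -> a + c <= b -> `|F i a| <= K -> `|F i b| <= K ->
  exists t, [/\ I01 t, a <= t, t <= b & `|F i.+1 t| <= (2 * K + 1) / c].
Proof.
move=> cF is_ a01 b01 c0 ab Ka Kb.
apply: contrapT => H.
have /I01P/andP[a0 a1] := a01; have /I01P/andP[b0 b1] := b01.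
have {}H t : a <= t -> t <= b -> (2 * K + 1) / c < `|F i.+1 t|.
  move=> at_ tb; rewrite ltNge; apply/negP => h; apply: H; exists t; split => //.
  by apply/I01P; apply/andP; lra.
have K0 : 0 <= K by apply: le_trans Ka.
have M0 : 0 < (2 * K + 1) / c by rewrite divr_gt0//; lra.
have ab' : a <= b by lra.
have Mc : 2 * K + 1 <= (2 * K + 1) / c * (b - a).
  by rewrite -mulrA ler_peMr ?ler_pdivlMl//; lra.
move: Ka Kb; rewrite !ler_norml => /andP[Ka1 Ka2] /andP[Kb1 Kb2].
have [Fa|Fa] := ltP 0 (F i.+1 a).
  have := chain_growth cF is_ a0 ab' b1 Fa (ltW M0) H; lra.
(* [-2 * F + F] is [- F]: the negative case reduces to the positive one through [chain_lin]. *)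
have cN := chain_lin (-2) cF cF.
have /= := @chain_growth s _ i a b _ cN is_ a0 ab' b1 _ (ltW M0).
have Fa0 : 0 < -2 * F i.+1 a + F i.+1 a.
  have := H a (lexx _) ab'; rewrite ler0_norm//; lra.
move=> /(_ Fa0) h; have {h} := h _.
have E x : -2 * F i.+1 x + F i.+1 x = - F i.+1 x by ring.
by move=> h; have := h (fun t at_ tb => ltac:(rewrite E normrN; exact: H)); lra.
Qed.

(* Between consecutive points where [F i] is bounded there is one where [F i.+1]
   is, so that half of the separated points survive one differentiation. *)
Lemma chain_bound n (K C c : R) : 0 <= K -> 0 <= C -> 0 < c ->
  exists K' : R, 0 <= K' /\ forall F (x : nat -> R), chain n.+1 F ->
    (forall a, (a < 2 ^ n)%N -> I01 (x a) /\ `|F 0%N (x a)| <= K) ->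
    (forall a, (a.+1 < 2 ^ n)%N -> x a + c <= x a.+1) ->
    \int[mu]_(t in I01) (F n.+1 t ^+ 2) <= C ->
    forall i, (i < n.+1)%N -> forall t, I01 t -> `|F i t| <= K'.
Proof.
move=> K0 C0 c0; elim: n K K0 => [|n IH] K K0.
  exists (K + Num.sqrt C); split; first by rewrite addr_ge0// sqrtr_ge0.
  move=> F x cF Fx _ FC i; rewrite ltnS leqn0 => /eqP -> t t01.
  have [x01 xK] := Fx 0%N isT.
  rewrite -(subrK (F 0%N (x 0%N)) (F 0%N t)) addrC.
  apply: le_trans (ler_normD _ _) (lerD xK _).
  apply: le_trans (chain_osc cF _ t01 x01) _ => //; exact: ler_wsqrtr.
have K1 : 0 <= (2 * K + 1) / c by rewrite divr_ge0//; [lra|exact: ltW].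
have [K' [K'0 hK']] := IH _ K1.
exists (K + K'); split; first exact: addr_ge0.
move=> F x cF Fx xc FC.
(* The points are taken in disjoint pairs [x a.*2], [x a.*2.+1]; consecutive pairs lie [c] apart, so
   the [y a] inherit the separation. *)
have Hy a : exists t, (a < 2 ^ n)%N ->
    [/\ I01 t, x a.*2 <= t, t <= x a.*2.+1 & `|F 1%N t| <= (2 * K + 1) / c].
  have [an|] := boolP (a < 2 ^ n)%N; last by exists 0.
  have a1 : (a.*2.+1 < 2 ^ n.+1)%N by rewrite expnS; lia.
  have [x1 F1] := Fx _ (ltnW a1); have [x2 F2] := Fx _ a1.
  have [|t ht] := chain_mean_value cF _ x1 x2 c0 (xc _ a1) F1 F2 => //.
  by exists t.
have [y hy] := choice Hy.
have cF' : chain n.+1 (fun i => F i.+1).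
  by split; [exact: chain_sqint cF|move=> i is_ t t01; exact: (chain_step cF)].
have HF' := hK' _ y cF' _ _ FC.
have {}HF' i : (i < n.+1)%N -> forall t, I01 t -> `|F i.+1 t| <= K'.
  apply: HF' => a an; first by have [] := hy a an.
  have [_ _ h1 _] := hy a (ltnW an); have [_ h2 _ _] := hy _ an.
  have a2 : (a.*2.+2 < 2 ^ n.+1)%N by rewrite expnS; lia.
  have := xc _ a2; rewrite -doubleS; lra.
case=> [|i] is_ t t01; last by apply: le_trans (HF' i _ t t01) _; rewrite ?lerDr.
have [|x01 xK] := Fx 0%N; first by rewrite expn_gt0.
rewrite -(subrK (F 0%N (x 0%N)) (F 0%N t)) addrC.
apply: le_trans (ler_normD _ _) (lerD xK _).
apply: le_trans (chain_osc cF _ t01 x01) _ => //.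
rewrite -[leRHS](ger0_norm K'0) -sqrtr_sqr; apply: ler_wsqrtr.
apply: sqint_le_cst => [|u u01]; first by have [] := chain_regular cF (ltn0Sn _).
rewrite -(real_normK (num_real (F 1%N u))) lerXn2r ?nnegrE//.
exact: HF'.
Qed.

End chain_inner_product.

(** * The Sobolev space of tuples of trajectories *)

Section sobolevk_space.
Context {R : realType} {k d : nat}.
Local Notation mu := (@lebesgue_measure R).
Local Notation traj := ('I_k.+1 -> R -> 'rV[R]_d).
Variable s : nat.
Hypothesis s_gt0 : (0 < s)%N.
Implicit Types (u v w : traj).

Definition deriv_chain u (j : 'I_k.+1) (l : 'I_d) (i : nat) : R -> R :=
  coord l (nderiv01 i (u j)).

Lemma deriv_chainP u j l : sobolevk s u -> chain s (deriv_chain u j l).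
Proof. by move=> su; exact: sobolev_chain. Qed.

Lemma deriv_chain_lin (a : R) u v j l : sobolevk s u -> sobolevk s v ->
  [/\ forall i, (i < s)%N -> {in I01, deriv_chain (a *: u + v) j l i =1
        (fun t => a * deriv_chain u j l i t + deriv_chain v j l i t)} &
    {ae mu, forall t, I01 t -> deriv_chain (a *: u + v) j l s t =
        a * deriv_chain u j l s t + deriv_chain v j l s t}].
Proof.
move=> su sv; have [_ h1 h2] := sobolev_lin a s_gt0 (su j) (sv j); split.
  by move=> i is_ t t01; rewrite /deriv_chain /coord h1// !mxE.
by apply: ae_I01P h2 => t _ h; rewrite /deriv_chain /coord h !mxE.
Qed.

Lemma sobolevk_lin (a : R) u v : sobolevk s u -> sobolevk s v ->
  sobolevk s (a *: u + v).
Proof. by move=> su sv j; have [] := sobolev_lin a s_gt0 (su j) (sv j). Qed.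

Definition sobB u v : R :=
  \sum_j \sum_(l < d) chainB s (deriv_chain u j l) (deriv_chain v j l).

Lemma chainB_deriv_lin (a : R) u v w j l :
  sobolevk s u -> sobolevk s v -> sobolevk s w ->
  chainB s (deriv_chain (a *: u + v) j l) (deriv_chain w j l) =
  a * chainB s (deriv_chain u j l) (deriv_chain w j l) +
    chainB s (deriv_chain v j l) (deriv_chain w j l).
Proof.
move=> su sv sw; have [h1 h2] := deriv_chain_lin a j l su sv.
rewrite -(sip_lin (chain_sip s) a); try exact: deriv_chainP.
apply: eq_chainB => //; try exact: deriv_chainP.
- exact/deriv_chainP/sobolevk_lin.
- by apply: chain_lin; exact: deriv_chainP.
- by move=> i is_; rewrite h1// inE; exact: I01_0.
Qed.

Lemma sobolevk_sip : semi_inner_product (V := traj) (sobolevk s) sobB.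
Proof.
split.
- by move=> a u v su sv; exact: sobolevk_lin.
- move=> u v su sv; apply: eq_bigr => j _; apply: eq_bigr => l _.
  by apply: (sip_sym (chain_sip s)); exact: deriv_chainP.
- move=> a u v w su sv sw; rewrite /sobB mulr_sumr -big_split; apply: eq_bigr => j _.
  rewrite mulr_sumr -big_split; apply: eq_bigr => l _; exact: chainB_deriv_lin.
- move=> u su; apply: sumr_ge0 => j _; apply: sumr_ge0 => l _.
  by apply: (sip_ge0 (chain_sip s)); exact: deriv_chainP.
Qed.

Lemma chainB_le_sobB u j l : sobolevk s u ->
  chainB s (deriv_chain u j l) (deriv_chain u j l) <= sobB u u.
Proof.
move=> su; rewrite /sobB (bigD1 j)//= (bigD1 l)//= -addrA lerDl addr_ge0//.
  by apply: sumr_ge0 => l' _; apply: (sip_ge0 (chain_sip s)); exact: deriv_chainP.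
apply: sumr_ge0 => j' _; apply: sumr_ge0 => l' _.
by apply: (sip_ge0 (chain_sip s)); exact: deriv_chainP.
Qed.

(** The derivatives of a difference are the differences on [[0, 1]] below order [s], and almost
    everywhere at order [s]; [chainB] does not see the discrepancy, and [eq_chainB] removes it in
    one argument at a time. *)
Lemma chainB_deriv_sub u v F j l : sobolevk s u -> sobolevk s v -> chain s F ->
  (forall i, (i < s)%N -> {in I01, deriv_chain v j l i =1 F i}) ->
  {ae mu, forall t, I01 t -> deriv_chain v j l s t = F s t} ->
  chainB s (deriv_chain (u - v) j l) (deriv_chain (u - v) j l) =
  chainB s (deriv_chain u j l - F) (deriv_chain u j l - F).
Proof.
move=> su sv cF h1 h2.
have cu : chain s (deriv_chain u j l) by exact: deriv_chainP.
have cv : chain s (deriv_chain v j l) by exact: deriv_chainP.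
have suv : sobolevk s (u - v) by exact: (sip_subr sobolevk_sip).
have cuv : chain s (deriv_chain (u - v) j l) by exact: deriv_chainP.
have cuF : chain s (deriv_chain u j l - F) by exact: (sip_subr (chain_sip s)).
have e0 i : (i < s)%N -> deriv_chain (u - v) j l i 0 = (deriv_chain u j l - F) i 0.
  have [h3 _] := deriv_chain_lin (-1) j l sv su.
  move=> is_; rewrite addrC -scaleN1r h3 ?inE//; last exact: I01_0.
  by rewrite h1 ?inE//; [rewrite mulN1r addrC|exact: I01_0].
have eae : {ae mu, forall t, I01 t -> deriv_chain (u - v) j l s t = (deriv_chain u j l - F) s t}.
  have [_ h3] := deriv_chain_lin (-1) j l sv su.
  have FF := ae_filter_ringOfSetsType mu.
  apply: filterS2 h2 h3 => t h2 h3 t01.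
  by rewrite addrC -scaleN1r h3// h2// mulN1r addrC.
rewrite (eq_chainB cuv cuF cuv e0 eae) (sip_sym (chain_sip s) cuF cuv).
exact: (eq_chainB cuv cuF cuF e0 eae).
Qed.

Lemma sobolevk_complete : sip_complete (V := traj) (sobolevk s) sobB.
Proof.
move=> u su hu.
have H j l : exists F, chain s F /\ forall e : R, 0 < e -> exists N, forall n, (N <= n)%N ->
    chainB s (deriv_chain (u n) j l - F) (deriv_chain (u n) j l - F) <= e.
  apply: (chain_complete (u := fun n => deriv_chain (u n) j l)).
    by move=> n; exact: deriv_chainP.
  move=> e e0; have [N hN] := hu e e0; exists N => m n Nm Nn.
  apply: le_trans (hN m n Nm Nn).
  rewrite -(@chainB_deriv_sub (u m) (u n) (deriv_chain (u n) j l) j l) //.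
  - by apply: chainB_le_sobB; exact: (sip_subr sobolevk_sip).
  - exact: deriv_chainP.
  - by apply: aeW.
have {H} /choice[F hF] : forall j, exists F : 'I_d -> nat -> R -> R, forall l,
    chain s (F l) /\ forall e : R, 0 < e -> exists N, forall n, (N <= n)%N ->
    chainB s (deriv_chain (u n) j l - F l) (deriv_chain (u n) j l - F l) <= e.
  by move=> j; have [F hF] := choice (H j); exists F.
pose G j (i : nat) t : 'rV[R]_d := \row_l F j l i t.
have GF j l : (fun i => coord l (G j i)) = F j l.
  by apply/funext => i; apply/funext => t; rewrite /coord mxE.
have Hv j := @chain_sobolev R d s (G j 0%N) (G j) s_gt0.
have {}Hv j : [/\ sobolev s (G j 0%N), forall i, (i < s)%N -> {in I01, nderiv01 i (G j 0%N) =1 G j i} &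
    {ae mu, forall t, I01 t -> nderiv01 s (G j 0%N) t = G j s t}].
  by apply: Hv => // l; rewrite GF; have [] := hF j l.
pose v : traj := fun j => G j 0%N.
have sv : sobolevk s v by move=> j; have [] := Hv j.
have key n j l : chainB s (deriv_chain (u n - v) j l) (deriv_chain (u n - v) j l) =
    chainB s (deriv_chain (u n) j l - F j l) (deriv_chain (u n) j l - F j l).
  have [cF _] := hF j l; have [_ h1 h2] := Hv j.
  apply: chainB_deriv_sub => //.
    by move=> i is_ t t01; rewrite /deriv_chain /coord h1// mxE.
  by apply: ae_I01P h2 => t _ h; rewrite /deriv_chain /coord h mxE.
exists v; split => // e e0.
have : sobB (u n - v) (u n - v) @[n --> \oo] --> \sum_(j < k.+1) \sum_(l < d) (0 : R).
  apply: cvg_sum_ord => j; apply: cvg_sum_ord => l; apply/cvg_seqP => g g0.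
  have [cF h] := hF j l; have [N hN] := h g g0; exists N => n Nn.
  rewrite subr0 key ger0_norm ?hN//; apply: (sip_ge0 (chain_sip s)).
  by apply: (sip_subr (chain_sip s)) => //; exact: deriv_chainP.
rewrite big1 => [|j _]; last by rewrite big1.
move=> /cvg_seqP/(_ e e0)[N hN]; exists N => n /hN.
by rewrite subr0; apply: le_trans; exact: ler_norm.
Qed.

Lemma sobolevk_sqnorm2 u j i : sobolevk s u -> (i <= s)%N ->
  sqnorm2 (nderiv01 i (u j)) = \sum_(l < d) \int[mu]_(t in I01) (deriv_chain u j l i t ^+ 2).
Proof.
move=> su is_; apply: sqnorm2E; apply/square_integrable01P => l.
by have [] := chain_regular (deriv_chainP j l su) is_.
Qed.

Lemma sobolevk_norm_sqr u : sobolevk s u -> sobolevk_norm s u ^+ 2 =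
  \sum_j \sum_(i < s.+1) \sum_(l < d) \int[mu]_(t in I01) (deriv_chain u j l i t ^+ 2).
Proof.
move=> su; rewrite /sobolevk_norm sqr_sqrtr.
  apply: eq_bigr => j _; apply: eq_bigr => i _; apply: sobolevk_sqnorm2 => //.
  by rewrite -ltnS.
by do 2 ![apply: sumr_ge0 => ? _]; apply: Rintegral_ge0 => t _; exact: sqr_ge0.
Qed.

Lemma integral_le_sobolevk_norm u j l i : sobolevk s u -> (i <= s)%N ->
  \int[mu]_(t in I01) (deriv_chain u j l i t ^+ 2) <= sobolevk_norm s u ^+ 2.
Proof.
move=> su is_; rewrite sobolevk_norm_sqr//.
have p0 j' l' i' : 0 <= \int[mu]_(t in I01) (deriv_chain u j' l' i' t ^+ 2).
  by apply: Rintegral_ge0 => t _; exact: sqr_ge0.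
have is' : (i < s.+1)%N by [].
rewrite (bigD1 j)//= (bigD1 (Ordinal is'))//= (bigD1 l)//= -!addrA lerDl.
by rewrite !addr_ge0//; do ![apply: sumr_ge0 => ? _].
Qed.

(** Functionals in [sobolevk_dual] are bounded in the full Sobolev norm; this makes them bounded for
    [sobB], the form to which the abstract compactness theorem is applied. *)
Lemma sobolevk_norm_le u : sobolevk s u ->
  sobolevk_norm s u ^+ 2 <= s.+1%:R * 4 ^+ s * sobB u u.
Proof.
move=> su; rewrite sobolevk_norm_sqr// /sobB mulr_sumr; apply: ler_sum => j _.
rewrite exchange_big/= mulr_sumr; apply: ler_sum => l _.
rewrite -mulrA -[X in X%:R]card_ord mulr_natl -sumr_const.
apply: ler_sum => i _; apply: chain_integral_le; first exact: deriv_chainP.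
by rewrite -ltnS.
Qed.

Lemma sobolevk_dual_sip L : sobolevk_dual s L -> sip_dual (sobolevk s) sobB L.
Proof.
move=> [Llin [C LC]]; split; first exact: Llin.
have K0 : 0 <= s.+1%:R * 4 ^+ s :> R by rewrite mulr_ge0// exprn_ge0.
exists (`|C| * Num.sqrt (s.+1%:R * 4 ^+ s)) => u su.
apply: le_trans (LC u su) _.
have n0 : 0 <= sobolevk_norm s u by exact: sqrtr_ge0.
apply: (@le_trans _ _ (`|C| * sobolevk_norm s u)).
  by rewrite ler_wpM2r// ler_norm.
rewrite -mulrA ler_wpM2l// -sqrtrM// -(ger0_norm n0) -sqrtr_sqr.
exact/ler_wsqrtr/sobolevk_norm_le.
Qed.

Theorem sobolevk_weak_compact (u : nat -> traj) C : (forall n, sobolevk s (u n)) ->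
  (forall n, sobB (u n) (u n) <= C) ->
  exists h : nat -> nat, {homo h : m n / (m < n)%N} /\
  exists v, weak_cvg s (u \o h) v.
Proof.
move=> su uC; have [h [hh [v [sv hv]]]] := sip_weak_compact sobolevk_sip sobolevk_complete su uC.
exists h; split => //; exists v; split => // L /sobolevk_dual_sip; exact: hv.
Qed.

(** Evaluation at a time is a bounded functional: averaging [chain_step_sqr_le] over the second time
    bounds the squared value by twice the integrals of orders 0 and 1, hence by 4 times the squared
    norm. *)
Lemma weak_cvg_pointwise (u : nat -> traj) v : weak_cvg s u v ->
  forall j t l, I01 t -> u n j t ord0 l @[n --> \oo] --> v j t ord0 l.
Proof.
move=> [sv uv] j t l t01; apply: (uv (fun w => w j t ord0 l)); split.
  by move=> a w w' _ _; rewrite !mxE.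
exists 2 => w sw.
have cw := deriv_chainP j l sw.
have n0 : 0 <= sobolevk_norm s w by exact: sqrtr_ge0.
apply: normr_le_sqr; first exact: mulr_ge0.
pose I i := \int[mu]_(x in I01) (deriv_chain w j l i x ^+ 2).
have h0 := integral_le_sobolevk_norm j l sw (leq0n s).
have h1 := integral_le_sobolevk_norm j l sw s_gt0.
have sq0 : sqint mu I01 (deriv_chain w j l 0) by have [] := chain_regular cw (leq0n s).
have : (w j t ord0 l ^+ 2 - 2 * I 1%N) / 2 <= I 0%N.
  apply: cst_le_sqint; first exact: sqint_integrable measurable_I01 sq0.
  move=> x x01; have := chain_step_sqr_le cw s_gt0 t01 x01.
  by rewrite /I {1}/deriv_chain /coord /nderiv01/=; lra.
by rewrite exprMn; rewrite /I; lra.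
Qed.

(** The bilinear form behind the penalty, semidefinite only. *)
Definition topB u v : R :=
  \sum_j \sum_(l < d) \int[mu]_(t in I01) (deriv_chain u j l s t * deriv_chain v j l s t).

Lemma topB_sip : semi_inner_product (V := traj) (sobolevk s) topB.
Proof.
have L2 := sqint_sip mu measurable_I01.
have sq u j l : sobolevk s u -> sqint mu I01 (deriv_chain u j l s).
  by move=> su; exact: chain_sqint (deriv_chainP j l su).
split.
- by move=> a u v su sv; exact: sobolevk_lin.
- move=> u v su sv; apply: eq_bigr => j _; apply: eq_bigr => l _.
  by apply: (sip_sym L2); exact: sq.
- move=> a u v w su sv sw; rewrite /topB mulr_sumr -big_split; apply: eq_bigr => j _.
  rewrite mulr_sumr -big_split; apply: eq_bigr => l _ /=.
  rewrite -(sip_lin L2 a (sq u j l su) (sq v j l sv) (sq w j l sw)).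
  have [_ h] := deriv_chain_lin a j l su sv.
  congr fine; apply: ae_eq_integral.
  + exact: measurable_I01.
  + apply/measurable_EFinP/measurable_funM; last by have [] := sq w j l sw.
    by have [] := sq (a *: u + v) j l (sobolevk_lin a su sv).
  + apply/measurable_EFinP/measurable_funM; last by have [] := sq w j l sw.
    by have [] := sqint_lin a measurable_I01 (sq u j l su) (sq v j l sv).
  + by apply: ae_I01P h => t _ ->.
- move=> u su; apply: sumr_ge0 => j _; apply: sumr_ge0 => l _.
  by apply: Rintegral_ge0 => t _; rewrite -expr2 sqr_ge0.
Qed.

Lemma penaltyE (lambda : R) u : sobolevk s u -> penalty s lambda u = lambda * topB u u.
Proof.
move=> su; rewrite /penalty; congr (_ * _); apply: eq_bigr => j _.
by rewrite sobolevk_sqnorm2.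
Qed.

Lemma topB_le_norm u : sobolevk s u -> topB u u <= sobolevk_norm s u ^+ 2.
Proof.
move=> su; rewrite sobolevk_norm_sqr//; apply: ler_sum => j _.
rewrite big_ord_recr/= lerDr; apply: sumr_ge0 => i _; apply: sumr_ge0 => l _.
by apply: Rintegral_ge0 => t _; exact: sqr_ge0.
Qed.

(** Since [topB] is nonnegative at [u n - v], twice [topB (u n) v] is at most
    [topB (u n) (u n) + topB v v]. The left side is a bounded functional of [u n] and passes to the
    weak limit. *)
Lemma weak_cvg_penalty (lambda : R) (u : nat -> traj) v c N : 0 < lambda ->
  (forall n, sobolevk s (u n)) -> weak_cvg s u v ->
  (forall n, (N <= n)%N -> penalty s lambda (u n) <= c) -> penalty s lambda v <= c.
Proof.
move=> l0 su [sv uv] uc.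
have dL : sobolevk_dual s (fun w => topB w v).
  split; first by move=> a w w' sw sw'; exact: (sip_lin topB_sip).
  exists (Num.sqrt (topB v v)) => w sw.
  apply: le_trans (sip_CS topB_sip sw sv) _; rewrite mulrC.
  apply: ler_wpM2l; first exact: sqrtr_ge0.
  have n0 : 0 <= sobolevk_norm s w by exact: sqrtr_ge0.
  by rewrite -(ger0_norm n0) -sqrtr_sqr; exact/ler_wsqrtr/topB_le_norm.
have h := uv _ dL.
have h2 : topB v v <= (c / lambda + topB v v) / 2.
  rewrite -(cvg_lim (@Rhausdorff R) h); apply: limr_le; first by apply/cvg_ex; eexists; exact: h.
  exists N => // n /= Nn.
  have := sip_ge0 topB_sip (sip_subr topB_sip (su n) sv).
  rewrite (sip_sqrB topB_sip (su n) sv).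
  have : topB (u n) (u n) <= c / lambda by rewrite ler_pdivlMr// mulrC -penaltyE//; exact: uc.
  rewrite (cvg_lim (@Rhausdorff R) h); lra.
by rewrite penaltyE// mulrC -ler_pdivlMr//; lra.
Qed.

(* On tuples with bounded penalty, boundedness at sufficiently many separated
   times controls the whole Sobolev norm. *)
Lemma sobolev_points_bound (K C c : R) : 0 <= K -> 0 <= C -> 0 < c ->
  exists K' : R, 0 <= K' /\ forall u j (x : nat -> R), sobolevk s u ->
    (forall a, (a < 2 ^ s.-1)%N -> I01 (x a) /\ enorm (u j (x a)) <= K) ->
    (forall a, (a.+1 < 2 ^ s.-1)%N -> x a + c <= x a.+1) ->
    sqnorm2 (nderiv01 s (u j)) <= C ->
    forall i, (i < s)%N -> forall t l, I01 t -> `|deriv_chain u j l i t| <= K'.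
Proof.
move=> K0 C0 c0; have [K' [K'0 H]] := @chain_bound R s.-1 K C c K0 C0 c0.
exists K'; split => // u j x su ux xc uC i is_ t l t01.
rewrite prednK// in H.
apply: (H (deriv_chain u j l) x) => //.
- exact: deriv_chainP.
- move=> a ha; have [x01 xK] := ux a ha; split => //.
  by apply: le_trans xK; exact: coord_le_enorm.
- apply: le_trans uC; rewrite sobolevk_sqnorm2// (bigD1 l)//= lerDl.
  by apply: sumr_ge0 => l' _; apply: Rintegral_ge0 => t' _; exact: sqr_ge0.
Qed.

Lemma sobB_bound (K C : R) : 0 <= K -> 0 <= C -> exists K' : R, forall u, sobolevk s u ->
  (forall j t, I01 t -> enorm (u j t) <= K) ->
  (forall j, sqnorm2 (nderiv01 s (u j)) <= C) -> sobB u u <= K'.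
Proof.
move=> K0 C0.
(* A trajectory bounded everywhere is bounded at [2 ^ s.-1] equally spaced times. *)
pose n := (2 ^ s.-1)%N.
have n0 : (0 < n)%N by rewrite expn_gt0.
have c0 : 0 < n%:R^-1 :> R by rewrite invr_gt0 ltr0n.
have [K' [K'0 H]] := sobolev_points_bound K0 C0 c0.
exists (\sum_(j < k.+1) \sum_(l < d) (s%:R * K' ^+ 2 + C)) => u su uK uC.
apply: ler_sum => j _; apply: ler_sum => l _; rewrite chainB_sqr; apply: lerD.
  rewrite -[X in X%:R]card_ord mulr_natl -sumr_const; apply: ler_sum => i _.
  rewrite -(real_normK (num_real (deriv_chain _ _ _ _ _))) lerXn2r ?nnegrE//.
  apply: (H u j (fun a => a%:R / n%:R)) => //; last exact: I01_0.
    move=> a an; have a01 : I01 (a%:R / n%:R : R).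
      apply/I01P; rewrite divr_ge0//= ler_pdivrMr ?ltr0n// mul1r ler_nat.
      exact: ltnW.
    by split => //; exact: uK.
  by move=> a _; rewrite -{2}[n%:R^-1]mul1r -mulrDl -natr1.
apply: le_trans (uC j); rewrite sobolevk_sqnorm2// (bigD1 l)//= lerDl.
by apply: sumr_ge0 => l' _; apply: Rintegral_ge0 => t' _; exact: sqr_ge0.
Qed.

Lemma sobolevk_holder u j l t t' : sobolevk s u -> I01 t -> I01 t' ->
  `|u j t ord0 l - u j t' ord0 l| <=
  Num.sqrt `|t - t'| * Num.sqrt (4 ^+ s * sobB u u).
Proof.
move=> su t01 t'01; have cu := deriv_chainP j l su.
apply: le_trans (chain_holder cu s_gt0 t01 t'01) _.
apply: ler_wpM2l; first exact: sqrtr_ge0.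
apply: ler_wsqrtr; apply: le_trans (chain_integral_le cu s_gt0) _.
by apply: ler_wpM2l; [exact: exprn_ge0|exact: chainB_le_sobB].
Qed.

Lemma sobolevk_cont u j l : sobolevk s u -> cont01 (coord l (u j)).
Proof.
move=> su; have cu := deriv_chainP j l su.
have [_] := chain_regular cu (leq0n s).
by move=> /(_ s_gt0)/ac01_cont.
Qed.

Lemma sobolev_cst (c : 'rV[R]_d) : sobolev s (fun _ : R => c) /\
  sqnorm2 (nderiv01 s (fun _ : R => c)) = 0.
Proof.
pose F (i : nat) (t : R) : 'rV[R]_d := if i == 0%N then c else 0.
have [|//|h1 h2 h3] := @chain_sobolev R d s (fun _ => c) F s_gt0.
  move=> l; split.
    rewrite /coord /F gtn_eqF//=; have := @sqint_cst R 0.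
    by congr (sqint _ _ _); apply/funext => t; rewrite mxE.
  move=> i is_ t t01; rewrite /primitive.
  have -> : \int[mu]_(x in `[0, t]) coord l (F i.+1) x = \int[mu]_(x in `[0, t]) (0 : R).
    by apply: eq_Rintegral => x _; rewrite /coord mxE.
  rewrite Rintegral_cst ?mul0r ?addr0; last exact: measurable_itv.
  by case: i is_ => //.
split => //.
have [_ _ sq] := h1; have /square_integrable01P sql := sq.
rewrite sqnorm2E// big1// => l _.
have -> : 0 = \int[mu]_(t in I01) (0 : R).
  by rewrite Rintegral_cst ?mul0r//; exact: measurable_I01.
congr fine; apply: ae_eq_integral.
- exact: measurable_I01.
- by apply/measurable_EFinP/measurable_funX; have [] := sql l.
- exact: measurable_cst.
- by apply: ae_I01P h3 => t _ h; rewrite /coord h /F gtn_eqF// mxE expr0n.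
Qed.

Lemma sobolevk_replace (lambda : R) (c : 'I_k.+1 -> 'rV[R]_d) u (J : pred 'I_k.+1) :
  0 <= lambda -> sobolevk s u ->
  let v := fun j => if J j then u j else fun=> c j in
  sobolevk s v /\ penalty s lambda v <= penalty s lambda u.
Proof.
move=> l0 su v; split.
  by move=> j; rewrite /v; case: (J j); [exact: su|have [] := sobolev_cst (c j)].
apply: ler_wpM2l => //; apply: ler_sum => j _; rewrite /v; case: (J j) => //.
have [_ ->] := sobolev_cst (c j).
by apply: Rintegral_ge0 => t _; exact: sqr_ge0.
Qed.

End sobolevk_space.

(** * The strong law of large numbers *)

Section independence.
Context {d d1 d2 d3 : measure_display} {Omega : measurableType d}
  {U1 : measurableType d1} {U2 : measurableType d2} {U3 : measurableType d3}
  {R : realType} (P : probability Omega R).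

(** The joint law is the product of the laws, as both agree on rectangles; Tonelli then applies,
    [w'] acting as an independent copy of the outcome. *)
Lemma ge0_integral_indep (X : Omega -> U1) (Y : Omega -> U2)
    (mX : measurable_fun setT X) (mY : measurable_fun setT Y)
    (F : U1 * U2 -> \bar R) :
  (forall A B, measurable A -> measurable B ->
    P (X @^-1` A `&` Y @^-1` B) = (P (X @^-1` A) * P (Y @^-1` B))%E) ->
  measurable_fun setT F -> (forall x, 0 <= F x)%E ->
  (\int[P]_w F (X w, Y w) = \int[P]_w \int[P]_w' F (X w, Y w'))%E.
Proof.
move=> ind mF F0.
have mXY : measurable_fun setT (fun w => (X w, Y w)) by exact: measurable_fun_pair.
pose X' : {mfun Omega >-> U1} := mfun_Sub (mem_set mX).
pose Y' : {mfun Omega >-> U2} := mfun_Sub (mem_set mY).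
pose XY : {mfun Omega >-> (U1 * U2)%type} := mfun_Sub (mem_set mXY).
have /= E1 := @ge0_integral_distribution _ _ _ _ _ P XY F mF F0.
transitivity (\int[distribution P XY]_z F z)%E; first by rewrite E1.
transitivity (\int[distribution P X' \x distribution P Y']_z F z)%E.
  apply: eq_measure_integral => A mA _; apply: esym.
  apply: (@product_measure_unique _ _ _ _ _ (distribution P X') (distribution P Y')
    (distribution P XY)) => // B C mB mC; exact: ind.
rewrite fubini_tonelli1//.
have mG : measurable_fun setT (fun x => \int[distribution P Y']_y F (x, y))%E.
  exact: measurable_fun_fubini_tonelli_F.
have G0 x : (0 <= \int[distribution P Y']_y F (x, y))%E by exact: integral_ge0.
have /= E2 := @ge0_integral_distribution _ _ _ _ _ P X' _ mG G0.
rewrite [LHS]E2; apply: eq_integral => w _ /=.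
have mFx : measurable_fun setT (fun y => F (X w, y)).
  by apply: (measurableT_comp mF); exact: measurable_fun_pair.
by have /= E3 := @ge0_integral_distribution _ _ _ _ _ P Y' _ mFx (fun y => F0 _); rewrite [LHS]E3.
Qed.

(** The sets [E] satisfying the conclusion form a Dynkin system containing the rectangles, which
    generate the product sigma-algebra. *)
Lemma indep_pair (X : Omega -> U1) (Y : Omega -> U2) (Z : Omega -> U3)
    (mX : measurable_fun setT X) (mY : measurable_fun setT Y)
    (mZ : measurable_fun setT Z) :
  (forall A B C, measurable A -> measurable B -> measurable C ->
    P (X @^-1` A `&` Y @^-1` B `&` Z @^-1` C) =
      (P (X @^-1` A) * P (Y @^-1` B) * P (Z @^-1` C))%E) ->
  forall E C, measurable E -> measurable C ->
    P ((fun w => (X w, Y w)) @^-1` E `&` Z @^-1` C) =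
    (P ((fun w => (X w, Y w)) @^-1` E) * P (Z @^-1` C))%E.
Proof.
move=> ind E C mE mC.
pose XY w := (X w, Y w).
have mXY : measurable_fun setT XY by exact: measurable_fun_pair.
have mpre (S : set (U1 * U2)) : measurable S -> measurable (XY @^-1` S).
  by move=> mS; rewrite -[X in measurable X]setTI; exact: mXY.
have mZC : measurable (Z @^-1` C) by rewrite -[X in measurable X]setTI; exact: mZ.
move: E mE; rewrite measurable_prod_measurableType.
apply: dynkin_induction => /=.
- by rewrite measurable_prod_measurableType.
- move=> _ _ [A1 mA1 [A2 mA2 <-]] [B1 mB1 [B2 mB2 <-]].
  exists (A1 `&` B1); first exact: measurableI.
  exists (A2 `&` B2); first exact: measurableI.
  by rewrite setXI.
- by rewrite preimage_setT setTI probability_setT mul1e.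
- move=> _ [A mA [B mB <-]].
  have -> : (fun w => (X w, Y w)) @^-1` (A `*` B) = X @^-1` A `&` Y @^-1` B by [].
  rewrite ind//; congr (_ * _)%E.
  by have := ind A B setT mA mB measurableT; rewrite preimage_setT setIT probability_setT mule1.
- move=> S mS HS; rewrite -/XY in HS *.
  have mS' := mpre S mS.
  rewrite preimage_setC probability_setC//.
  have -> : ~` (XY @^-1` S) `&` Z @^-1` C = Z @^-1` C `\` (XY @^-1` S `&` Z @^-1` C).
    by rewrite setDE setCI setIUr setICr setU0 setIC.
  rewrite measureD//; last 2 first.
  + exact: measurableI.
  + by rewrite -ge0_fin_numE// fin_num_measure.
  have -> : Z @^-1` C `&` (XY @^-1` S `&` Z @^-1` C) = XY @^-1` S `&` Z @^-1` C.
    by rewrite setIC -setIA setIid.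
  have fS := fin_num_measure P _ mS'; have fZ := fin_num_measure P _ mZC.
  set p := fine (P (XY @^-1` S)); set z := fine (P (Z @^-1` C)).
  transitivity (z%:E - (p * z)%:E)%E.
    congr (_ - _)%E; first exact: esym (fineK fZ).
    by rewrite EFinM !fineK//; exact: HS.
  transitivity ((1 - p%:E) * z%:E)%E.
    by rewrite -!EFinB -EFinM; congr EFin; ring.
  by congr (_ * _)%E; [congr (_ - _)%E; exact: fineK fS|exact: fineK fZ].
- move=> F mF tF HF; rewrite -/XY in HF *.
  have tF1 : trivIset setT (fun n => XY @^-1` F n).
    by move=> i j _ _ [w [Fi Fj]]; apply: (tF i j) => //; exists (XY w).
  have tF2 : trivIset setT (fun n => XY @^-1` F n `&` Z @^-1` C).
    by move=> i j _ _ [w [[Fi _] [Fj _]]]; apply: (tF i j) => //; exists (XY w).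
  have -> : XY @^-1` (\bigcup_k F k) `&` Z @^-1` C =
      \bigcup_k (XY @^-1` F k `&` Z @^-1` C).
    by rewrite preimage_bigcup setI_bigcupl.
  rewrite preimage_bigcup !measure_bigcup//; last 2 first.
  + by move=> n _; exact: mpre.
  + by move=> n _; apply: measurableI => //; exact: mpre.
  rewrite muleC -(fineK (fin_num_measure P _ mZC)) -nneseriesZl//.
  apply: eq_eseriesr => n _; apply: (eq_trans (HF n)); rewrite muleC.
  by congr (_ * _)%E; exact: (esym (fineK (fin_num_measure P _ mZC))).
Qed.

End independence.

Section sparse_averages.
Context {R : realType}.

Lemma exists_nat_ge (x : R) : exists n : nat, x <= n%:R.
Proof.
exists (Num.bound `|x|); apply: le_trans (ler_norm x) _.
exact/ltW/archi_boundP.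
Qed.

(** From [m ^ 2] to an index below [m.+1 ^ 2] there are at most [2 * m] steps, over which [a] moves
    by at most [2 * m%:R * c], small against [m ^ 2]. Squares are sparse enough for the variances of
    averages to be summable along them. *)
Lemma sublinear_squares (a : nat -> R) (c : R) : 0 <= c ->
  (forall n, `|a n.+1 - a n| <= c) ->
  (forall e : R, 0 < e -> exists M, forall m, (M <= m)%N ->
     `|a (m ^ 2)%N| <= e * (m ^ 2)%:R) ->
  forall e : R, 0 < e -> exists N, forall n, (N <= n)%N -> `|a n| <= e * n%:R.
Proof.
move=> c0 ac H e e0.
have aD n j : `|a (n + j)%N - a n| <= j%:R * c.
  elim: j => [|j IH]; first by rewrite addn0 subrr normr0 mul0r.
  have -> : a (n + j.+1)%N - a n = (a (n + j).+1 - a (n + j)%N) + (a (n + j)%N - a n).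
    by rewrite addnS; ring.
  rewrite -natr1 mulrDl mul1r; apply: le_trans (ler_normD _ _) _.
  by rewrite addrC; exact: lerD.
have [M HM] := H (e / 2) (divr_gt0 e0 (ltr0n _ 2)).
have [M' HM'] : exists M', 4 * c / e <= M'%:R.
  exact: exists_nat_ge.
exists (maxn M M' ^ 2)%N => n Nn.
have [m /andP[m1 m2]] : exists m, (m ^ 2 <= n < m.+1 ^ 2)%N.
  elim: n {Nn} => [|n [m /andP[m1 m2]]]; first by exists 0%N.
  have [h|h] := ltnP n.+1 (m.+1 ^ 2); first by exists m; rewrite h (leq_trans m1).
  by exists m.+1; rewrite h /=; apply: (leq_ltn_trans m2); rewrite ltn_exp2r.
have mM : (maxn M M' <= m)%N.
  by rewrite -ltnS -(ltn_exp2r _ _ (erefl : (0 < 2)%N)); exact: leq_ltn_trans m2.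
have := HM m (leq_trans (leq_maxl _ _) mM) => h1.
have := aD (m ^ 2)%N (n - m ^ 2)%N; rewrite subnKC// => h2.
have m1R : (m ^ 2)%:R <= n%:R :> R by rewrite ler_nat.
have h3 : (n - m ^ 2)%:R * c <= 2 * m%:R * c.
  by rewrite ler_wpM2r// -natrM ler_nat; lia.
have h4 : 4 * c <= e * m%:R.
  rewrite [leRHS]mulrC -ler_pdivrMr// (le_trans HM')// ler_nat.
  exact: leq_trans (leq_maxr _ _) mM.
have h5 : 2 * m%:R * c <= e / 2 * (m ^ 2)%:R.
  rewrite natrX expr2; have : 0 <= m%:R :> R by [].
  move: (m%:R) h4 => x h4 x0; have := ler_wpM2l x0 h4; lra.
have : `|a n| <= `|a n - a (m ^ 2)%N| + `|a (m ^ 2)%N|.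
  by rewrite -{1}(subrK (a (m ^ 2)%N) (a n)); exact: ler_normD.
have := ler_wpM2l (ltW e0) m1R.
move: h1 h2 h3 h5; move: (`|a n|) (`|_ - _|) (`|a _|) ((n - _)%:R * c) (_ * _ * c).
by move=> x y z u v; lra.
Qed.

Lemma sum_inv_sqr (N : nat) : \sum_(m < N) (m.+1%:R ^+ 2)^-1 <= 2 :> R.
Proof.
have H n : \sum_(m < n.+1) (m.+1%:R ^+ 2)^-1 <= 2 - n.+1%:R^-1 :> R.
  elim: n => [|n IH]; first by rewrite big_ord1 expr1n invr1; lra.
  rewrite big_ord_recr/=; apply: le_trans (lerD IH (lexx _)) _.
  have n0 : 0 < n.+1%:R :> R by [].
  have -> : n.+2%:R = n.+1%:R + 1 :> R by rewrite natr1.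
  move: (n.+1%:R) n0 => x x0.
  have : 0 <= x^-1 - (x + 1)^-1 - ((x + 1) ^+ 2)^-1.
    have -> : x^-1 - (x + 1)^-1 - ((x + 1) ^+ 2)^-1 = (x * (x + 1) ^+ 2)^-1.
      by field; rewrite ?gt_eqF ?ltr_wpDl ?addr_gt0// ltW.
    by rewrite invr_ge0 mulr_ge0 ?sqr_ge0// ltW.
  move: (x^-1) ((x + 1)^-1) (_ ^-1) => a b c'; lra.
case: N => [|n]; first by rewrite big_ord0.
apply: le_trans (H n) _; have : 0 <= n.+1%:R^-1 :> R by [].
move: (_^-1) => x; lra.
Qed.

(** A geometric sum of ratio 2 is at most twice its last term. It bounds by a first moment the
    expected numbers, summed over [m], of samples among the first [2 ^ m] that exceed [2 ^+ m]. *)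
Lemma sum_dyadic_small (x : R) N : 0 <= x ->
  \sum_(m < N) (if 2 ^+ m < x then 2 ^+ m else 0) <= 2 * x.
Proof.
move=> x0.
have H n : \sum_(m < n) (if 2 ^+ m < x then 2 ^+ m else 0) <= Num.min (2 ^+ n) (2 * x).
  elim: n => [|n IH]; first by rewrite big_ord0 le_min expr0 mulr_ge0//; lra.
  rewrite big_ord_recr/=; move: IH; rewrite !le_min => /andP[h1 h2].
  have : 0 < 2 ^+ n :> R by rewrite exprn_gt0.
  rewrite exprS; case: ifP => h; move: h h1 h2; move: (\sum_(_ < _) _) (2 ^+ n) => s y.
    by move=> h h1 h2 y0; apply/andP; split; lra.
  by move=> _ h1 h2 y0; apply/andP; split; lra.
by apply: le_trans (H N) _; rewrite ge_min lexx orbT.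
Qed.

(** A geometric sum of ratio [2^-1] is at most twice its first term. It bounds by a first moment the
    variances, summed over [m], of averages of [2 ^ m] samples truncated at [2 ^+ m]. *)
Lemma sum_dyadic_large (x : R) N : 0 <= x ->
  \sum_(m < N) (2 ^+ m)^-1 * (if x <= 2 ^+ m then x else 0) ^+ 2 <= 2 * x.
Proof.
move=> x0.
set S := fun n => \sum_(m < n) (2 ^+ m)^-1 * (if x <= 2 ^+ m then x else 0) ^+ 2.
(* As long as the level is below [x] all terms vanish; afterwards the subtracted term is the tail of
   the series still to come. *)
have H n : (x <= 2 ^+ n -> S n <= 2 * x - 2 * (2 ^+ n)^-1 * x ^+ 2) /\
    (2 ^+ n < x -> S n = 0).
  elim: n => [|n [IH1 IH2]].
    rewrite /S big_ord0 expr0; split=> // x1; rewrite invr1 mulr1 expr2.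
    have := ler_wpM2l x0 x1; lra.
  have y0 : 0 < 2 ^+ n :> R by rewrite exprn_gt0.
  have SE : S n.+1 = S n + (2 ^+ n)^-1 * (if x <= 2 ^+ n then x else 0) ^+ 2.
    by rewrite /S big_ord_recr.
  rewrite SE exprS; move: (2 ^+ n) y0 IH1 IH2 => y y0 IH1 IH2.
  have i0 : 2 * (2 * y)^-1 = y^-1 by field; exact: lt0r_neq0.
  have [xy|yx] := leP x y.
    split; last by move=> h; lra.
    move=> _; rewrite i0; have := IH1 xy; move: (y^-1) => z; lra.
  rewrite (IH2 yx) expr0n/= mulr0 addr0; split=> // xy; rewrite i0.
  have : y^-1 * x <= 2 by rewrite mulrC ler_pdivrMr.
  move: (y^-1) => z h; have := ler_wpM2l x0 h; rewrite expr2; lra.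
have [xN|Nx] := leP x (2 ^+ N); last by rewrite -/(S N) (H N).2// mulr_ge0.
apply: le_trans ((H N).1 xN) _; rewrite gerBl mulr_ge0 ?sqr_ge0// mulr_ge0// invr_ge0 exprn_ge0//.
Qed.

End sparse_averages.

Section probability_integral.
Context {d : measure_display} {Omega : measurableType d} {R : realType}
  (P : probability Omega R).

Lemma bounded_prob_integrable (f : Omega -> R) (b : R) : measurable_fun setT f ->
  (forall x, 0 <= f x <= b) -> P.-integrable setT (EFin \o f).
Proof.
move=> mf fb; apply: (le_integrable measurableT _ _ (_ : P.-integrable setT (EFin \o cst b))) => //.
- exact/measurable_EFinP.
- by move=> x _ /=; have /andP[f0 f1] := fb x; rewrite lee_fin !ger0_norm//; exact: le_trans f1.
- exact: finite_measure_integrable_cst.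
Qed.

Lemma bounded_prob_integralE (f : Omega -> R) (b : R) : measurable_fun setT f ->
  (forall x, 0 <= f x <= b) -> (\int[P]_w (f w)%:E = (\int[P]_w f w)%:E)%E.
Proof.
move=> mf fb; rewrite /Rintegral fineK//.
exact: (integrable_fin_num measurableT (bounded_prob_integrable mf fb)).
Qed.

End probability_integral.

Section orthogonal_sums.
Context {R : realType} {V : lmodType R} (S : set V) (B : V -> V -> R).
Hypothesis HB : semi_inner_product S B.

Lemma sip_orthogonal_sum (u : nat -> V) (v : R) : (forall n, S (u n)) ->
  (forall i j, i != j -> B (u i) (u j) = 0) -> (forall i, B (u i) (u i) <= v) ->
  forall n, S (\sum_(i < n) u i) /\
    B (\sum_(i < n) u i) (\sum_(i < n) u i) <= n%:R * v.
Proof.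
move=> Su ou uv n.
have S0 : S 0 by rewrite -(subrr (u 0%N)); exact: (sip_subr HB).
have SD x y : S x -> S y -> S (x + y).
  by move=> Sx Sy; rewrite -(scale1r x); exact: (sip_closed HB).
have Ss m : S (\sum_(i < m) u i).
  by elim: m => [|m IH]; rewrite ?big_ord0// big_ord_recr/=; exact: SD.
have BD x y z : S x -> S y -> S z -> B (x + y) z = B x z + B y z.
  by move=> Sx Sy Sz; rewrite -{1}(scale1r x) (sip_lin HB)// mul1r.
have B0 z : S z -> B 0 z = 0.
  by move=> Sz; rewrite -(subrr (u 0%N)) (sipBl HB)// subrr.
have Bs m j : (m <= j)%N -> B (\sum_(i < m) u i) (u j) = 0.
  elim: m => [|m IH] mj; first by rewrite big_ord0 B0.
  rewrite big_ord_recr/= (BD _ _ _ (Ss m) (Su m) (Su j)) (IH (ltnW mj)) ou ?addr0//.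
  by apply/eqP => mE; rewrite mE ltnn in mj.
split=> //; elim: n => [|n IH]; first by rewrite big_ord0 B0// mul0r.
have Sn := SD _ _ (Ss n) (Su n).
rewrite big_ord_recr/= (BD _ _ _ (Ss n) (Su n) Sn) !(sip_sym HB _ Sn)// !BD//.
rewrite (sip_sym HB (Su n) (Ss n)) !Bs// addr0 add0r -natr1 mulrDl mul1r.
exact: lerD.
Qed.

End orthogonal_sums.

Section slln.
Context {dO dU : measure_display} {Omega : measurableType dO}
  {U : measurableType dU} {R : realType} (P : probability Omega R)
  (T : nat -> Omega -> U).
Hypothesis mT : forall i, measurable_fun setT (T i).
Hypothesis indT : forall i j, i != j -> forall A B, measurable A -> measurable B ->
  P (T i @^-1` A `&` T j @^-1` B) = (P (T i @^-1` A) * P (T j @^-1` B))%E.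
Hypothesis idT : identically_distributed P T.

Lemma ge0_integral_identical (F : U -> \bar R) i : measurable_fun setT F ->
  (forall x, 0 <= F x)%E -> (\int[P]_w F (T i w) = \int[P]_w F (T 0%N w))%E.
Proof.
move=> mF F0.
pose X j : {mfun Omega >-> U} := mfun_Sub (mem_set (mT j)).
have /= Ei := @ge0_integral_distribution _ _ _ _ _ P (X i) F mF F0.
have /= E0 := @ge0_integral_distribution _ _ _ _ _ P (X 0%N) F mF F0.
transitivity (\int[distribution P (X i)]_z F z)%E; first by rewrite Ei.
transitivity (\int[distribution P (X 0%N)]_z F z)%E; last by rewrite E0.
by apply: eq_measure_integral => A mA _; exact: idT.
Qed.

(** Pairwise independence makes the centred variables orthogonal in L^2 of [P], and a variance is at
    most the second moment. *)
Lemma variance_sum (h : U -> R) (b : R) n : measurable_fun setT h ->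
  (forall x, 0 <= h x <= b) ->
  (\int[P]_w ((\sum_(i < n) h (T i w) - n%:R * \int[P]_w' h (T 0%N w')) ^+ 2)%:E <=
  (n%:R * \int[P]_w (h (T 0%N w) ^+ 2))%:E)%E.
Proof.
move=> mh hb; set e := Rintegral _ _ _; set v := (\int[P]_w (h (T 0%N w) ^+ 2))%R.
pose B (f g : Omega -> R) := \int[P]_w (f w * g w).
have sip := @sqint_sip _ _ R P setT measurableT; rewrite -/B in sip.
have mhT i : measurable_fun setT (fun w => h (T i w)).
  by apply: measurableT_comp (mT i).
have Scst c : sqint P setT (fun=> c).
  split; first exact: measurable_cst.
  by rewrite integral_cst// [X in (_ * X)%E]probability_setT mule1 ltry.
have SF (f : Omega -> R) (c : R) : measurable_fun setT f -> (forall x, `|f x| <= c) -> sqint P setT f.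
  move=> mf fc; split=> //; apply: le_lt_trans (proj2 (Scst c)).
  apply: ge0_le_integral => //.
  - by move=> x _; rewrite lee_fin sqr_ge0.
  - by apply/measurable_EFinP; exact: measurable_funX.
  - move=> x _; rewrite lee_fin -(ger0_norm (sqr_ge0 (f x))) normrX.
    apply: lerXn2r; rewrite ?nnegrE//; exact: le_trans (fc x).
have Sh i : sqint P setT (fun w => h (T i w)).
  apply: (SF _ b) => // w; have /andP[h0 hb'] := hb (T i w).
  by rewrite ger0_norm.
have hint i : P.-integrable setT (EFin \o (fun w => h (T i w))).
  have := sqint_mul measurableT (Scst 1) (Sh i).
  by congr (integrable _ _ (EFin \o _)); apply/funext => w; rewrite mul1r.
have hE i : (\int[P]_w (h (T i w))%:E = e%:E)%E.
  have <- : (\int[P]_w (h (T 0%N w))%:E = e%:E)%E.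
    by rewrite /e /Rintegral fineK//; exact: (integrable_fin_num measurableT (hint 0%N)).
  apply: (@ge0_integral_identical (fun x => (h x)%:E) i); first exact/measurable_EFinP.
  by move=> x; rewrite lee_fin; have /andP[] := hb x.
have hRE i : \int[P]_w h (T i w) = e by rewrite /Rintegral hE.
have hhE i j : i != j -> B (fun w => h (T i w)) (fun w => h (T j w)) = e * e.
  move=> ij; rewrite /B /Rintegral.
  have H0 x : 0 <= h x by have /andP[] := hb x.
  have := @ge0_integral_indep _ _ _ _ _ _ _ P (T i) (T j) (mT i) (mT j)
    (fun z => (h z.1 * h z.2)%:E) (indT ij).
  move=> /= ->.
  - have -> : (fun w => \int[P]_w' (h (T i w) * h (T j w'))%:E)%E = (fun w => (h (T i w) * e)%:E).
      apply/funext => w; under eq_integral do rewrite EFinM.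
      rewrite ge0_integralZl ?lee_fin ?hE//; first exact/measurable_EFinP.
      by move=> x _; rewrite lee_fin.
    rewrite (_ : (fun w => (h (T i w) * e)%:E) = (fun w => e%:E * (h (T i w))%:E)%E); last first.
      by apply/funext => w; rewrite mulrC EFinM.
    rewrite ge0_integralZl ?lee_fin ?hE//; first exact/measurable_EFinP.
      by move=> x _; rewrite lee_fin.
    by rewrite /e; apply: Rintegral_ge0.
  - apply/measurable_EFinP; apply: measurable_funM.
      exact: (measurableT_comp mh measurable_fst).
    exact: (measurableT_comp mh measurable_snd).
  - by move=> x; rewrite lee_fin mulr_ge0.
have B1 c : B (fun=> c) (fun=> c) = c * c.
  by rewrite /B Rintegral_cst// [X in fine X]probability_setT mulr1.
have Bh1 i : B (fun w => h (T i w)) (fun=> e) = e * e.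
  rewrite /B -{3}(hRE i) -RintegralZl//; apply: eq_Rintegral => w _; exact: mulrC.
have Bhh i : B (fun w => h (T i w)) (fun w => h (T i w)) = v.
  rewrite /B /v /Rintegral; congr fine.
  rewrite -(@ge0_integral_identical (fun x => (h x ^+ 2)%:E) i)//.
  - by apply/measurable_EFinP; exact: measurable_funX.
  - by move=> x; rewrite lee_fin sqr_ge0.
pose u i : Omega -> R := (fun w => h (T i w)) - (fun=> e).
have Su i : sqint P setT (u i) by exact: (sip_subr sip).
have Buu i j : B (u i) (u j) =
    B (fun w => h (T i w)) (fun w => h (T j w)) - e * e.
  rewrite /u (sipBl sip)//; last exact: Su.
  rewrite !(sipBr sip)// (sip_sym sip (Scst e) (Sh j)) B1 !Bh1; ring.
have [] := @sip_orthogonal_sum _ _ _ _ sip u v Su _ _ n.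
- by move=> i j ij; rewrite Buu hhE// subrr.
- by move=> i; rewrite Buu Bhh gerBl -expr2 sqr_ge0.
have -> : \sum_(i < n) u i = fun w => \sum_(i < n) h (T i w) - n%:R * e.
  apply/funext => w; rewrite fct_sumE sumrB sumr_const card_ord mulr_natl//.
move=> S1; rewrite -lee_fin => S2; apply: le_trans S2.
by rewrite [leLHS](sqint_integralE measurableT S1).
Qed.

Lemma integral_variance (h : U -> R) (b : R) n : measurable_fun setT h ->
  (forall x, 0 <= h x <= b) ->
  (\int[P]_w ((n.+1%:R^-1 * \sum_(i < n.+1) h (T i w) -
     \int[P]_w' h (T 0%N w')) ^+ 2)%:E <=
  (n.+1%:R^-1)%:E * \int[P]_w (h (T 0%N w) ^+ 2)%:E)%E.
Proof.
move=> mh hb; set e := Rintegral _ _ _.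
have mS : measurable_fun setT
    (fun w => (\sum_(i < n.+1) h (T i w) - n.+1%:R * e) ^+ 2).
  apply: measurable_funX; apply: measurable_funB => //.
  by apply: measurable_sum => i; exact: measurableT_comp (mT i).
have := variance_sum n.+1 mh hb; rewrite -/e => V.
have n0 : (0 <= (n.+1%:R^-1 : R) ^+ 2) by rewrite sqr_ge0.
have -> : (fun w => ((n.+1%:R^-1 * \sum_(i < n.+1) h (T i w) - e) ^+ 2)%:E) =
    (fun w => ((n.+1%:R^-1) ^+ 2)%:E *
      ((\sum_(i < n.+1) h (T i w) - n.+1%:R * e) ^+ 2)%:E)%E.
  by apply/funext => w; rewrite -EFinM -exprMn mulrBr mulrA mulVf// mul1r.
rewrite ge0_integralZl ?lee_fin//; first last.
- by move=> x _; rewrite lee_fin sqr_ge0.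
- exact/measurable_EFinP.
apply: le_trans (lee_wpmul2l _ V) _; first by rewrite lee_fin.
rewrite (@bounded_prob_integralE _ _ _ _ (fun w => h (T 0%N w) ^+ 2) (b ^+ 2)); first last.
- move=> w; have /andP[h0 h1] := hb (T 0%N w); rewrite sqr_ge0/=.
  by apply: lerXn2r; rewrite ?nnegrE//; exact: le_trans h1.
- by apply: measurable_funX; exact: measurableT_comp (mT _).
rewrite -!EFinM lee_fin mulrA expr2 -(mulrA _ _ n.+1%:R) mulVf// mulr1//.
Qed.

End slln.

Section strong_law.
Context {dO dU : measure_display} {Omega : measurableType dO}
  {U : measurableType dU} {R : realType} (P : probability Omega R)
  (T : nat -> Omega -> U).
Hypothesis mT : forall i, measurable_fun setT (T i).
Hypothesis indT : forall i j, i != j -> forall A B, measurable A -> measurable B ->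
  P (T i @^-1` A `&` T j @^-1` B) = (P (T i @^-1` A) * P (T j @^-1` B))%E.
Hypothesis idT : identically_distributed P T.

Lemma slln_bounded (h : U -> R) (b : R) : measurable_fun setT h ->
  (forall x, 0 <= h x <= b) ->
  {ae P, forall w, forall e : R, 0 < e -> exists N, forall n, (N <= n)%N ->
    `|\sum_(i < n) h (T i w) - n%:R * \int[P]_w' h (T 0%N w')| <= e * n%:R}.
Proof.
move=> mh hb; set m := Rintegral _ _ _.
have mhT i : measurable_fun setT (fun w => h (T i w)).
  by apply: measurableT_comp (mT i).
pose f j w := ((j.+1 ^ 2)%:R^-1 * \sum_(i < j.+1 ^ 2) h (T i w) - m) ^+ 2.
have mf j : measurable_fun setT (f j).
  apply: measurable_funX; apply: measurable_funB => //; apply: measurable_funM => //.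
  by apply: measurable_sum => i.
have h0 x : 0 <= h x by have /andP[] := hb x.
have h1 x : h x <= b by have /andP[] := hb x.
have fI j : (\int[P]_w (f j w)%:E <= (b ^+ 2 * (j.+1%:R ^+ 2)^-1)%:E)%E.
  have E : ((j.+1 ^ 2).-1.+1 = j.+1 ^ 2)%N by rewrite prednK// expn_gt0.
  have := integral_variance mT indT idT (j.+1 ^ 2).-1 mh hb; rewrite E => V.
  apply: le_trans V _; rewrite natrX mulrC EFinM lee_wpmul2l ?lee_fin ?invr_ge0 ?sqr_ge0//.
  apply: (@le_trans _ _ (\int[P]_w (b ^+ 2)%:E)%E).
    apply: ge0_le_integral => //.
    - by move=> w _; rewrite lee_fin sqr_ge0.
    - by apply/measurable_EFinP; exact: measurable_funX.
    - by move=> w _; rewrite lee_fin lerXn2r ?nnegrE//; exact: le_trans (h1 (T 0%N w)).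
  by rewrite integral_cst// [X in (_ * X)%E]probability_setT mule1.
have HA : {ae P, forall w, setT w -> f n w @[n --> \oo] --> 0}.
  apply: (@ae_cvg0_summable _ _ R P setT f (b ^+ 2 * 2) measurableT mf).
    by move=> n w _; exact: sqr_ge0.
  move=> N; apply: (@le_trans _ _ (\sum_(j < N) (b ^+ 2 * (j.+1%:R ^+ 2)^-1)%:E)%E).
    by apply: lee_sum => j _; exact: fI.
  rewrite sumEFin lee_fin -mulr_sumr ler_wpM2l ?sqr_ge0//; exact: sum_inv_sqr.
move: HA; apply: filterS => w Hw; have {}Hw := (cvg_seqP _ _).1 (Hw I).
pose a n := \sum_(i < n) h (T i w) - n%:R * m.
apply: (@sublinear_squares _ a (b + `|m|)).
- by rewrite addr_ge0//; exact: le_trans (h0 (T 0%N w)) (h1 _).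
- move=> n; have -> : a n.+1 - a n = h (T n w) - m.
    by rewrite /a big_ord_recr/= -natr1; ring.
  by apply: le_trans (ler_normB _ _) _; rewrite lerD// ger0_norm.
move=> e e0; have [M HM] := Hw (e ^+ 2) (exprn_gt0 2 e0).
exists M.+1 => -[//|j] jM; have := HM j jM.
rewrite subr0 ger0_norm ?sqr_ge0// /f => H.
have : (j.+1 ^ 2 != 0)%N by rewrite expn_eq0.
move: (j.+1 ^ 2)%N H => q H q0.
have {}q0 : q%:R != 0 :> R by rewrite pnatr_eq0.
have -> : a q = (q%:R^-1 * \sum_(i < q) h (T i w) - m) * q%:R.
  by rewrite mulrBl mulrAC mulVf// mul1r mulrC.
move: (_ - m) H => z H.
rewrite normrM [X in _ * X <= _]ger0_norm// ler_wpM2r//.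
rewrite -ler_sqr ?nnegrE ?(ltW e0)//.
by rewrite real_normK ?num_real.
Qed.

Lemma sum_integral_le (q : nat -> U -> R) (H : U -> R) (c : R) N :
  (forall m, measurable_fun setT (q m)) -> (forall m x, 0 <= q m x) ->
  measurable_fun setT H -> (forall x, \sum_(m < N) q m x <= 2 * H x) ->
  (forall x, 0 <= H x) -> (\int[P]_w (H (T 0%N w))%:E = c%:E)%E ->
  (\sum_(m < N) \int[P]_w (q m (T 0%N w))%:E <= (2 * c)%:E)%E.
Proof.
move=> mq q0 mH qH H0 Hc.
have mqT m : measurable_fun setT (fun w => (q m (T 0%N w))%:E).
  by apply/measurable_EFinP; apply: measurableT_comp (mT _).
have mHT : measurable_fun setT (fun w => (H (T 0%N w))%:E).
  by apply/measurable_EFinP; apply: measurableT_comp (mT _).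
rewrite -ge0_integral_sum//; last by move=> m w _; rewrite lee_fin.
rewrite EFinM -Hc -ge0_integralZl//; last by move=> w _; rewrite lee_fin.
apply: ge0_le_integral => //.
- by move=> w _; apply: sume_ge0 => m _; rewrite lee_fin.
- by apply: emeasurable_sum => m; exact: mqT.
- by apply: measurable_funeM.
- by move=> w _; rewrite sumEFin -EFinM lee_fin.
Qed.

(** The first [2 ^ m] samples are truncated at [2 ^+ m]: by the dyadic estimates the truncated
    averages approach their means, and almost surely no sample is truncated for large [m].
    Interpolation between powers of 2 loses a factor 2, harmless as the lemma is applied to
    remainders of small mean. *)
Lemma slln_tail (H : U -> R) (c : R) : measurable_fun setT H ->
  (forall x, 0 <= H x) -> (\int[P]_w (H (T 0%N w))%:E = c%:E)%E ->
  {ae P, forall w, forall e : R, 0 < e -> exists N, forall n, (N <= n)%N ->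
    \sum_(i < n) H (T i w) <= (2 * c + e) * n%:R}.
Proof.
move=> mH H0 Hc.
pose h m x := if H x <= 2 ^+ m then H x else 0.
pose g m x := if 2 ^+ m < H x then 1 else 0 : R.
have mh m : measurable_fun setT (h m).
  apply: measurable_fun_ifT => //; exact: measurable_fun_ler.
have mg m : measurable_fun setT (g m).
  apply: measurable_fun_ifT => //; exact: measurable_fun_ltr.
have h0 m x : 0 <= h m x <= 2 ^+ m.
  by rewrite /h; case: ifP => [->|_]; rewrite ?H0// lexx exprn_ge0.
have hH m x : h m x <= H x by rewrite /h; case: ifP.
have g0 m x : 0 <= g m x <= 1 by rewrite /g; case: ifP => _; rewrite !lexx ler01.
pose E m := \int[P]_w h m (T 0%N w).
have mhT m i : measurable_fun setT (fun w => h m (T i w)).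
  by apply: measurableT_comp (mT i).
have mgT m i : measurable_fun setT (fun w => g m (T i w)).
  by apply: measurableT_comp (mT i).
have Ec m : E m <= c.
  rewrite -lee_fin -Hc /E -(@bounded_prob_integralE _ _ _ P _ (2 ^+ m))//.
  apply: ge0_le_integral => //.
  - by move=> w _; rewrite lee_fin; have /andP[] := h0 m (T 0%N w).
  - exact/measurable_EFinP.
  - by apply/measurable_EFinP; apply: measurableT_comp (mT _).
  - by move=> w _; rewrite lee_fin.
pose F m w := ((2 ^ m)%:R^-1 * \sum_(i < 2 ^ m) h m (T i w) - E m) ^+ 2.
pose G m w := \sum_(i < 2 ^ m) g m (T i w).
have mF m : measurable_fun setT (F m).
  apply: measurable_funX; apply: measurable_funB => //; apply: measurable_funM => //.
  by apply: measurable_sum => i.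
have mG m : measurable_fun setT (G m) by apply: measurable_sum => i.
have G0 m w : 0 <= G m w by apply: sumr_ge0 => i _; have /andP[] := g0 m (T i w).
have aeF : {ae P, forall w, setT w -> F n w @[n --> \oo] --> 0}.
  apply: (@ae_cvg0_summable _ _ R P setT F (2 * c) measurableT mF).
    by move=> n w _; exact: sqr_ge0.
  move=> N; have := @sum_integral_le (fun m x => (2 ^+ m)^-1 * h m x ^+ 2) H c N _ _ mH _ H0 Hc.
  move=> /(_ _ _ _)/(le_trans _); apply.
  - apply: lee_sum => m _.
    have En : ((2 ^ m).-1.+1 = 2 ^ m)%N by rewrite prednK// expn_gt0.
    have := integral_variance mT indT idT (2 ^ m).-1 (mh m) (h0 m); rewrite En.
    move/le_trans; apply; rewrite -ge0_integralZl//.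
    + by under eq_integral do rewrite -EFinM natrX.
    + by apply/measurable_EFinP/measurable_funX.
    + by move=> w _; rewrite lee_fin sqr_ge0.
  - by move=> m; apply: measurable_funM => //; exact: measurable_funX.
  - by move=> m x; rewrite mulr_ge0 ?sqr_ge0// invr_ge0 exprn_ge0.
  - by move=> x; exact: sum_dyadic_large.
have aeG : {ae P, forall w, setT w -> G n w @[n --> \oo] --> 0}.
  apply: (@ae_cvg0_summable _ _ R P setT G (2 * c) measurableT mG).
    by move=> n w _.
  move=> N; have := @sum_integral_le (fun m x => \sum_(i < 2 ^ m) g m x) H c N _ _ mH _ H0 Hc.
  move=> /(_ _ _ _)/(le_trans _); apply.
  - apply: lee_sum => m _; rewrite /G.
    under eq_integral do rewrite -sumEFin.
    under [leRHS]eq_integral do rewrite -sumEFin.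
    have gE x : (0 <= (g m x)%:E)%E by rewrite lee_fin; have /andP[] := g0 m x.
    rewrite !ge0_integral_sum//; try by move=> i; apply/measurable_EFinP.
    apply: lee_sum => i _; rewrite (@ge0_integral_identical _ _ _ _ _ P T mT idT (fun x => (g m x)%:E))//.
    exact/measurable_EFinP.
  - by move=> m; apply: measurable_sum => i.
  - by move=> m x; apply: sumr_ge0 => i _; have /andP[] := g0 m x.
  - move=> x; apply: le_trans (sum_dyadic_small N (H0 x)); apply: ler_sum => m _.
    rewrite sumr_const card_ord /g -natrX; case: ifP => _; rewrite ?mul0rn//.
move: aeF aeG; apply: filterS2 => w HF HG e e0.
have {}HF := (cvg_seqP _ _).1 (HF I); have {}HG := (cvg_seqP _ _).1 (HG I).
have [M1 HM1] := HF ((e / 2) ^+ 2) (exprn_gt0 2 (divr_gt0 e0 (ltr0n _ 2))).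
(* [G m w] counts the samples above the truncation level, so it is 0 once it is at most [1 / 2]. *)
have [M2 HM2] := HG (1 / 2) (divr_gt0 (ltr0n _ 1) (ltr0n _ 2)).
have key m : (M1 <= m)%N -> (M2 <= m)%N ->
    \sum_(i < 2 ^ m) H (T i w) <= (c + e / 2) * (2 ^ m)%:R.
  move=> m1 m2; have := HM1 m m1; have := HM2 m m2.
  rewrite !subr0 !ger0_norm ?sqr_ge0// /F /G => HG' HF'.
  have hE (i : 'I_(2 ^ m)) : H (T i w) = h m (T i w).
    rewrite /h; case: leP => // lt.
    move: HG'; rewrite (bigD1 i)//= {1}/g lt => HG'.
    suff : 0 <= \sum_(j < 2 ^ m | j != i) g m (T j w) by move: (\sum_(_ < _ | _) _) HG' => z; lra.
    by apply: sumr_ge0 => j _; have /andP[] := g0 m (T j w).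
  under eq_bigr do rewrite hE.
  have : (2 ^ m != 0)%N by rewrite expn_eq0.
  move: (2 ^ m)%N HF' => q HF' q0.
  have {}q0 : 0 < q%:R :> R by rewrite ltr0n lt0n.
  have : q%:R^-1 * \sum_(i < q) h m (T i w) - E m <= e / 2.
    apply: le_trans (ler_norm _) _.
    by rewrite -ler_sqr ?nnegrE ?divr_ge0 ?(ltW e0)// real_normK ?num_real.
  have Em := Ec m => h1; rewrite [leRHS]mulrC -ler_pdivrMl//; move: (_^-1 * _) h1 => z h1; lra.
exists (2 ^ maxn M1 M2)%N => n Nn.
have [m /andP[m1 m2]] : exists m, (2 ^ m <= n < 2 ^ m.+1)%N.
  have n0 : (0 < n)%N by apply: leq_trans Nn; rewrite expn_gt0.
  exists (trunc_log 2 n); rewrite trunc_logP// trunc_log_ltn//.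
have mM : (maxn M1 M2 <= m.+1)%N.
  by rewrite ltnW// -(ltn_exp2l _ _ (erefl : (1 < 2)%N)); exact: leq_ltn_trans m2.
have := key m.+1 (leq_trans (leq_maxl _ _) mM) (leq_trans (leq_maxr _ _) mM).
have : \sum_(i < n) H (T i w) <= \sum_(i < 2 ^ m.+1) H (T i w).
  rewrite -!(big_mkord xpredT (fun i => H (T i w))) (big_cat_nat (leq0n n) (ltnW m2))//=.
  by rewrite lerDl sumr_ge0.
move=> h1 h2; apply: (le_trans h1); apply: (le_trans h2).
have c0 : 0 <= c by rewrite -lee_fin -Hc integral_ge0// => x _; rewrite lee_fin.
have : (2 ^ m)%:R <= n%:R :> R by rewrite ler_nat.
rewrite expnS natrM; move: ((2 ^ m)%:R) (n%:R) => x y xy.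
have ce : 0 <= 2 * c + e by rewrite addr_ge0 ?mulr_ge0// ltW.
have := ler_wpM2l ce xy; lra.
Qed.

(** The part of [G] cut at [b] falls under the bounded case. The remainder has mean [c - E b], which
    tends to 0 by monotone convergence, and [slln_tail] bounds its averages by about twice that
    mean. *)
Lemma slln (G : U -> R) (c : R) : measurable_fun setT G ->
  (forall x, 0 <= G x) -> (\int[P]_w (G (T 0%N w))%:E = c%:E)%E ->
  {ae P, forall w, forall e : R, 0 < e -> exists N, forall n, (N <= n)%N ->
    `|\sum_(i < n) G (T i w) - n%:R * c| <= e * n%:R}.
Proof.
move=> mG G0 Gc.
pose g (b : nat) x := Num.min (G x) b%:R.
pose h (b : nat) x := G x - g b x.
have mg b : measurable_fun setT (g b) by exact: measurable_minr.
have mh b : measurable_fun setT (h b) by exact: measurable_funB.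
have g0 b x : 0 <= g b x <= b%:R by rewrite le_min G0 ler0n/= ge_min lexx orbT.
have h0 b x : 0 <= h b x by rewrite subr_ge0 ge_min lexx.
have mT0 (f : U -> R) : measurable_fun setT f -> measurable_fun setT (fun w => (f (T 0%N w))%:E).
  by move=> mf; apply/measurable_EFinP; apply: measurableT_comp (mT _).
pose E b := \int[P]_w g b (T 0%N w).
have gE b : (\int[P]_w (g b (T 0%N w))%:E = (E b)%:E)%E.
  apply: (@bounded_prob_integralE _ _ _ P _ b%:R); last by [].
  by apply: measurableT_comp (mT _).
have hE b : (\int[P]_w (h b (T 0%N w))%:E = (c - E b)%:E)%E.
  have : (\int[P]_w (g b (T 0%N w))%:E + \int[P]_w (h b (T 0%N w))%:E = c%:E)%E.
    rewrite -ge0_integralD//; try exact: mT0.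
    - by rewrite -Gc; apply: eq_integral => w _; rewrite -EFinD /h addrC subrK.
    - by move=> w _; rewrite lee_fin; have /andP[] := g0 b (T 0%N w).
    - by move=> w _; rewrite lee_fin.
  rewrite gE; case: (\int[P]_w _)%E => [z| |]//= [] <-.
  by rewrite addrC addrK.
have hcv : E b @[b --> \oo] --> c.
  suff /fine_cvg : (E b)%:E @[b --> \oo] --> c%:E by [].
  rewrite -Gc; under eq_fun do rewrite -gE.
  have -> : (\int[P]_w (G (T 0%N w))%:E =
      \int[P]_w limn (fun b => (g b (T 0%N w))%:E))%E.
    apply: eq_integral => w _; apply/esym/cvg_lim => //.
    apply: cvg_EFin; first by near=> b.
    have [b0 hb0] := exists_nat_ge (G (T 0%N w)).
    apply/cvg_seqP => e e0; exists b0 => b bb0 /=.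
    rewrite /g min_l ?subrr ?normr0 ?(ltW e0)//.
    by apply: le_trans hb0 _; rewrite ler_nat.
  apply: cvg_monotone_convergence => //.
  - by move=> b; exact: mT0.
  - by move=> b w _; rewrite lee_fin; have /andP[] := g0 b (T 0%N w).
  - move=> w _ a b ab; rewrite lee_fin /g le_min ge_min lexx/=.
    by rewrite ge_min ler_nat ab orbT.
have A1 : {ae P, forall w, forall b : nat, forall e : R, 0 < e -> exists N, forall n, (N <= n)%N ->
    `|\sum_(i < n) g b (T i w) - n%:R * E b| <= e * n%:R}.
  by apply: ae_foralln => b; exact: (slln_bounded (mg b) (g0 b)).
have A2 : {ae P, forall w, forall b : nat, forall e : R, 0 < e -> exists N, forall n, (N <= n)%N ->
    \sum_(i < n) h b (T i w) <= (2 * (c - E b) + e) * n%:R}.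
  by apply: ae_foralln => b; exact: (slln_tail (mh b) (h0 b) (hE b)).
move: A1 A2; apply: filterS2 => w H1 H2 e e0.
have [b Hb] := (cvg_seqP _ _).1 hcv (e / 6) (divr_gt0 e0 (ltr0n _ 6)).
have {}Hb := Hb b (leqnn b).
have [N1 HN1] := H1 b (e / 4) (divr_gt0 e0 (ltr0n _ 4)).
have [N2 HN2] := H2 b (e / 12) (divr_gt0 e0 (ltr0n _ 12)).
exists (maxn N1 N2) => n; rewrite geq_max => /andP[n1 n2].
have {}HN1 := HN1 n n1; have {}HN2 := HN2 n n2.
have -> : \sum_(i < n) G (T i w) = \sum_(i < n) g b (T i w) + \sum_(i < n) h b (T i w).
  by rewrite -big_split; apply: eq_bigr => i _; rewrite /h/=; ring.
have : 0 <= \sum_(i < n) h b (T i w) by apply: sumr_ge0 => i _.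
move: HN1 HN2 Hb; move: (\sum_(i < n) g b (T i w)) (\sum_(i < n) h b (T i w)) (E b).
have : 0 <= n%:R :> R by [].
move: (n%:R) => y y0 u v x.
rewrite ler_norml => /andP[a1 a2] a3; rewrite ler_norml => /andP[a4 a5] v0.
rewrite ler_norml; apply/andP; split; nra.
Unshelve. all: by end_near.
Qed.

End strong_law.

(** * The law of the data *)

Section borel_rV.
Context {R : realType} {d : nat}.

Lemma measurable_box (c : 'rV[R]_d) (r : R) :
  measurable [set v : 'rV[R]_d | forall i, `|v ord0 i - c ord0 i| <= r].
Proof.
have -> : [set v : 'rV[R]_d | forall i, `|v ord0 i - c ord0 i| <= r] =
    \bigcap_(i in [set: 'I_d]) [set v : 'rV[R]_d | `|v ord0 i - c ord0 i| <= r].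
  by apply/seteqP; split=> [v h i _|v h i]; exact: h.
apply: fin_bigcap_measurable => // i _.
have mf : measurable_fun setT (fun v : 'rV[R]_d => `|v ord0 i - c ord0 i|).
  apply: measurableT_comp => //; apply: measurable_funB => //.
  exact: measurable_coord.
rewrite -[X in measurable X]setTI.
rewrite (_ : [set v | _] = (fun v : 'rV[R]_d => `|v ord0 i - c ord0 i|) @^-1` `]-oo, r]%classic).
  exact: mf.
by apply/seteqP; split=> v; rewrite /= in_itv.
Qed.

(** The sigma-algebra is generated by the coordinates; an open set is the countable union of the
    boxes with rational centre and radius [n.+1%:R^-1] that it contains. This gives the
    measurability of the continuous density [phi0]. *)
Lemma open_measurable_rV (U : set 'rV[R]_d) : open U -> measurable U.
Proof.
move=> oU.
pose B (z : 'rV[rat]_d * nat) :=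
  [set v : 'rV[R]_d | forall i, `|v ord0 i - map_mx ratr z.1 ord0 i| <= z.2.+1%:R^-1].
have -> : U = \bigcup_z (if `[< B z `<=` U >] then B z else set0).
  apply/seteqP; split=> [x Ux|x [z _]]; last by case: asboolP => // h /h.
  have /nbhs_ballP[e /= e0 he] : nbhs x U by apply: open_nbhs_nbhs.
  have [n hn] := exists_nat_ge (e / 4)^-1.
  have n0 : 0 < n.+1%:R^-1 :> R by [].
  have ne : n.+1%:R^-1 <= e / 4.
    rewrite -[leRHS]invrK lef_pV2 ?posrE ?invr_gt0 ?divr_gt0//.
    by apply: le_trans hn _; rewrite ler_nat.
  have hq i : exists q : rat, `|ratr q - x ord0 i| < n.+1%:R^-1.
    have [|q] := @rat_in_itvoo R (x ord0 i - n.+1%:R^-1) (x ord0 i + n.+1%:R^-1).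
      by move: (n.+1%:R^-1) n0 => y y0; lra.
    by rewrite in_itv/= => hq; exists q; rewrite ltr_distl.
  have [q qx] := choice hq.
  pose z : 'rV[rat]_d * nat := (\row_i q i, n).
  exists z => //=; rewrite asboolT.
    by move=> i; rewrite !mxE distrC; exact/ltW.
  move=> v hv; apply: he; split; first by [].
  move=> i j; rewrite /ball/= ord1; have := hv j; rewrite !mxE => h1.
  have := qx j; rewrite -!(distrC (ratr _)) in h1 *; move: (n.+1%:R^-1) ne n0 h1 => y ne n0 h1 h2.
  have -> : x ord0 j - v ord0 j = (x ord0 j - ratr (q j)) + (ratr (q j) - v ord0 j) by ring.
  by apply: le_lt_trans (ler_normD _ _) _; rewrite (distrC (x ord0 j)); lra.
apply: countable_bigcupT_measurable => [|z]; first exact: countableP.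
by case: ifP => // _; exact: measurable_box.
Qed.

Lemma continuous_measurable_rV (f : 'rV[R]_d -> R) : continuous f ->
  measurable_fun setT f.
Proof.
move=> cf; apply: (measurability _ (RGenOInfty.measurableE R)) => //.
move=> _ [_ [x ->] <-]; rewrite setTI; apply: open_measurable_rV.
by apply: open_comp => [v _|]; [exact: cf|exact: interval_open].
Qed.

End borel_rV.

Section density.
Context {d : measure_display} {T : measurableType d} {R : realType}
  (nu mu : {measure set T -> \bar R}) (D : set T) (f : T -> R).
Hypotheses (mD : measurable D) (mf : measurable_fun D f)
  (hf : has_density nu mu D f).

Let f0 x : D x -> (0 <= (f x)%:E)%E.
Proof. by move=> Dx; rewrite lee_fin; exact: hf.1. Qed.

Let mfE : measurable_fun D (fun x => (f x)%:E).
Proof. exact/measurable_EFinP. Qed.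

Let integral_density_indic E : measurable E ->
  (\int[nu]_x (\1_E x)%:E = \int[mu]_(x in D) ((\1_E x)%:E * (f x)%:E))%E.
Proof.
move=> mE; rewrite integral_indic// setIT hf.2// setIC integral_mkcondr.
apply: eq_integral => x _; rewrite patchE indicE; case: ifP => _; first by rewrite mul1e.
by rewrite mul0e.
Qed.

Import HBNNSimple.

Let integral_density_nnsfun (g : {nnsfun T >-> R}) :
  (\int[nu]_x (g x)%:E = \int[mu]_(x in D) ((g x)%:E * (f x)%:E))%E.
Proof.
under [LHS]eq_integral do rewrite fimfunE -fsumEFin//.
rewrite [LHS]ge0_integral_fsum//; last 2 first.
  - by move=> r; exact/measurable_EFinP/measurableT_comp.
  - by move=> n x _; rewrite EFinM nnfun_muleindic_ge0.
under [RHS]eq_integral.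
  move=> x; rewrite inE => xD; rewrite fimfunE -fsumEFin// ge0_mule_fsuml; last first.
    by move=> r; rewrite EFinM nnfun_muleindic_ge0.
  over.
rewrite [RHS]ge0_integral_fsum//; last 2 first.
  - move=> r; apply: emeasurable_funM => //; apply/measurable_EFinP.
    by apply: measurable_funM => //; exact: measurable_funTS.
  - by move=> n x Dx; rewrite mule_ge0 ?f0// EFinM nnfun_muleindic_ge0.
apply: eq_fsbigr => r _.
have [r0|r0] := ltP r 0.
  rewrite preimage_nnfun0// indic0; under eq_integral do rewrite mulr0.
  by under [RHS]eq_integral do rewrite mulr0 mul0e; rewrite !integral0.
have mE : measurable (g @^-1` [set r]) by exact: measurable_sfunP.
under eq_integral do rewrite EFinM; under [RHS]eq_integral do rewrite EFinM -muleA.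
have mI : measurable_fun setT (fun x => (\1_(g @^-1` [set r]) x)%:E : \bar R).
  by apply/measurable_EFinP; exact: measurable_indic.
rewrite !ge0_integralZl//; first by rewrite integral_density_indic.
- by apply: emeasurable_funM => //; exact: measurable_funTS.
- by move=> x Dx; rewrite mule_ge0 ?f0.
Qed.

Lemma ge0_integral_density (F : T -> \bar R) : measurable_fun setT F ->
  (forall x, 0 <= F x)%E ->
  (\int[nu]_x F x = \int[mu]_(x in D) (F x * (f x)%:E))%E.
Proof.
move=> mF F0.
pose g := nnsfun_approx measurableT mF.
have gle x m n : (m <= n)%N -> g m x <= g n x.
  by move=> mn; exact/lefP/nd_nnsfun_approx.
have gc x : (g n x)%:E @[n --> \oo] --> F x by exact: cvg_nnsfun_approx.
transitivity (lim (\int[nu]_x (g n x)%:E @[n --> \oo])%E).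
  rewrite -monotone_convergence//=.
  - by apply: eq_integral => x _; apply/esym/cvg_lim.
  - by move=> n; exact/measurable_EFinP/measurable_funTS.
  - by move=> n x _; rewrite lee_fin.
  - by move=> x _ m n mn; rewrite lee_fin; exact: gle.
transitivity (lim (\int[mu]_(x in D) ((g n x)%:E * (f x)%:E) @[n --> \oo])%E).
  by apply: congr_lim; apply/funext => n; exact: integral_density_nnsfun.
rewrite -monotone_convergence//=.
- apply: eq_integral => x /[!inE] Dx; apply/cvg_lim => //.
  by apply: cvgeZr => //; exact: gc.
- by move=> n; apply: emeasurable_funM => //; exact/measurable_EFinP/measurable_funTS.
- by move=> n x Dx; rewrite mule_ge0 ?f0// lee_fin.
- by move=> x Dx m n mn; rewrite lee_wpmul2r ?f0// lee_fin; exact: gle.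
Qed.

End density.

Lemma ge0_integral_preserving {d1 d2 : measure_display} {T1 : measurableType d1}
    {T2 : measurableType d2} {R : realType} (m1 : {measure set T1 -> \bar R})
    (m2 : {measure set T2 -> \bar R}) (h : T1 -> T2) (F : T2 -> \bar R) :
  measurable_fun setT h ->
  (forall A, measurable A -> m1 (h @^-1` A) = m2 A) ->
  measurable_fun setT F -> (forall x, 0 <= F x)%E ->
  (\int[m1]_x F (h x) = \int[m2]_x F x)%E.
Proof.
move=> mh hE mF F0.
pose m : {measure set T2 -> \bar R} :=
  measure_function_pushforward__canonical__measure_function_Measure m1 mh.
transitivity (\int[m]_x F x)%E.
  by have /= -> := ge0_integral_pushforward mh m1 measurableT mF (fun x _ => F0 x).
by apply: eq_measure_integral => A mA _; exact: hE.
Qed.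

Section translation.
Context {R : realType}.
Local Notation mu := (@lebesgue_measure R).

Lemma measurable_shift (a : R) :
  measurable_fun setT (fun x : measurableTypeR R => ((x : R) + a)%R : measurableTypeR R).
Proof. exact: measurable_funD. Qed.

Lemma ge0_integral_translation (a : R) (F : measurableTypeR R -> \bar R) :
  measurable_fun setT F -> (forall x, 0 <= F x)%E ->
  (\int[mu]_x F ((x : R) + a)%R = \int[mu]_x F x)%E.
Proof.
move=> mF F0.
apply: ge0_integral_preserving => // [|A mA]; first exact: measurable_shift.
apply/esym.
pose m : {measure set (measurableTypeR R) -> \bar R} :=
  measure_function_pushforward__canonical__measure_function_Measure mu (measurable_shift a).
apply: (@lebesgue_measure_unique _ m) => // X [[x y] xy <-].
rewrite /m/= /pushforward.
rewrite (_ : +%R^~ a @^-1` _ = `]x - a, y - a]%classic); last first.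
  by apply/seteqP; split=> z /=; rewrite !in_itv/= ltrBlDr lerBrDr.
rewrite !lebesgue_measure_itv/= !lte_fin ltrD2r; case: ifP => // _.
by rewrite -!EFinB; congr EFin; ring.
Qed.

Lemma ge0_integral_lebesgue_rVS n (F : 'rV[R]_n.+1 -> \bar R) :
  measurable_fun setT F -> (forall x, 0 <= F x)%E ->
  (\int[lebesgue_rV n.+1]_v F v =
   \int[mu]_x \int[lebesgue_rV n]_v F (cons_rV (x, v)))%E.
Proof.
move=> mF F0.
transitivity (\int[(mu \x lebesgue_rV n)%E]_z F (cons_rV z))%E.
  apply/esym/ge0_integral_preserving => //; exact: measurable_cons_rV.
rewrite fubini_tonelli1//.
exact: measurableT_comp mF (@measurable_cons_rV R n).
Qed.

(** This change of variables turns the density of the noise into that of the response. Induction on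
    the dimension, one coordinate being split off by Tonelli. *)
Lemma ge0_integral_rV_translation n (a : 'rV[R]_n) (F : 'rV[R]_n -> \bar R) :
  measurable_fun setT F -> (forall x, 0 <= F x)%E ->
  (\int[lebesgue_rV n]_v F ((v : 'rV[R]_n) + a)%R = \int[lebesgue_rV n]_v F v)%E.
Proof.
elim: n a F => [|n IH] a F mF F0.
  by apply: eq_integral => v _; congr F; apply/rowP; case.
have mFa : measurable_fun setT (fun v : 'rV[R]_n.+1 => F (v + a)%R).
  apply: measurableT_comp => //; apply: measurable_fun_rV => i.
  under eq_fun do rewrite mxE; apply: measurable_funD => //.
  exact: measurable_coord.
rewrite (ge0_integral_lebesgue_rVS mFa (fun=> F0 _)) (ge0_integral_lebesgue_rVS mF F0).
have mFc x : measurable_fun setT (fun v => F (cons_rV (x, v))).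
  apply: (measurableT_comp mF); apply: (measurableT_comp (@measurable_cons_rV R n)).
  exact: measurable_pair1.
pose G x := (\int[lebesgue_rV n]_v F (cons_rV (x, v)))%E.
transitivity (\int[mu]_x G ((x : R) + a ord0 ord0)%R)%E.
  apply: eq_integral => x _; rewrite /G.
  rewrite -(IH (\row_i a ord0 (lift ord0 i)) (fun v => F (cons_rV (((x : R) + a ord0 ord0)%R : measurableTypeR R, v))))//.
  apply: eq_integral => v _; congr F; apply/rowP => i.
  have [j ->|->] := unliftP ord0 i; rewrite mxE ?cons_rVES ?cons_rVE0// ?mxE//.
apply: ge0_integral_translation => [|x]; last exact: integral_ge0.
apply: (@measurable_fun_fubini_tonelli_F _ _ _ _ _ (lebesgue_rV n) (fun z => F (cons_rV z))) => //.
exact: measurableT_comp mF (@measurable_cons_rV R n).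
Qed.

End translation.

(** * Costs of samples and the law of a datum *)

Section measurable_costs.
Context {R : realType} {k d : nat}.
Local Notation traj := ('I_k.+1 -> R -> 'rV[R]_d).

Lemma measurable_bigmin {d' : measure_display} {T : measurableType d'} n
    (g : T -> R) (f : 'I_n -> T -> R) : measurable_fun setT g ->
  (forall j, measurable_fun setT (f j)) ->
  measurable_fun setT (fun x => \big[Num.min/g x]_(j < n) f j x).
Proof.
move=> mg mf; elim: (index_enum _) => [|j s IH].
  by under eq_fun do rewrite big_nil.
under eq_fun do rewrite big_cons.
exact: measurable_minr.
Qed.

Lemma measurable_fun_enorm {d' : measure_display} {T : measurableType d'}
    (f : T -> 'rV[R]_d) : (forall i, measurable_fun setT (fun x => f x ord0 i)) ->
  measurable_fun setT (fun x => enorm (f x) ^+ 2).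
Proof.
move=> mf; under eq_fun do rewrite enorm_sqr.
by apply: measurable_sum => i; exact: measurable_funX.
Qed.

Lemma measurable_fun_label {d' : measure_display} {T : measurableType d'}
    (f : 'I_k.+1 -> T -> R) : (forall j, measurable_fun setT (f j)) ->
  measurable_fun setT (fun z : 'I_k.+1 * T => f z.1 z.2).
Proof.
move=> mf.
have -> : (fun z : 'I_k.+1 * T => f z.1 z.2) =
    fun z => \sum_l \1_[set l] z.1 * f l z.2.
  apply/funext => z; rewrite (bigD1 z.1)//= indicE mem_set//= mul1r big1 ?addr0// => l lz.
  by rewrite indicE memNset ?mul0r//= => zl; rewrite zl eqxx in lz.
apply: measurable_sum => l; apply: measurable_funM; last first.
  exact: measurableT_comp (mf l) measurable_snd.
by apply: measurableT_comp measurable_fst; exact: measurable_indic.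
Qed.

Lemma min_cost_ge0 (u : traj) t y : 0 <= min_cost u t y.
Proof.
rewrite /min_cost; elim/big_ind: _ => [|x z x0 z0|j _]; rewrite ?sqr_ge0//.
by rewrite le_min x0.
Qed.

Lemma min_cost_le (u : traj) t y j : min_cost u t y <= enorm (y - u j t) ^+ 2.
Proof. exact: bigmin_le. Qed.

Lemma min_costP (u : traj) t y : exists j, min_cost u t y = enorm (y - u j t) ^+ 2.
Proof.
rewrite /min_cost; elim/big_ind: _ => [|x z [i ->] [j ->]|j _].
- by exists ord0.
- by rewrite /Num.min; case: ifP => _; [exists i|exists j].
- by exists j.
Qed.

Lemma enorm_sqrD_le (a b : 'rV[R]_d) (e : R) : 0 < e ->
  enorm (a + b) ^+ 2 <= (1 + e) * enorm a ^+ 2 + (1 + e^-1) * enorm b ^+ 2.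
Proof.
move=> e0; have ab := enormD a b.
apply: (@le_trans _ _ ((enorm a + enorm b) ^+ 2)).
  by rewrite ler_sqr ?nnegrE ?addr_ge0 ?enorm_ge0.
move: (enorm a) (enorm b) => x y.
have : 0 <= e^-1 * (e * x - y) ^+ 2 by rewrite mulr_ge0 ?sqr_ge0 ?invr_ge0 ?ltW.
have -> : e^-1 * (e * x - y) ^+ 2 = e * x ^+ 2 - 2 * x * y + e^-1 * y ^+ 2.
  by field; exact: lt0r_neq0.
by move: (e^-1) => z; lra.
Qed.

(** A perturbation of the trajectories by [r] changes a quadratic cost by an amount that grows with
    the sample. The factor [1 + e] absorbs it, at the price of an additive term that is the same for
    all samples. *)
Lemma min_cost_near (u v : traj) t y (r e : R) : 0 < e ->
  (forall j, enorm (u j t - v j t) <= r) ->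
  min_cost u t y <= (1 + e) * min_cost v t y + (1 + e^-1) * r ^+ 2.
Proof.
move=> e0 uv; have [j ->] := min_costP v t y.
apply: le_trans (min_cost_le u t y j) _.
have -> : y - u j t = (y - v j t) + (v j t - u j t).
  by rewrite addrA subrK.
apply: le_trans (enorm_sqrD_le _ _ e0) _; rewrite lerD2l ler_wpM2l//.
  by rewrite addr_ge0 ?invr_ge0 ?ltW.
by rewrite enormB ler_sqr ?nnegrE ?enorm_ge0//; apply: le_trans (uv j); exact: enorm_ge0.
Qed.

End measurable_costs.

Section data.
Context {R : realType} {k d : nat} {dO : measure_display}
  {Omega : measurableType dO} (P : probability Omega R).
Variables (mudag : 'I_k.+1 -> R -> 'rV[R]_d) (p : 'I_k.+1 -> R)
  (phi0 : 'rV[R]_d -> R) (phiT : R -> R)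
  (phi : nat -> {RV P >-> 'I_k.+1}) (eps : nat -> {RV P >-> 'rV[R]_d})
  (t : nat -> {RV P >-> R}) (y : nat -> Omega -> 'rV[R]_d).
Hypothesis A1 : assumption1 mudag p phi0 phiT phi eps t y.
Local Notation mu := (@lebesgue_measure R).
Local Notation U := ('I_k.+1 * 'rV[R]_d * R)%type.

Definition datum (i : nat) (w : Omega) : U := (phi i w, eps i w, t i w).

Let mphi i : measurable_fun setT (phi i) := measurable_funPT (phi i).
Let meps i : measurable_fun setT (eps i) := measurable_funPT (eps i).
Let mt i : measurable_fun setT (t i) := measurable_funPT (t i).

Lemma measurable_datum i : measurable_fun setT (datum i).
Proof. by apply: measurable_fun_pair => //; exact: measurable_fun_pair. Qed.

Lemma datum_indep i j : i != j -> forall A B, measurable A -> measurable B ->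
  P (datum i @^-1` A `&` datum j @^-1` B) =
    (P (datum i @^-1` A) * P (datum j @^-1` B))%E.
Proof.
move=> ij A B mA mB.
pose E l := if l == i then datum i @^-1` A else datum j @^-1` B.
have := triples_independent A1 (J := [fset i; j]%fset) (E := E).
rewrite big_fsetU1 ?inE//= big_seq_fset1 /E eqxx eq_sym (negbTE ij) => <-.
- congr (P _); apply/seteqP; split=> [w [Aw Bw] l /=|w h].
    by rewrite !inE => /orP[/eqP ->|/eqP ->]; rewrite ?eqxx// eq_sym (negbTE ij).
  split; first by have /= := h i; rewrite !inE eqxx => /(_ isT).
  by have /= := h j; rewrite !inE eqxx orbT eq_sym (negbTE ij) => /(_ isT).
- move=> l; rewrite !inE => /orP[/eqP ->|/eqP ->].
    by rewrite eqxx; exists A => //; rewrite setTI.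
  by rewrite eq_sym (negbTE ij); exists B => //; rewrite setTI.
Qed.

Lemma components_indep A B C : measurable A -> measurable B -> measurable C ->
  P (phi 0%N @^-1` A `&` eps 0%N @^-1` B `&` t 0%N @^-1` C) =
    (P (phi 0%N @^-1` A) * P (eps 0%N @^-1` B) * P (t 0%N @^-1` C))%E.
Proof.
move=> mA mB mC.
pose o0 : 'I_3 := @Ordinal 3 0 isT.
pose o1 : 'I_3 := @Ordinal 3 1 isT.
pose o2 : 'I_3 := @Ordinal 3 2 isT.
pose E (l : 'I_3) := tnth [tuple phi 0%N @^-1` A; eps 0%N @^-1` B; t 0%N @^-1` C] l.
have := components_independent A1 (i := 0%N) (J := (o0 |` (o1 |` [fset o2]))%fset) (E := E).
rewrite !big_fsetU1 ?inE//= big_seq_fset1 /E !(tnth_nth set0)/= muleA => <-.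
- congr (P _); apply/seteqP; split=> [w [[Aw Bw] Cw] l /=|w h].
    by rewrite !inE => /or3P[/eqP ->|/eqP ->|/eqP ->]; rewrite (tnth_nth set0).
  have /= h0 := h o0; have /= h1 := h o1; have /= h2 := h o2.
  move: h0 h1 h2; rewrite !inE !(tnth_nth set0)/= => h0 h1 h2.
  by split; [split; [exact: h0|exact: h1]|exact: h2].
- move=> l; rewrite !inE => /or3P[/eqP ->|/eqP ->|/eqP ->]; rewrite !(tnth_nth set0)/=.
  + by exists A => //; rewrite setTI.
  + by exists B => //; rewrite setTI.
  + by exists C => //; rewrite setTI.
Qed.

Lemma measurable_phi0 : measurable_fun setT phi0.
Proof. exact: continuous_measurable_rV (phi0_continuous A1). Qed.

Lemma measurable_phiT : measurable_fun (I01 : set (measurableTypeR R)) phiT.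
Proof. by apply: subspace_continuous_measurable_fun; [exact: measurable_I01|exact: phiT_continuous A1]. Qed.

Lemma phi0_ge0 v : 0 <= phi0 v.
Proof. exact: (noise_law A1 0%N).1. Qed.

Lemma phiT_ge0 s : I01 s -> 0 <= phiT s.
Proof. exact: (time_law A1 0%N).1. Qed.

Lemma integral_noise (F : 'rV[R]_d -> \bar R) : measurable_fun setT F ->
  (forall v, 0 <= F v)%E ->
  (\int[P]_w F (eps 0%N w) = \int[lebesgue_rV d]_v (F v * (phi0 v)%:E))%E.
Proof.
move=> mF F0.
have /= <- := @ge0_integral_distribution _ _ _ _ _ P (eps 0%N) F mF F0.
by rewrite (ge0_integral_density measurableT measurable_phi0 (noise_law A1 0%N)).
Qed.

(* The density hypothesis is stated on [R], the integral of the goal on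
   [measurableTypeR R]: the same sigma-algebra in two different instances. *)
Lemma time_densityE i (A : set (measurableTypeR R)) : measurable A ->
  distribution P (t i) A = (\int[mu]_(s in A `&` I01) (phiT s)%:E)%E.
Proof.
move=> mA; rewrite (time_law A1 i).2//.
have mid : @measurable_fun _ _ (measurableTypeR R) R setT id.
  by move=> _ B mB; rewrite setTI.
have mD : measurable (A `&` I01 : set (measurableTypeR R)).
  by apply: measurableI => //; exact: measurable_I01.
have mf : measurable_fun (A `&` I01 : set (measurableTypeR R)) phiT.
  by apply: measurable_funS measurable_phiT => //; exact: measurable_I01.
have mf' : @measurable_fun _ _ R (\bar R) (A `&` I01) (fun s => (phiT s)%:E).
  exact/measurable_EFinP.
have f0 : {in A `&` I01, forall s, (0 <= (phiT s)%:E)%E}.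
  by move=> s /[!inE] -[_ ?]; rewrite lee_fin phiT_ge0.
exact: (@ge0_integral_pushforward _ _ _ _ _ _ mid mu (A `&` I01) (fun s => (phiT s)%:E) mD mf' f0).
Qed.

Lemma integral_time (F : R -> \bar R) : measurable_fun setT F ->
  (forall v, 0 <= F v)%E ->
  (\int[P]_w F (t 0%N w) = \int[mu]_(s in I01) (F s * (phiT s)%:E))%E.
Proof.
move=> mF F0.
have mt0 : @measurable_fun _ _ Omega (measurableTypeR R) setT (t 0%N) by exact: mt.
pose nu : {measure set (measurableTypeR R) -> \bar R} :=
  measure_function_pushforward__canonical__measure_function_Measure P mt0.
have mF' : measurable_fun setT (F : measurableTypeR R -> \bar R) by exact: mF.
have D : has_density nu mu I01 phiT by split; [exact: (time_law A1 0%N).1|move=> A mA; rewrite -(time_densityE 0%N mA)].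
rewrite -(ge0_integral_density measurable_I01 measurable_phiT D mF' F0).
exact: (ge0_integral_preserving (m2 := nu) mt0).
Qed.

Lemma integral_label (F : 'I_k.+1 -> \bar R) : (forall j, 0 <= F j)%E ->
  (\int[P]_w F (phi 0%N w) = \sum_j (p j)%:E * F j)%E.
Proof.
move=> F0.
have E w : F (phi 0%N w) = (\sum_j F j * (\1_[set w | phi 0%N w = j] w)%:E)%E.
  rewrite (bigD1 (phi 0%N w))//= indicE mem_set//= mule1 big1 ?adde0// => l lz.
  by rewrite indicE memNset ?mule0//= => zl; rewrite zl eqxx in lz.
under eq_integral do rewrite E.
have mS j : measurable [set w | phi 0%N w = j].
  by rewrite -[X in measurable X]setTI; exact: (mphi 0%N measurableT (Y := [set j])).
rewrite ge0_integral_sum//.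
- apply: eq_bigr => j _; rewrite ge0_integralZl//.
  + rewrite integral_indic// setIT muleC; congr (_ * _)%E; exact: (label_law A1).
  + by apply/measurable_EFinP; exact: measurable_indic.
- by move=> j; apply: measurable_funeM; apply/measurable_EFinP; exact: measurable_indic.
- by move=> j w _; rewrite mule_ge0.
Qed.

(** The time is the outermost variable, as in [f_infty]: [indep_pair] separates it from the pair of
    label and noise, which are then separated from each other. *)
Lemma integral_datum (F : U -> \bar R) : measurable_fun setT F ->
  (forall v, 0 <= F v)%E ->
  (\int[P]_w F (datum 0%N w) = \int[mu]_(s in I01)
     ((\sum_j (p j)%:E * \int[lebesgue_rV d]_v (F (j, v, s) * (phi0 v)%:E)) *
      (phiT s)%:E))%E.
Proof.
move=> mF F0.
pose X w := (phi 0%N w, eps 0%N w).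
have mX : measurable_fun setT X by exact: measurable_fun_pair.
have := indep_pair (mphi 0%N) (meps 0%N) (mt 0%N) components_indep => indX.
have mFs : measurable_fun setT (fun z : R * ('I_k.+1 * 'rV[R]_d) => F (z.2, z.1)).
  by apply: (measurableT_comp mF); exact: measurable_fun_pair.
have := @ge0_integral_indep _ _ _ _ _ _ _ P (t 0%N) X (mt 0%N) mX
  (fun z => F (z.2, z.1)) _ mFs (fun z => F0 _).
move=> /(_ _)/= ->; last first.
  by move=> A B mA mB; rewrite setIC indX// muleC.
pose H s := (\int[P]_w F (X w, s))%E.
have HE s : H s = (\sum_j (p j)%:E * \int[lebesgue_rV d]_v (F (j, v, s) * (phi0 v)%:E))%E.
  have mFj j : measurable_fun setT (fun v => F (j, v, s)).
    by apply: (measurableT_comp mF); apply: measurable_fun_pair => //; exact: measurable_fun_pair.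
  have mFz : measurable_fun setT (fun z => F (z, s)).
    by apply: (measurableT_comp mF); exact: measurable_fun_pair.
  have := @ge0_integral_indep _ _ _ _ _ _ _ P (phi 0%N) (eps 0%N) (mphi 0%N) (meps 0%N)
    (fun z => F (z, s)) _ mFz (fun z => F0 _).
  rewrite /H /X => /(_ _)/= ->; last first.
    move=> A B mA mB; have := components_indep mA mB (@measurableT _ R).
    by rewrite preimage_setT setIT probability_setT mule1.
  rewrite (integral_label (F := fun j => (\int[P]_w F (j, eps 0%N w, s))%E))//; last first.
    by move=> j; exact: integral_ge0.
  apply: eq_bigr => j _; congr (_ * _)%E.
  exact: (integral_noise (F := fun v => F (j, v, s))).
rewrite -[LHS]/(\int[P]_w H (t 0%N w))%E integral_time.
- by apply: eq_integral => s _; rewrite HE.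
- have mG : measurable_fun setT (fun z : Omega * R => F (X z.1, z.2)).
    apply: (measurableT_comp mF); apply: measurable_fun_pair => //.
    exact: measurableT_comp mX measurable_fst.
  exact: (@measurable_fun_fubini_tonelli_G _ _ _ _ _ P (fun z : Omega * R => F (X z.1, z.2))).
- by move=> s; exact: integral_ge0.
Qed.

End data.

Section extension.
Context {R : realType} {d : nat}.

(** Extension by zero: trajectories are arbitrary off [[0, 1]], whereas the strong law is stated for
    functions measurable on the whole space of data. Sampled times never leave [[0, 1]]. *)
Definition ext01 (f : R -> 'rV[R]_d) (s : R) : 'rV[R]_d :=
  \row_l ((fun x => f x ord0 l) \_ I01) s.

Lemma ext01E f s : I01 s -> ext01 f s = f s.
Proof. by move=> s01; apply/rowP => l; rewrite mxE patchE mem_set. Qed.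

Lemma measurable_ext01 f l : measurable_fun (I01 : set R) f ->
  measurable_fun setT (fun s => ext01 f s ord0 l).
Proof.
move=> mf; under eq_fun do rewrite mxE.
have mI : measurable (I01 : set R) by exact: measurable_I01.
apply: (measurable_restrictT (fun x => f x ord0 l) mI).1.
exact: (measurableT_comp (measurable_coord l) mf).
Qed.

End extension.

Section data_law.
Context {R : realType} {k d : nat} {dO : measure_display}
  {Omega : measurableType dO} (P : probability Omega R).
Variables (mudag : 'I_k.+1 -> R -> 'rV[R]_d) (p : 'I_k.+1 -> R)
  (phi0 : 'rV[R]_d -> R) (phiT : R -> R)
  (phi : nat -> {RV P >-> 'I_k.+1}) (eps : nat -> {RV P >-> 'rV[R]_d})
  (t : nat -> {RV P >-> R}) (y : nat -> Omega -> 'rV[R]_d).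
Hypothesis A1 : assumption1 mudag p phi0 phiT phi eps t y.
Hypothesis A2 : assumption2 phi0.
Local Notation mu := (@lebesgue_measure R).
Local Notation U := ('I_k.+1 * 'rV[R]_d * R)%type.
Local Notation traj := ('I_k.+1 -> R -> 'rV[R]_d).
Local Notation datum := (datum phi eps t).

Definition admissible (u : traj) :=
  (forall j, measurable_fun (I01 : set R) (u j)) /\
  exists C : R, forall j s, I01 s -> enorm (u j s) <= C.

Definition expected_cost (u : traj) : R := \int[P]_w min_cost u (t 0%N w) (y 0%N w).

Definition response (z : U) : 'rV[R]_d := ext01 (mudag z.1.1) z.2 + z.1.2.

(** The cost as a function of label, noise and time, since it is these triples that are independent
    and identically distributed. *)
Definition sample_cost (u : traj) (z : U) : R :=
  min_cost (fun j => ext01 (u j)) z.2 (response z).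

Lemma min_cost_ext01 (u : traj) s v : I01 s ->
  min_cost (fun j => ext01 (u j)) s v = min_cost u s v.
Proof.
by move=> s01; rewrite /min_cost ext01E//; apply: eq_bigr => j _; rewrite ext01E.
Qed.

Lemma sample_costE u i w : sample_cost u (datum i w) = min_cost u (t i w) (y i w).
Proof.
have t01 := time_in01 A1 i w.
by rewrite /sample_cost /response /= min_cost_ext01// ext01E// (data_model A1).
Qed.

Lemma sample_cost_ge0 u z : 0 <= sample_cost u z.
Proof. exact: min_cost_ge0. Qed.

Lemma measurable_sample_cost u : (forall j, measurable_fun (I01 : set R) (u j)) ->
  measurable_fun setT (sample_cost u).
Proof.
move=> mu'; have H j : measurable_fun setT (fun z : U => enorm (response z - ext01 (u j) z.2) ^+ 2).
  apply: measurable_fun_enorm => i.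
  rewrite (_ : (fun z => _) = fun z : U =>
      ext01 (mudag z.1.1) z.2 ord0 i + z.1.2 ord0 i - ext01 (u j) z.2 ord0 i); last first.
    apply/funext => z; rewrite /response.
    by move: (ext01 _ _) (ext01 _ _) => a b; rewrite !mxE.
  apply: measurable_funB; last first.
    exact: (measurableT_comp (measurable_ext01 i (mu' j)) measurable_snd).
  apply: measurable_funD; last first.
    apply: (measurableT_comp (measurable_coord i)).
    exact: measurableT_comp measurable_snd measurable_fst.
  apply: (measurableT_comp (measurable_fun_label (fun j => measurable_ext01 i (mudag_bounded A1 j).1))
    (_ : measurable_fun setT (fun z : U => (z.1.1, z.2)))).
  apply: measurable_fun_pair => //.
  exact: measurableT_comp measurable_fst measurable_fst.
exact: measurable_bigmin.
Qed.

Lemma mudag_ae_bound : exists M : R, 0 <= M /\ {ae mu, forall s, I01 s ->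
  forall j, enorm (mudag j s) <= M}.
Proof.
have /choice[M HM] : forall j, exists M : R, {ae mu, forall s, I01 s -> enorm (mudag j s) <= M}.
  by move=> j; exact: (mudag_bounded A1 j).2.
exists (\sum_j `|M j|); split; first by apply: sumr_ge0.
have FF := ae_filter_ringOfSetsType mu.
have : {ae mu, forall s, forall j : nat, I01 s -> enorm (mudag (inord j) s) <= M (inord j)}.
  by apply: ae_foralln => j; exact: HM.
apply: filterS => s H s01 j.
have := H j s01; rewrite inord_val => h; apply: (le_trans h).
rewrite (bigD1 j)//=; apply: le_trans (ler_norm _) _.
by rewrite lerDl sumr_ge0.
Qed.

(** The true trajectories are bounded off a null set of times only; the times have a density, so
    almost surely none of them falls into it. *)
Lemma mudag_sample_bound (M : R) :
  {ae mu, forall s, I01 s -> forall j, enorm (mudag j s) <= M} ->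
  {ae P, forall w, forall i j, enorm (mudag j (t i w)) <= M}.
Proof.
move=> [N [mN N0 hN]]; apply: ae_foralln => i.
exists (t i @^-1` (N : set R)); split.
- by rewrite -[X in measurable X]setTI; exact: (measurable_funPT (t i)).
- have := time_densityE A1 i mN; rewrite /distribution/= /pushforward => ->.
  apply: null_set_integral.
  + by apply: measurableI => //; exact: measurable_I01.
  + apply/measurable_EFinP; apply: measurable_funS (measurable_phiT A1) => //; exact: measurable_I01.
  + by apply: subset_measure0 N0 => //; apply: measurableI => //; exact: measurable_I01.
- move=> w h; apply: hN => h'; apply: h => j; apply: h'; exact: (time_in01 A1).
Qed.

Let mdatum := measurable_datum phi eps t.

Lemma measurable_noise_sqr : measurable_fun setT (fun v : 'rV[R]_d => enorm v ^+ 2).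
Proof. by apply: measurable_fun_enorm => l; exact: measurable_coord. Qed.

Lemma noise_sqr_finite : (\int[P]_w (enorm (eps 0%N w) ^+ 2)%:E < +oo)%E.
Proof.
rewrite (integral_noise A1 (F := fun v => (enorm v ^+ 2)%:E)).
- by under eq_integral do rewrite -EFinM; exact: A2.2.
- by apply/measurable_EFinP; exact: measurable_noise_sqr.
- by move=> v; rewrite lee_fin sqr_ge0.
Qed.

(** The second moment of the noise enters here: the trajectory [ord0] alone bounds the cost by twice
    the squared noise plus a constant. *)
Lemma sample_cost_finite u : admissible u ->
  (\int[P]_w (sample_cost u (datum 0%N w))%:E < +oo)%E.
Proof.
move=> [mu' [C HC]]; have [M [M0 HM]] := mudag_ae_bound.
have HM' := mudag_sample_bound HM.
pose B : R := 2 * (M + C) ^+ 2.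
apply: (@le_lt_trans _ _ (\int[P]_w (2 * enorm (eps 0%N w) ^+ 2 + B)%:E)%E).
  apply: ae_ge0_le_integral => //.
  - by move=> w _; rewrite lee_fin sample_cost_ge0.
  - apply/measurable_EFinP; apply: measurableT_comp (mdatum 0%N).
    exact: measurable_sample_cost.
  - by move=> w _; rewrite lee_fin; apply: addr_ge0; apply: mulr_ge0 => //; exact: sqr_ge0.
  - apply/measurable_EFinP; apply: measurable_funD => //; apply: measurable_funM => //.
    exact: (measurableT_comp measurable_noise_sqr (measurable_funPT (eps 0%N))).
  - move: HM'; apply: filterS => w Hw _; rewrite lee_fin sample_costE.
    apply: le_trans (min_cost_le u _ _ ord0) _.
    rewrite (data_model A1) addrAC addrC.
    apply: le_trans (enorm_sqrD_le _ _ (ltr01 : 0 < 1 :> R)) _.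
    rewrite invr1 -[1 + 1]/(2%:R : R) lerD2l /B ler_wpM2l// ler_sqr ?nnegrE ?enorm_ge0//.
      apply: le_trans (enormD _ _) _; rewrite enormN lerD ?Hw//; apply: HC; exact: (time_in01 A1).
    rewrite addr_ge0//; apply: le_trans (HC ord0 _ (time_in01 A1 0%N w)); exact: enorm_ge0.
under eq_integral do rewrite EFinD EFinM.
have mE : measurable_fun setT (fun w => (enorm (eps 0%N w) ^+ 2)%:E).
  apply/measurable_EFinP.
  exact: (measurableT_comp measurable_noise_sqr (measurable_funPT (eps 0%N))).
rewrite ge0_integralD//; last 3 first.
- by move=> w _; rewrite -EFinM lee_fin mulr_ge0 ?sqr_ge0.
- exact: measurable_funeM.
- by move=> w _; rewrite lee_fin; apply: mulr_ge0 => //; exact: sqr_ge0.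
rewrite ge0_integralZl//; last by move=> w _; rewrite lee_fin sqr_ge0.
rewrite lte_add_pinfty//; first by rewrite lte_mul_pinfty// noise_sqr_finite.
by rewrite integral_cst// [X in (_ * X)%E]probability_setT mule1 ltry.
Qed.

Lemma expected_costE u : admissible u ->
  (\int[P]_w (sample_cost u (datum 0%N w))%:E = (expected_cost u)%:E)%E.
Proof.
move=> au; rewrite /expected_cost /Rintegral.
under [in RHS]eq_integral do rewrite -sample_costE.
rewrite fineK// ge0_fin_numE ?sample_cost_finite//.
by apply: integral_ge0 => w _; rewrite lee_fin sample_cost_ge0.
Qed.

(** Given time and label, translating the noise by [mudag j x] produces the density of the response;
    summing over labels with weights [p j] produces [phiY]. *)
Lemma f_inftyE s lambda u : admissible u ->
  f_infty s lambda p mudag phi0 phiT u = (expected_cost u + penalty s lambda u)%:E.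
Proof.
move=> au; rewrite EFinD; congr (_ + _)%E; rewrite -expected_costE//.
have mS := measurable_sample_cost au.1.
rewrite (integral_datum A1 (F := fun z => (sample_cost u z)%:E)); last 2 first.
- exact/measurable_EFinP.
- by move=> z; rewrite lee_fin sample_cost_ge0.
apply: eq_integral => x /[!inE] x01.
have mc : measurable_fun setT (fun v : 'rV[R]_d => min_cost u x v).
  apply: measurable_bigmin => [|j]; apply: measurable_fun_enorm => l;
    by under eq_fun do rewrite !mxE; apply: measurable_funB => //; exact: measurable_coord.
have mp0 := measurable_phi0 A1.
have mp0' j : measurable_fun setT (fun v : 'rV[R]_d => phi0 (v - mudag j x)).
  apply: (measurableT_comp mp0); apply: measurable_fun_rV => l.
  by under eq_fun do rewrite !mxE; apply: measurable_funB => //; exact: measurable_coord.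
have cost_ge0 v : 0 <= min_cost u x v by exact: min_cost_ge0.
have p0 v : 0 <= phi0 v by exact: (phi0_ge0 A1).
have E j : (\int[lebesgue_rV d]_v ((sample_cost u (j, v, x))%:E * (phi0 v)%:E) =
    \int[lebesgue_rV d]_v (min_cost u x v * phi0 (v - mudag j x))%:E)%E.
  rewrite -(ge0_integral_rV_translation (mudag j x) (F := fun v => (min_cost u x v * phi0 (v - mudag j x))%:E)).
  - apply: eq_integral => v _; rewrite -EFinM /sample_cost /response/= min_cost_ext01// ext01E//.
    by rewrite addrK (addrC v).
  - by apply/measurable_EFinP; exact: measurable_funM.
  - by move=> v; rewrite lee_fin mulr_ge0.
under [in RHS]eq_bigr do rewrite E.
under eq_integral do rewrite mulrC mulrA.
transitivity ((phiT x)%:E * \int[lebesgue_rV d]_v (\sum_j (p j)%:E * (min_cost u x v * phi0 (v - mudag j x))%:E))%E.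
  rewrite -ge0_integralZl//; last 3 first.
  - apply: emeasurable_sum => j; apply: measurable_funeM; apply/measurable_EFinP; exact: measurable_funM.
  - by move=> v _; apply: sume_ge0 => j _; rewrite -EFinM lee_fin !mulr_ge0// (p_ge0 A1).
  - by rewrite lee_fin (phiT_ge0 A1).
  apply: eq_integral => v _; under [in RHS]eq_bigr do rewrite -EFinM.
  rewrite sumEFin -EFinM; congr EFin; rewrite /phiY -mulrA; congr (_ * _).
  by rewrite mulr_sumr; apply: eq_bigr => j _; ring.
rewrite muleC; congr (_ * _)%E; rewrite ge0_integral_sum//.
- apply: eq_bigr => j _; rewrite ge0_integralZl//.
  + by apply/measurable_EFinP; exact: measurable_funM.
  + by move=> v _; rewrite lee_fin mulr_ge0.
  + by rewrite lee_fin (p_ge0 A1).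
- move=> j; apply: measurable_funeM; apply/measurable_EFinP; exact: measurable_funM.
- by move=> j v _; rewrite -EFinM lee_fin !mulr_ge0// (p_ge0 A1).
Qed.

End data_law.

(** * Almost sure regularity of the data *)

Section averages.
Context {R : realType}.
Implicit Types (f g : nat -> R).

Definition average f (n : nat) : R := n%:R^-1 * \sum_(i < n) f i.

Lemma average_le f g n : (forall i, (i < n)%N -> f i <= g i) ->
  average f n <= average g n.
Proof.
by move=> fg; rewrite ler_wpM2l ?invr_ge0//; apply: ler_sum => i _; exact: fg.
Qed.

Lemma average_ge0 f n : (forall i, 0 <= f i) -> 0 <= average f n.
Proof. by move=> f0; rewrite mulr_ge0 ?invr_ge0// sumr_ge0. Qed.

Lemma averageD f g n : average (fun i => f i + g i) n = average f n + average g n.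
Proof. by rewrite /average big_split mulrDr. Qed.

Lemma averageZ (a : R) f n : average (fun i => a * f i) n = a * average f n.
Proof. by rewrite /average -mulr_sumr mulrCA. Qed.

Lemma average_cst (a : R) n : (0 < n)%N -> average (fun=> a) n = a.
Proof.
move=> n0; rewrite /average sumr_const card_ord -(mulr_natl a) mulKf//.
by rewrite pnatr_eq0 -lt0n.
Qed.

Lemma average_dist f (a e : R) n : (0 < n)%N ->
  `|\sum_(i < n) f i - n%:R * a| <= e * n%:R -> `|average f n - a| <= e.
Proof.
move=> n0 h; have n0' : 0 < n%:R :> R by rewrite ltr0n.
have -> : average f n - a = n%:R^-1 * (\sum_(i < n) f i - n%:R * a).
  by rewrite mulrBr mulKf ?gt_eqF.
by rewrite normrM [X in X * _]ger0_norm ?invr_ge0 ?(ltW n0')// ler_pdivrMl// (mulrC _ e).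
Qed.

Lemma squeeze_limit (h c F W A B : R) : 0 < h -> h <= 1 -> 0 <= c ->
  0 <= F -> 0 <= W -> 0 <= A -> 0 <= B ->
  W <= (1 + h) * F + c -> F <= (1 + h) * W + c ->
  A <= (1 + h) * B + c -> B <= (1 + h) * A + c -> `|B - W| <= c ->
  `|A - F| <= 12 * h * F + 28 * c.
Proof.
move=> h0 h1 c0 F0 W0 A0 B0 WF FW AB BA; rewrite !ler_norml => /andP[BW WB].
have hF : h * F <= F by rewrite ler_piMl.
have hc : h * c <= c by rewrite ler_piMl.
have hhF : h * (h * F) <= h * F by rewrite ler_wpM2l// ltW.
have hhc : h * (h * c) <= h * c by rewrite ler_wpM2l// ltW.
have AF : A <= F + 3 * (h * F) + 7 * c.
  have : (1 + h) * B <= (1 + h) * ((1 + h) * F + c + c).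
    by rewrite ler_wpM2l ?addr_ge0//; lra.
  lra.
have FA : F <= A + 2 * (h * A) + h * (h * A) + 7 * c.
  have : (1 + h) * W <= (1 + h) * ((1 + h) * A + c + c).
    by rewrite ler_wpM2l ?addr_ge0//; lra.
  lra.
have hA : h * A <= h * (4 * F + 7 * c) by rewrite ler_wpM2l; lra.
have hhA : h * (h * A) <= h * A by apply: ler_wpM2l; [exact: ltW|rewrite ler_piMl].
by apply/andP; split; lra.
Qed.

Lemma squeeze_precision (F e : R) : 0 <= F -> 0 < e ->
  exists h r : R, [/\ 0 < h, h <= 1, 0 < r &
    12 * h * F + 28 * ((1 + h^-1) * r ^+ 2) <= e].
Proof.
move=> F0 e0.
have small (c b : R) : 0 < c -> 0 < b -> exists x : R, [/\ 0 < x, x <= 1 & x * c <= b].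
  move=> c0 b0; exists (Num.min 1 (b / c)).
  by rewrite lt_min ltr01 divr_gt0// -ler_pdivlMr// !ge_min !lexx orbT.
(* [F + 1] because [F] may vanish. The factors 24 and 56 leave half of [e] to each term, and [r]
   comes after [h], whose inverse it has to compensate. *)
have [h [h0 h1 hF]] := small (24 * (F + 1)) e (ltac:(lra)) e0.
have hF0 := mulr_ge0 (ltW h0) F0.
have c0 : 0 < 1 + h^-1 by rewrite addr_gt0// invr_gt0.
have [r [r0 r1 re]] := small (56 * (1 + h^-1)) e (mulr_gt0 (ltr0n _ 56) c0) e0.
exists h, r; split=> //.
have rr : r ^+ 2 <= r by rewrite expr2 ler_piMl ?(ltW r0).
have := ler_wpM2l (ltW c0) rr; move: re.
rewrite mulrCA (mulrC r); move: (_ * r) (_ * r ^+ 2) => x z; lra.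
Qed.

End averages.

Section regular_data.
Context {R : realType} {k d : nat}.
Local Notation traj := ('I_k.+1 -> R -> 'rV[R]_d).

Definition cell (m a : nat) : set R :=
  [set s | a%:R <= s * m.+1%:R <= a.+1%:R].

(** The comparison constants are put on the first coordinate axis, where distances are differences
    of integers. *)
Definition axis_point (c : nat) : 'rV[R]_d :=
  \row_(l < d) (if l == 0%N :> nat then c%:R else 0).

Definition near_axis_point (c : nat) (v : 'rV[R]_d) :=
  [forall l, `|v ord0 l - axis_point c ord0 l| <= 1].

Definition equicontinuous01 (u : traj) := forall e : R, 0 < e ->
  exists2 r : R, 0 < r & forall j s s', I01 s -> I01 s' -> `|s - s'| < r ->
    enorm (u j s - u j s') <= e.

(* [ss], [vv] and [zz] stand for the times, the noise and the responses. *)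
Record regular_data (M K : R) (F : traj -> R) (ss : nat -> R)
    (vv zz : nat -> 'rV[R]_d) : Prop := {
  rd_time : forall i, I01 (ss i) ;
  rd_noise : forall i, enorm (zz i - vv i) <= M ;
  rd_cell : forall m a : nat, exists N, forall n, (N <= n)%N ->
    average (fun i => \1_(cell m a) (ss i)) n <= K / m.+1%:R ;
  rd_tail : forall e : R, 0 < e -> exists (r : R) N, forall n, (N <= n)%N ->
    average (fun i => if r < enorm (vv i) then enorm (vv i) ^+ 2 + 1 else 0) n <= e ;
  rd_near : forall c : nat, exists2 q : R, 0 < q & exists N, forall n, (N <= n)%N ->
    q <= average (fun i => (near_axis_point c (vv i))%:R) n ;
  rd_cost : forall u, admissible u -> equicontinuous01 u -> forall e : R, 0 < e ->
    exists N, forall n, (N <= n)%N ->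
      `|average (fun i => min_cost u (ss i) (zz i)) n - F u| <= e }.

(** A countable type. The pieces are half-open of length [m.+1%:R^-1], and [m.+2] of them are needed
    to reach time 1. *)
Definition step_index := {m : nat & {ffun 'I_m.+2 * 'I_k.+1 * 'I_d -> rat}}.

Definition step_traj (x : step_index) : traj :=
  fun j s => \row_l \sum_(a < (tag x).+2)
    \1_[set s' : R | a%:R <= s' * (tag x).+1%:R < a.+1%:R] s * ratr (tagged x (a, j, l)).

Lemma step_admissible (x : step_index) : admissible (step_traj x).
Proof.
split=> [j|].
  suff H l : measurable_fun (I01 : set R) (fun s => step_traj x j s ord0 l).
    exact: (@measurable_fun_rV_coord R d _ R I01 (step_traj x j) H).
  under eq_fun do rewrite mxE.
  apply: measurable_sum => a; apply: measurable_funM => //.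
  apply: measurable_indic.
  rewrite (_ : [set _ | _] = `[a%:R / (tag x).+1%:R, a.+1%:R / (tag x).+1%:R[%classic).
    exact: measurable_itv.
  by apply/seteqP; split=> s /=; rewrite in_itv/= ler_pdivrMr// ltr_pdivlMr.
pose C : R := \sum_(a < (tag x).+2) \sum_j \sum_l `|ratr (tagged x (a, j, l))|.
exists (d%:R * C) => j s _; apply: enorm_le_sum => l; rewrite mxE.
apply: le_trans (ler_norm_sum _ _ _) _; apply: ler_sum => a _.
rewrite normrM (bigD1 j)//= (bigD1 l)//= -!addrA.
apply: (@le_trans _ _ (`|ratr (tagged x (a, j, l))|)).
  by rewrite ler_piMl// indicE; case: (_ \in _); rewrite ?normr1 ?normr0.
by rewrite lerDl addr_ge0// ?sumr_ge0// => i _; rewrite sumr_ge0.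
Qed.

Lemma step_dense (u : traj) : equicontinuous01 u -> forall e : R, 0 < e ->
  exists x : step_index, forall j s, I01 s -> enorm (u j s - step_traj x j s) <= e.
Proof.
move=> eu e e0.
have [r r0 hr] := eu (e / 2) (divr_gt0 e0 (ltr0n _ 2)).
have [m hm] := exists_nat_ge r^-1.
have mr : m.+1%:R^-1 < r.
  by rewrite -[ltRHS]invrK ltf_pV2 ?posrE ?invr_gt0//; apply: le_lt_trans hm _; rewrite ltr_nat.
pose e' := e / (2 * d.+1%:R).
have e'0 : 0 < e' by rewrite divr_gt0// mulr_gt0.
have hq (z : 'I_m.+2 * 'I_k.+1 * 'I_d) : exists q : rat,
    `|u z.1.2 (z.1.1%:R / m.+1%:R) ord0 z.2 - ratr q| <= e'.
  set b := u _ _ _ _.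
  have [|q] := @rat_in_itvoo R (b - e') (b + e'); first by rewrite ltrD2l gtrN.
  by rewrite in_itv/= => hq; exists q; rewrite ltW// distrC ltr_distl.
have [q qP] := choice hq.
exists (existT _ m [ffun z => q z]) => j s s01.
have /andP[s0 s1] : 0 <= s <= 1 by exact/I01P.
have x0 : 0 <= s * m.+1%:R by rewrite mulr_ge0.
have /andP[a1 a2] := truncn_itv x0; set a := Num.truncn _ in a1 a2.
have am : (a < m.+2)%N.
  rewrite ltnS -(ler_nat R) (le_trans a1)//.
  by rewrite -[leRHS]mul1r ler_wpM2r.
have a01 : I01 (a%:R / m.+1%:R : R).
  apply/I01P; rewrite divr_ge0//= ler_pdivrMr// mul1r; apply: (le_trans a1).
  by rewrite -[leRHS]mul1r ler_wpM2r.
have -> : step_traj (existT _ m [ffun z => q z]) j s =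
    \row_l ratr (q (Ordinal am, j, l)).
  apply/rowP => l; rewrite !mxE /=.
  rewrite (bigD1 (Ordinal am))//= indicE mem_set/= ?a1// mul1r ffunE big1 ?addr0// => b bm.
  rewrite indicE memNset ?mul0r//= => /andP[b1 b2]; move/eqP: bm; apply.
  apply/val_inj => /=; apply/eqP; rewrite eqn_leq; apply/andP; split; rewrite -ltnS -(ltr_nat R).
    by rewrite (le_lt_trans b1).
  by rewrite (le_lt_trans a1).
apply: le_trans (enorm_triB _ (u j (a%:R / m.+1%:R)) _) _.
rewrite [leRHS](splitr e); apply: lerD.
  apply: hr => //; rewrite ger0_norm; last by rewrite subr_ge0 ler_pdivrMr.
  apply: le_lt_trans mr; rewrite -(ler_pM2r (ltr0Sn R m)) mulrBl divfK ?pnatr_eq0//.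
  rewrite mulVf ?pnatr_eq0// lerBlDl; apply: (le_trans (ltW a2)); by rewrite natr1.
apply: (@le_trans _ _ (d%:R * e')).
  by apply: enorm_le_sum => l; rewrite !mxE; exact: (qP (Ordinal am, j, l)).
apply: (@le_trans _ _ (d.+1%:R * e')); first by rewrite ler_wpM2r ?(ltW e'0)// ler_nat.
by rewrite /e' invfM mulrC -!mulrA mulVf ?pnatr_eq0// mulr1.
Qed.

End regular_data.

Lemma ae_and {d : measure_display} {T : measurableType d} {R : realType}
    (P : probability T R) (A B : T -> Prop) :
  {ae P, forall w, A w} -> {ae P, forall w, B w} -> {ae P, forall w, A w /\ B w}.
Proof. by apply: filterS2. Qed.

Lemma indic_bounds {R : realType} {T : Type} (A : set T) x :
  0 <= (\1_A x : R) <= 1.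
Proof. by rewrite indicE; case: (_ \in _); rewrite ?lexx ler01. Qed.

Section data_regularity.
Context {R : realType} {k d : nat} {dO : measure_display}
  {Omega : measurableType dO} (P : probability Omega R).
Variables (mudag : 'I_k.+1 -> R -> 'rV[R]_d) (p : 'I_k.+1 -> R)
  (phi0 : 'rV[R]_d -> R) (phiT : R -> R)
  (phi : nat -> {RV P >-> 'I_k.+1}) (eps : nat -> {RV P >-> 'rV[R]_d})
  (t : nat -> {RV P >-> R}) (y : nat -> Omega -> 'rV[R]_d).
Hypothesis A1 : assumption1 mudag p phi0 phiT phi eps t y.
Hypothesis A2 : assumption2 phi0.
Hypothesis A3 : assumption3 phi0.
Local Notation mu := (@lebesgue_measure R).
Local Notation U := ('I_k.+1 * 'rV[R]_d * R)%type.
Local Notation traj := ('I_k.+1 -> R -> 'rV[R]_d).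
Local Notation datum := (datum phi eps t).
Local Notation cost := (sample_cost mudag).
Local Notation F := (expected_cost t y).

Let mdatum := measurable_datum phi eps t.

Lemma datum_slln (G : U -> R) (c : R) : measurable_fun setT G ->
  (forall z, 0 <= G z) -> (\int[P]_w (G (datum 0%N w))%:E = c%:E)%E ->
  {ae P, forall w, forall e : R, 0 < e -> exists N, forall n, (N <= n)%N ->
    `|average (fun i => G (datum i w)) n - c| <= e}.
Proof.
move=> mG G0 Gc.
have := slln mdatum (datum_indep A1) (triples_identically_distributed A1) mG G0 Gc.
apply: filterS => w Hw e e0; have [N HN] := Hw e e0.
exists N.+1 => n Nn; apply: average_dist; first exact: leq_trans Nn.
exact/HN/ltnW.
Qed.

Lemma datum_slln_bounded (G : U -> R) (b : R) : measurable_fun setT G ->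
  (forall z, 0 <= G z <= b) ->
  {ae P, forall w, forall e : R, 0 < e -> exists N, forall n, (N <= n)%N ->
    `|average (fun i => G (datum i w)) n - \int[P]_w' G (datum 0%N w')| <= e}.
Proof.
move=> mG Gb; apply: datum_slln => // [z|]; first by have /andP[] := Gb z.
apply: (@bounded_prob_integralE _ _ _ P _ b) => //.
by apply: measurableT_comp (mdatum 0%N).
Qed.

Lemma measurable_cell m a : measurable (cell m a : set R).
Proof.
rewrite (_ : cell m a = `[a%:R / m.+1%:R, a.+1%:R / m.+1%:R]%classic) //.
by apply/seteqP; split=> s; rewrite /cell/= in_itv/= ler_pdivrMr// ler_pdivlMr.
Qed.

(** By continuity [phiT] has a maximum on [[0, 1]], which bounds the probabilities of all cells by
    their length; the added 1 leaves room for the convergence of frequencies to probabilities. *)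
Lemma cell_frequency : exists K : R, forall m a,
  {ae P, forall w, exists N, forall n, (N <= n)%N ->
    average (fun i => \1_(cell m a) (t i w)) n <= K / m.+1%:R}.
Proof.
have [c c01 hc] := EVT_max (ler01 : 0 <= 1 :> R) (phiT_continuous A1).
have c0 : 0 <= phiT c by apply: (phiT_ge0 A1).
exists (phiT c + 1) => m a.
have mG : measurable_fun setT (fun z : U => \1_(cell m a) z.2 : R).
  by apply: (measurableT_comp _ measurable_snd); exact: measurable_indic (measurable_cell m a).
have G0 (z : R) : 0 <= (\1_(cell m a) z : R) <= 1 by exact: indic_bounds.
have m0 : 0 < m.+1%:R^-1 :> R by [].
have mphi : measurable_fun (I01 : set (measurableTypeR R)) (fun s => (phiT s)%:E).
  by apply/measurable_EFinP; exact: (measurable_phiT A1).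
have mcell : measurable_fun (I01 : set (measurableTypeR R))
    (fun s => (\1_(cell m a) s)%:E : \bar R).
  apply/measurable_EFinP; apply: measurable_funTS.
  by apply: measurable_indic; exact: measurable_cell.
have E : \int[P]_w' ((\1_(cell m a) : R -> R) (t 0%N w'))%R <= phiT c / m.+1%:R.
  rewrite -lee_fin -(@bounded_prob_integralE _ _ _ P _ 1)//; last first.
    exact: (measurableT_comp mG (mdatum 0%N)).
  rewrite (integral_time A1 (F := fun s => (\1_(cell m a) s)%:E)).
  - apply: (@le_trans _ _ (\int[mu]_(s in I01) ((phiT c)%:E * (\1_(cell m a) s)%:E))%E).
      apply: ge0_le_integral => //.
      + exact: measurable_I01.
      + by move=> s s01; rewrite mule_ge0 ?lee_fin ?(phiT_ge0 A1).
      + exact: emeasurable_funM.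
      + exact: measurable_funeM.
      + by move=> s s01; rewrite muleC lee_wpmul2r ?lee_fin//; exact: hc.
    rewrite ge0_integralZl//; last exact: measurable_I01.
    rewrite EFinM lee_wpmul2l ?lee_fin//.
    rewrite integral_indic//; last 2 first.
    + exact: measurable_I01.
    + exact: measurable_cell.
    apply: (@le_trans _ _ (mu (cell m a))).
      apply: le_measure; rewrite ?inE//; last exact: measurable_cell.
      by apply: measurableI; [exact: measurable_cell|exact: measurable_I01].
    rewrite (_ : cell m a = `[a%:R / m.+1%:R, a.+1%:R / m.+1%:R]%classic); last first.
      by apply/seteqP; split=> s; rewrite /cell/= in_itv/= ler_pdivrMr// ler_pdivlMr.
    rewrite lebesgue_measure_itv/= lte_fin ltr_pM2r// ltr_nat ltnSn -EFinB lee_fin.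
    by rewrite -mulrBl -natr1 addrAC subrr add0r mul1r.
  - by apply/measurable_EFinP; exact: measurable_indic (measurable_cell m a).
  - by move=> s; rewrite lee_fin; have /andP[] := G0 s.
have := datum_slln_bounded mG (fun z => G0 z.2).
apply: filterS => w /(_ _ m0)[N HN]; exists N => n Nn; have := HN n Nn.
rewrite mulrDl mul1r ler_norml => /andP[_]; rewrite lerBlDl => h.
by apply: (le_trans h); rewrite lerD2r.
Qed.

(** The positivity of [phi0] enters here: if the box had probability 0, the density would vanish
    almost everywhere on a set of positive Lebesgue measure. *)
Lemma near_axis_frequency (c : nat) : exists2 q : R, 0 < q &
  {ae P, forall w, exists N, forall n, (N <= n)%N ->
    q <= average (fun i => (near_axis_point c (eps i w))%:R) n}.
Proof.
pose B := [set v : 'rV[R]_d | forall l, `|v ord0 l - axis_point c ord0 l| <= 1].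
have BE v : (near_axis_point c v)%:R = \1_B v :> R.
  by rewrite indicE; congr ((nat_of_bool _)%:R); apply/forallP/idP; rewrite inE.
have mB : measurable B by exact: measurable_box.
have mG : measurable_fun setT (fun z : U => \1_B z.1.2 : R).
  have mB1 : measurable_fun setT (\1_B : 'rV[R]_d -> R) by exact: measurable_indic.
  exact: (measurableT_comp mB1 (measurableT_comp measurable_snd measurable_fst)).
have G0 (v : 'rV[R]_d) : 0 <= (\1_B v : R) <= 1 by exact: indic_bounds.
pose q := \int[P]_w' ((\1_B : 'rV[R]_d -> R) (eps 0%N w'))%R.
have qE : (\int[lebesgue_rV d]_v ((\1_B v)%:E * (phi0 v)%:E) = q%:E)%E.
  rewrite -(integral_noise A1 (F := fun v => (\1_B v)%:E)).
  - rewrite (@bounded_prob_integralE _ _ _ P _ 1)//.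
    exact: (measurableT_comp mG (mdatum 0%N)).
  - by apply/measurable_EFinP; exact: measurable_indic.
  - by move=> v; rewrite lee_fin; have /andP[] := G0 v.
have q0 : 0 < q.
  rewrite lt_neqAle; apply/andP; split; last first.
    by apply: Rintegral_ge0 => w _; have /andP[] := G0 (eps 0%N w).
  apply/eqP => q0; move: qE; rewrite -q0 => qE.
  have mBp : measurable_fun setT (fun v : 'rV[R]_d => ((\1_B v)%:E * (phi0 v)%:E)%E).
    apply: emeasurable_funM; apply/measurable_EFinP; first exact: measurable_indic.
    exact: (measurable_phi0 A1).
  have [N [mN N0 hN]] : {ae lebesgue_rV d, forall v, setT v -> ((\1_B v)%:E * (phi0 v)%:E)%E = 0%E}.
    apply/(ae_eq_integral_abs (lebesgue_rV d) measurableT mBp).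
    apply: etrans qE; apply: eq_integral => v _; rewrite gee0_abs// mule_ge0// lee_fin ?(ltW (A3 v))//.
  have BN : B `<=` N.
    move=> v Bv; apply: hN => /(_ I); rewrite indicE mem_set// mul1e => -[].
    by apply/eqP; rewrite gt_eqF.
  have : lebesgue_rV d B = 0%E by apply: subset_measure0 N0.
  pose A (l : 'I_d) : set R := `[axis_point c ord0 l - 1, axis_point c ord0 l + 1]%classic.
  have -> : B = [set v : 'rV[R]_d | forall l, A l (v ord0 l)].
    by apply/seteqP; split=> v h l; have := h l; rewrite /A /= in_itv/= ler_distl.
  have E : lebesgue_rV d [set v : 'rV[R]_d | forall l, A l (v ord0 l)] = (\prod_(l < d) mu (A l))%E.
    by apply: lebesgue_rV_box => l; exact: measurable_itv.
  have : (0 < \prod_(l < d) mu (A l))%E.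
    elim/big_ind: _ => [|x z x0 z0|l _]; [exact: lte01|exact: mule_gt0|].
    rewrite lebesgue_measure_itv/= lte_fin ltrD2l ifT -?EFinB ?lte_fin; lra.
  by rewrite E => h0 h1; rewrite h1 ltxx in h0.
exists (q / 2); first by rewrite divr_gt0.
have := datum_slln_bounded mG (fun z => G0 z.1.2).
apply: filterS => w /(_ _ (divr_gt0 q0 (ltr0n _ 2)))[N HN]; exists N => n Nn.
have := HN n Nn; rewrite -/q /average; under [in X in _ -> X]eq_bigr do rewrite BE.
by move: (_ * _) => x; rewrite ler_norml => /andP[h _]; lra.
Qed.

(** Dominated convergence makes the mean of the tail small for a large integer radius, and the
    strong law is applied to all integer radii. The summand 1 lets the tail control the number of
    exceptional samples as well. *)
Lemma noise_tail : {ae P, forall w, forall e : R, 0 < e -> exists (r : R) N,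
  forall n, (N <= n)%N -> average (fun i =>
    if r < enorm (eps i w) then enorm (eps i w) ^+ 2 + 1 else 0) n <= e}.
Proof.
pose g (v : 'rV[R]_d) : R := enorm v ^+ 2 + 1.
pose f (r : nat) (v : 'rV[R]_d) : R := if r%:R < enorm v then g v else 0.
have g0 v : 0 <= g v by rewrite /g addr_ge0 ?sqr_ge0.
have f0 r v : 0 <= f r v by rewrite /f; case: ifP.
have mg : measurable_fun setT g by apply: measurable_funD => //; exact: measurable_noise_sqr.
have mf r : measurable_fun setT (f r).
  have -> : f r = fun v => if r%:R ^+ 2 < enorm v ^+ 2 then g v else 0.
    by apply/funext => v; rewrite /f ltr_sqr ?nnegrE ?enorm_ge0.
  apply: measurable_fun_ifT => //; apply: measurable_fun_ltr => //.
  exact: measurable_noise_sqr.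
have me : measurable_fun setT (eps 0%N) by exact: measurable_funPT.
have mT (h : 'rV[R]_d -> R) : measurable_fun setT h ->
    measurable_fun setT (fun w => (h (eps 0%N w))%:E).
  by move=> mh; apply/measurable_EFinP; exact: (measurableT_comp mh me).
have mU (h : 'rV[R]_d -> R) : measurable_fun setT h ->
    measurable_fun setT (fun z : U => h z.1.2).
  by move=> mh; exact: (measurableT_comp mh (measurableT_comp measurable_snd measurable_fst)).
have ig : P.-integrable setT (fun w => (g (eps 0%N w))%:E).
  apply/integrableP; split; first exact: mT.
  under eq_integral do rewrite gee0_abs ?lee_fin//.
  under eq_integral do rewrite EFinD.
  rewrite ge0_integralD//; last 2 first.
  - by move=> w _; rewrite lee_fin sqr_ge0.
  - exact: (mT _ measurable_noise_sqr).
  rewrite lte_add_pinfty//; first exact: (noise_sqr_finite A1 A2).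
  by rewrite integral_cst// [X in (_ * X)%E]probability_setT mule1 ltry.
have fg r w : (`|(f r (eps 0%N w))%:E| <= (g (eps 0%N w))%:E)%E.
  by rewrite gee0_abs ?lee_fin// /f; case: ifP.
have fcv : {ae P, forall w, setT w -> (f r (eps 0%N w))%:E @[r --> \oo] --> 0%E}.
  apply: aeW => w _; have [r0 hr0] := exists_nat_ge (enorm (eps 0%N w)).
  apply: cvg_near_cst; exists r0 => // r /= r0r; rewrite /f ifF//.
  by apply/negbTE; rewrite -leNgt; apply: le_trans hr0 _; rewrite ler_nat.
have fdom : {ae P, forall w r, setT w -> (`|(f r (eps 0%N w))%:E| <= (g (eps 0%N w))%:E)%E}.
  by apply: aeW => w r _; exact: fg.
have [_ _ cv] := dominated_convergence measurableT (fun r => mT _ (mf r))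
  (measurable_cst _) fcv ig fdom.
pose c r := \int[P]_w f r (eps 0%N w).
have cE r : (\int[P]_w (f r (eps 0%N w))%:E = (c r)%:E)%E.
  rewrite /c /Rintegral fineK// ge0_fin_numE; last first.
    by apply: integral_ge0 => w _; rewrite lee_fin.
  apply: (@le_lt_trans _ _ (\int[P]_w (g (eps 0%N w))%:E)%E).
    apply: ge0_le_integral => //; try exact: mT.
    - by move=> w _; rewrite lee_fin.
    - by move=> w _; rewrite lee_fin /f; case: ifP.
  have := integrable_lty measurableT ig; apply: le_lt_trans.
  by under [leRHS]eq_integral do rewrite /=.
have {}cv : c r @[r --> \oo] --> 0.
  suff /fine_cvg : (c r)%:E @[r --> \oo] --> 0%:E by [].
  move: cv; rewrite integral0; under eq_fun do rewrite cE; exact.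
have ae1 : {ae P, forall w, forall r : nat, forall e : R, 0 < e -> exists N, forall n, (N <= n)%N ->
    `|average (fun i => f r (eps i w)) n - c r| <= e}.
  apply: ae_foralln => r; exact: (datum_slln (mU _ (mf r)) (fun z => f0 r _) (cE r)).
move: ae1; apply: filterS => w Hw e e0.
have [r hr] := (cvg_seqP _ _).1 cv (e / 2) (divr_gt0 e0 (ltr0n _ 2)).
have [N HN] := Hw r (e / 2) (divr_gt0 e0 (ltr0n _ 2)).
exists r%:R, N => n Nn; have := HN n Nn; have := hr r (leqnn r); rewrite /f.
rewrite subr0; move: (c r) (average _ n) => x z.
by rewrite !ler_norml => /andP[_ h1] /andP[_ h2]; lra.
Qed.

Lemma expected_cost_near (u v : traj) (r e : R) : 0 < e ->
  admissible u -> admissible v ->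
  (forall j s, I01 s -> enorm (u j s - v j s) <= r) ->
  F u <= (1 + e) * F v + (1 + e^-1) * r ^+ 2.
Proof.
move=> e0 au av uv.
have e1 : 0 <= 1 + e by rewrite addr_ge0// ltW.
have e2 : 0 <= (1 + e^-1) * r ^+ 2 by rewrite mulr_ge0 ?sqr_ge0// addr_ge0// invr_ge0 ltW.
have mc (x : traj) : admissible x -> measurable_fun setT (fun w => (cost x (datum 0%N w))%:E).
  move=> ax; apply/measurable_EFinP; apply: measurableT_comp (mdatum 0%N).
  exact: (measurable_sample_cost A1 ax.1).
have c0 x z : 0 <= cost x z by exact: sample_cost_ge0.
rewrite -lee_fin EFinD EFinM -(expected_costE A1 A2 au) -(expected_costE A1 A2 av).
rewrite -ge0_integralZl//; [|exact: mc|by move=> w _; rewrite lee_fin].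
apply: (@le_trans _ _ (\int[P]_w ((1 + e)%:E * (cost v (datum 0%N w))%:E + ((1 + e^-1) * r ^+ 2)%:E))%E).
  apply: ge0_le_integral => //.
  - by move=> w _; rewrite lee_fin.
  - exact: mc.
  - by apply: emeasurable_funD => //; apply: measurable_funeM; exact: mc.
  - move=> w _; rewrite -EFinM -EFinD lee_fin !(sample_costE A1).
    apply: min_cost_near => // j; apply: uv; exact: (time_in01 A1).
rewrite ge0_integralD//.
- by rewrite integral_cst// [X in (_ * X)%E]probability_setT mule1.
- by move=> w _; rewrite -EFinM lee_fin mulr_ge0.
- by apply: measurable_funeM; exact: mc.
Qed.

Lemma expected_cost_ge0 (u : traj) : 0 <= F u.
Proof. by apply: Rintegral_ge0 => w _; exact: min_cost_ge0. Qed.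

Lemma step_cost_limit : {ae P, forall w, forall x : @step_index k d, forall e : R, 0 < e ->
  exists N, forall n, (N <= n)%N ->
    `|average (fun i => min_cost (step_traj x) (t i w) (y i w)) n - F (step_traj x)| <= e}.
Proof.
pose Q (x : @step_index k d) w := forall e : R, 0 < e -> exists N, forall n, (N <= n)%N ->
  `|average (fun i => min_cost (step_traj x) (t i w) (y i w)) n - F (step_traj x)| <= e.
have H x : {ae P, forall w, Q x w}.
  have ax := @step_admissible R k d x.
  have := datum_slln (measurable_sample_cost A1 ax.1) (sample_cost_ge0 _ _) (expected_costE A1 A2 ax).
  apply: filterS => w Hw e e0; have [N HN] := Hw e e0; exists N => n /HN.
  by rewrite /average; under eq_bigr do rewrite (sample_costE A1).
(* The almost sure statements are gathered along the codes of the countably many step tuples. *)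
have : {ae P, forall w, forall n, if (choice.unpickle n : option (@step_index k d)) is Some x then Q x w else True}.
  by apply: ae_foralln => n; case: choice.unpickle => [x|]; [exact: H|exact: aeW].
by apply: filterS => w Hw x; have := Hw (choice.pickle x); rewrite choice.pickleK.
Qed.

Lemma regular_data_ae : exists M K : R, 0 <= M /\
  {ae P, forall w, @regular_data R k d M K F (t^~ w) (eps^~ w) (y^~ w)}.
Proof.
have [M [M0 HM]] := mudag_ae_bound A1; have aeM := mudag_sample_bound A1 HM.
have [K HK] := cell_frequency.
have aeK : {ae P, forall w, forall m a, exists N, forall n, (N <= n)%N ->
    average (fun i => \1_(cell m a) (t i w)) n <= K / m.+1%:R}.
  by apply: ae_foralln => m; apply: ae_foralln => a; exact: HK.
have aeN : {ae P, forall w, forall c : nat, exists2 q : R, 0 < q & exists N, forall n, (N <= n)%N ->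
    q <= average (fun i => (near_axis_point c (eps i w))%:R) n}.
  apply: ae_foralln => c; have [q q0 h] := near_axis_frequency c.
  by move: h; apply: filterS => w h; exists q.
exists M, K; split=> //.
have := ae_and aeM (ae_and aeK (ae_and aeN (ae_and noise_tail step_cost_limit))).
apply: filterS => w [h1 [h2 [h3 [h4 h5]]]].
apply: Build_regular_data; [|by move=> i; rewrite (data_model A1) addrK| | | |].
- by move=> i; exact: (time_in01 A1).
- exact: h2.
- exact: h4.
- exact: h3.
move=> u au eu e e0.
have [h [r [h0 h1' r0 hr]]] := squeeze_precision (expected_cost_ge0 u) e0.
have [x hx] := step_dense eu r0.
have c0 : 0 < (1 + h^-1) * r ^+ 2.
  by rewrite mulr_gt0 ?exprn_gt0// addr_gt0// invr_gt0.
have [N HN] := h5 x _ c0.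
have ax := @step_admissible R k d x.
have hx' j s : I01 s -> enorm (step_traj x j s - u j s) <= r.
  by move=> s01; rewrite enormB; exact: hx.
exists N.+1 => n Nn; have n0 : (0 < n)%N by exact: leq_trans Nn.
apply: le_trans hr; apply: (@squeeze_limit _ h _ _ (F (step_traj x)) _
  (average (fun i => min_cost (step_traj x) (t i w) (y i w)) n)) => //.
- exact: ltW.
- exact: expected_cost_ge0.
- exact: expected_cost_ge0.
- by apply: average_ge0 => i; exact: min_cost_ge0.
- by apply: average_ge0 => i; exact: min_cost_ge0.
- exact: expected_cost_near.
- exact: expected_cost_near.
- rewrite -averageZ -(average_cst ((1 + h^-1) * r ^+ 2) n0) -averageD.
  apply: average_le => i _; apply: min_cost_near => // j; apply: hx; exact: (time_in01 A1).
- rewrite -averageZ -(average_cst ((1 + h^-1) * r ^+ 2) n0) -averageD.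
  apply: average_le => i _; apply: min_cost_near => // j; apply: hx'; exact: (time_in01 A1).
- exact/HN/ltnW.
Qed.

End data_regularity.

(** * Boundedness and limits of the minimizers *)

Section far_points.
Context {R : realType} {k d : nat}.
Local Notation traj := ('I_k.+1 -> R -> 'rV[R]_d).
Variable s : nat.
Hypotheses (s_gt0 : (0 < s)%N) (d_gt0 : (0 < d)%N).

Lemma sobolevk_equicontinuous (u : traj) : sobolevk s u -> equicontinuous01 u.
Proof.
move=> su e e0; set C := Num.sqrt (4 ^+ s * sobB s u u).
have C0 : 0 <= C by exact: sqrtr_ge0.
pose r := (e / (d%:R * C + 1)) ^+ 2.
have D0 : 0 < d%:R * C + 1 by rewrite ltr_wpDl ?mulr_ge0.
exists r; first by rewrite exprn_gt0 ?divr_gt0.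
move=> j x x' x01 x01' xr.
apply: (@le_trans _ _ (d%:R * (Num.sqrt `|x - x'| * C))).
  by apply: enorm_le_sum => l; rewrite !mxE; exact: sobolevk_holder.
have : Num.sqrt `|x - x'| <= e / (d%:R * C + 1).
  rewrite -ler_sqr ?nnegrE ?sqrtr_ge0 ?divr_ge0 ?(ltW e0) ?(ltW D0)//.
  by rewrite sqr_sqrtr// ltW.
rewrite ler_pdivlMr//; have := sqrtr_ge0 `|x - x'|.
by move: (Num.sqrt `|x - x'|) => z z0; rewrite mulrCA; lra.
Qed.

Lemma sobolevk_admissible (u : traj) : sobolevk s u -> admissible u.
Proof.
move=> su; split=> [j|].
  suff H l : measurable_fun (I01 : set R) (fun x => u j x ord0 l).
    exact: (@measurable_fun_rV_coord R d _ R I01 (u j) H).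
  by have := cont01_measurable (sobolevk_cont s_gt0 j l su); exact.
set C := Num.sqrt (4 ^+ s * sobB s u u).
exists (\sum_j enorm (u j 0) + d%:R * C) => j x x01.
apply: le_trans (enorm_leB _ (u j 0)) _; apply: lerD.
  by rewrite (bigD1 j)//= lerDl sumr_ge0// => i _; exact: enorm_ge0.
apply: enorm_le_sum => l; rewrite !mxE.
apply: le_trans (sobolevk_holder s_gt0 j l su x01 I01_0) _.
rewrite ler_piMl ?sqrtr_ge0// -sqrtr1 ler_wsqrtr// subr0.
by move/I01P: x01 => /andP[x0 x1]; rewrite ger0_norm.
Qed.

Lemma enorm_axis_pointB (a b : nat) :
  enorm (axis_point a - axis_point b : 'rV[R]_d) = `|a%:R - b%:R|.
Proof.
rewrite -sqrtr_sqr /enorm; congr Num.sqrt.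
rewrite (bigD1 (Ordinal d_gt0))//= !mxE/= big1 ?addr0// => l l0.
have {}l0 : (l == 0%N :> nat) = false by apply/negbTE.
by rewrite !mxE l0 subrr expr0n.
Qed.

Lemma enorm_axis_point (a : nat) : enorm (axis_point a : 'rV[R]_d) = a%:R.
Proof.
have -> : axis_point a = axis_point a - axis_point 0 :> 'rV[R]_d.
  by apply/rowP => l; rewrite !mxE; case: ifP => _; rewrite subr0.
by rewrite enorm_axis_pointB subr0 ger0_norm.
Qed.

Lemma near_axis_pointP (a : nat) (v : 'rV[R]_d) : near_axis_point a v ->
  enorm (v - axis_point a) <= d%:R.
Proof.
move/forallP => h; rewrite -[leRHS]mulr1; apply: enorm_le_sum => l.
by have := h l; rewrite !mxE.
Qed.

Definition far_point (a0 D : nat) (j : 'I_k.+1) : 'rV[R]_d := axis_point (a0 + j * D).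

Lemma far_point_sep a0 D j l (delta : R) : delta <= D%:R -> j != l ->
  delta <= enorm (far_point a0 D j - far_point a0 D l).
Proof.
move=> hD jl; rewrite enorm_axis_pointB; apply: (le_trans hD).
wlog: j l jl / (l < j)%N.
  move=> H; case: (ltngtP l j) => h; first exact: H.
    by rewrite distrC; apply: H => //; rewrite eq_sym.
  by move/val_inj: h jl => ->; rewrite eqxx.
move=> lj; rewrite -natrB; last by rewrite leq_add2l leq_mul2r ltnW// orbT.
by rewrite normr_nat ler_nat subnDl -mulnBl leq_pmull// subn_gt0.
Qed.

Lemma far_point_bounds a0 D j : a0%:R <= enorm (far_point a0 D j) <= (a0 + k * D)%:R.
Proof.
rewrite enorm_axis_point !ler_nat leq_addr leq_add2l leq_mul2r.
by rewrite -ltnS ltn_ord orbT.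
Qed.

Lemma constant_Theta a0 D (delta : R) : delta <= D%:R ->
  Theta s delta (fun (j : 'I_k.+1) (_ : R) => far_point a0 D j).
Proof.
move=> hD; split=> [j|x _ j l jl]; last exact: far_point_sep.
exact: (sobolev_cst s_gt0 _).1.
Qed.

(** The retained trajectories stay in the ball of radius [A], the constants at distance at least
    [A + delta] from the origin and [D] from each other. *)
Lemma replaced_Theta a0 D (delta A : R) (J : pred 'I_k.+1) (u : traj) :
  delta <= D%:R -> A + delta <= a0%:R -> Theta s delta u ->
  (forall j x, J j -> I01 x -> enorm (u j x) <= A) ->
  Theta s delta (fun j => if J j then u j else fun=> far_point a0 D j).
Proof.
move=> hD ha [su sepu] uA; split.
  exact: (sobolevk_replace s_gt0 (far_point a0 D) J ler01 su).1.
move=> x x01 j l jl.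
have sep i i' : J i -> delta <= enorm (u i x - far_point a0 D i').
  move=> Ji; have /andP[h _] := far_point_bounds a0 D i'.
  have := enorm_leB (far_point a0 D i') (u i x); have := uA i x Ji x01.
  by rewrite (enormB (far_point _ _ _)); lra.
case: ifP => Jj; case: ifP => Jl; [exact: sepu|exact: sep| |exact: far_point_sep].
by rewrite enormB; exact: sep.
Qed.

(* A trajectory with a moderate derivative of order [s] that is small in too many
   cells is bounded; every other cell provides separated points. *)
Definition small_cells (u : traj) (L : R) (m : nat) (j : 'I_k.+1) :=
  [seq a <- iota 0 m.+1 | `[< exists x, [/\ I01 x, cell m a x & enorm (u j x) <= L] >]].

Lemma small_cells_mem (u : traj) L m j x : I01 x -> enorm (u j x) <= L ->
  exists2 a, a \in small_cells u L m j & cell m a x.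
Proof.
move=> x01 ux; have /andP[x0 x1] : 0 <= x <= 1 by exact/I01P.
have z0 : 0 <= x * m.+1%:R by rewrite mulr_ge0.
have [a am ax] : exists2 a, (a < m.+1)%N & cell m a x.
  have /andP[a1 a2] := truncn_itv z0; set a := Num.truncn _ in a1 a2.
  have [am|am] := ltnP a m.+1; first by exists a => //; rewrite /cell/= a1 ltW.
  exists m => //; rewrite /cell/=; apply/andP; split.
    by apply: le_trans a1; rewrite ler_nat ltnW.
  by rewrite -[leRHS]mul1r ler_wpM2r.
exists a => //; rewrite mem_filter mem_iota/= add0n am andbT.
by apply/asboolP; exists x.
Qed.

Lemma small_cells_size (L C : R) (m : nat) : 0 <= L -> 0 <= C ->
  exists K' : R, forall (u : traj) j, sobolevk s u ->
    sqnorm2 (nderiv01 s (u j)) <= C -> (2 ^ s < size (small_cells u L m j))%N ->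
    forall x, I01 x -> enorm (u j x) <= K'.
Proof.
move=> L0 C0.
have c0 : 0 < m.+1%:R^-1 :> R by [].
have [K' [K'0 HK']] := @sobolev_points_bound R k d s s_gt0 L C _ L0 C0 c0.
exists (d%:R * K') => u j su uC.
set S := small_cells u L m j => hS.
have Sn i : (i < size S)%N -> exists x, [/\ I01 x, cell m (nth 0%N S i) x & enorm (u j x) <= L].
  by move=> iS; have := mem_nth 0%N iS; rewrite mem_filter => /andP[/asboolP].
have sS : sorted ltn S by apply: sorted_filter; [exact: ltn_trans|exact: iota_ltn_sorted].
have hlt i : (i < 2 ^ s.-1)%N -> (i.*2 < size S)%N.
  move=> h; apply: leq_ltn_trans hS; rewrite -(prednK s_gt0) expnS -mul2n leq_mul2l/=.
  exact: ltnW.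
have [x hx] : exists x : nat -> R, forall i, (i < 2 ^ s.-1)%N ->
    [/\ I01 (x i), cell m (nth 0%N S i.*2) (x i) & enorm (u j (x i)) <= L].
  have H i : exists x : R, (i < 2 ^ s.-1)%N ->
      [/\ I01 x, cell m (nth 0%N S i.*2) x & enorm (u j x) <= L].
    have [h|h] := ltnP i (2 ^ s.-1); last by exists 0.
    by have [x hx] := Sn _ (hlt i h); exists x.
  by have [x hx] := choice H; exists x.
move=> z z01; apply: enorm_le_sum => l.
have := HK' u j x su _ _ uC 0%N s_gt0 z l z01; apply.
  by move=> a /hx[].
move=> a ha; have [_ /andP[_ h1] _] := hx a (ltnW ha).
have [_ /andP[h2 _] _] := hx a.+1 ha.
(* Skipping one small cell leaves a full cell between the chosen ones, hence a gap of [m.+1%:R^-1].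
   This is why [2 ^ s] cells are asked for to obtain [2 ^ s.-1] times. *)
have hn : ((nth 0%N S a.*2).+2 <= nth 0%N S a.+1.*2)%N.
  have i2 := hlt _ ha; rewrite doubleS in i2 *.
  have i1 : (a.*2.+1 < size S)%N by exact: ltnW.
  have l1 : (nth 0%N S a.*2 < nth 0%N S a.*2.+1)%N.
    by apply: (sorted_ltn_nth ltn_trans) => //; rewrite inE//; exact: ltnW.
  have l2 : (nth 0%N S a.*2.+1 < nth 0%N S a.*2.+2)%N.
    by apply: (sorted_ltn_nth ltn_trans).
  exact: leq_ltn_trans l1 l2.
rewrite -(ler_pM2r (ltr0Sn R m)) mulrDl mulVf ?pnatr_eq0//.
apply: le_trans h2; apply: (@le_trans _ _ ((nth 0%N S a.*2).+2)%:R); last by rewrite ler_nat.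
by rewrite -[leRHS]natr1 lerD2r.
Qed.

End far_points.

Section cost_gap.
Context {R : realType} {k d : nat}.
Local Notation traj := ('I_k.+1 -> R -> 'rV[R]_d).

Lemma average_sum (I : Type) (r : seq I) (Q : pred I) (f : I -> nat -> R) n :
  average (fun i => \sum_(x <- r | Q x) f x i) n = \sum_(x <- r | Q x) average (f x) n.
Proof. by rewrite /average exchange_big/= mulr_sumr. Qed.

(* Replacing the trajectories outside [J] by far away constants decreases the
   cost of a sample, by at least one if the noise is close to one of the
   constants; exceptions are large noise and times at which a replaced trajectory
   is small. *)
Lemma cost_gap (d_gt0 : (0 < d)%N) (u : traj) (J : pred 'I_k.+1) (a0 D : nat)
    (A L r M C0 B : R) (t : R) (z v : 'rV[R]_d) (l0 : 'I_k.+1) (bad : bool) :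
  0 <= M -> 0 <= A -> C0 = (a0 + k * D)%:R -> B = 2 + 2 * (M + C0) ^+ 2 ->
  C0 + d%:R <= r -> 2 * r + 2 * M + C0 + 1 <= L ->
  A + 2 * d%:R + 2 * M + 1 <= a0%:R ->
  (forall j, J j -> enorm (u j t) <= A) -> ~~ J l0 -> enorm (z - v) <= M ->
  (~~ bad -> forall j, ~~ J j -> L <= enorm (u j t)) ->
  min_cost (fun j => if J j then u j else fun=> far_point a0 D j) t z +
    (near_axis_point (a0 + l0 * D) v)%:R <=
  min_cost u t z + B * (if r < enorm v then enorm v ^+ 2 + 1 else 0) +
    (B * (r ^+ 2 + 1) + 1) * bad%:R.
Proof.
move=> M0 A0 hC0 hB hr hL ha uA Jl0 zv hbad.
set w := fun j => _; set gv := min_cost w t z; set x := near_axis_point _ _.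
pose c : 'rV[R]_d := far_point a0 D l0.
have C00 : 0 <= C0 by rewrite hC0.
have /andP[ca cC] : a0%:R <= enorm c <= C0 by rewrite hC0; exact: far_point_bounds.
have v0 := enorm_ge0 v.
have B0 : 0 <= B by rewrite hB addr_ge0// mulr_ge0 ?sqr_ge0.
have gvc : gv <= enorm (z - c) ^+ 2.
  by have := min_cost_le w t z l0; rewrite /w (negbTE Jl0).
have zc : enorm (z - c) <= enorm v + M + C0.
  have -> : z - c = v + ((z - v) - c) by rewrite addrA [v + _]addrC subrK.
  have := enormD v (z - v - c); have := enormD (z - v) (- c); rewrite enormN; lra.
have gvB : gv <= B * (enorm v ^+ 2 + 1).
  apply: (le_trans gvc); apply: (@le_trans _ _ ((enorm v + (M + C0)) ^+ 2)).
    by rewrite ler_sqr ?nnegrE ?enorm_ge0 ?addr_ge0// addrA.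
  rewrite hB; have := sqr_ge0 (enorm v - (M + C0)).
  have : 0 <= (M + C0) ^+ 2 * enorm v ^+ 2 by rewrite mulr_ge0 ?sqr_ge0.
  by move: (enorm v) (M + C0) => p q; lra.
have x1 : (x : nat)%:R <= 1 :> R by case: (x); rewrite ?lexx ?ler01.
have xn : x -> enorm (v - c) <= d%:R by exact: near_axis_pointP.
have gu0 := min_cost_ge0 u t z.
have r0 : 0 <= r by apply: le_trans hr; rewrite addr_ge0.
have T0 : 0 <= B * (r ^+ 2 + 1) + 1 by rewrite addr_ge0// mulr_ge0// addr_ge0// sqr_ge0.
(* Large noise: the tail term pays for the whole new cost, and [C0 + d%:R <= r] excludes noise near
   the constant. *)
have [rv|vr] := ltP r (enorm v).
  have -> : (x : nat)%:R = 0 :> R.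
    case: (boolP x) => // /xn h; exfalso.
    by have := enorm_leB v c; lra.
  rewrite addr0 -addrA; apply: (le_trans gvB).
  by have := mulr_ge0 T0 (ler0n R bad); lra.
rewrite mulr0 addr0.
have [bt|bf] := boolP bad.
  rewrite mulr1; suff : B * (enorm v ^+ 2 + 1) <= B * (r ^+ 2 + 1).
    by move: gvB x1 gu0; move: (B * _) => p; lra.
  by rewrite ler_wpM2l// lerD2r ler_sqr ?nnegrE.
rewrite mulr0 addr0.
have [j gu] := min_costP u t z; rewrite gu.
have zn : enorm z <= r + M by have := enorm_leB z v; lra.
have d0 : 0 <= d%:R :> R by [].
have sq1 (p q : R) : 0 <= p -> p + 1 <= q -> p ^+ 2 + 1 <= q ^+ 2.
  move=> p0 pq; apply: (@le_trans _ _ ((p + 1) ^+ 2)); first by rewrite sqrrD1; lra.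
  by rewrite ler_sqr ?nnegrE//; lra.
(* The optimal trajectory is outside [J]: being beyond [L], it is farther from [z] than [c] by at
   least 1. *)
have [Jj|Jj] := boolP (J j); last first.
  apply: le_trans (_ : enorm (z - c) ^+ 2 + 1 <= _); first exact: lerD.
  apply: sq1; first exact: enorm_ge0.
  by have := hbad bf j Jj; have := enorm_leB (u j t) z; rewrite (enormB _ z); lra.
have [xt|xf] := boolP x; last first.
  by rewrite addr0; have := min_cost_le w t z j; rewrite /w Jj.
(* [z] is within [d%:R + M] of [c], whose norm is at least [a0%:R]; the choice of [a0] makes a
   trajectory of norm at most [A] farther from [z] by at least 1. *)
have h1 := xn xt.
have h2 : enorm (z - c) <= d%:R + M by have := enorm_triB z v c; lra.
apply: le_trans (_ : enorm (z - c) ^+ 2 + 1 <= _); first exact: lerD.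
apply: sq1; first exact: enorm_ge0.
have := uA j Jj; have := enorm_leB c z; have := enorm_leB z (u j t).
by rewrite (enormB c); lra.
Qed.

End cost_gap.

Section minimizing_sequence.
Context {R : realType} {k d : nat}.
Local Notation traj := ('I_k.+1 -> R -> 'rV[R]_d).
Variables (s : nat) (lambda delta : R).
Hypotheses (s_gt0 : (0 < s)%N) (d_gt0 : (0 < d)%N)
  (lambda_gt0 : 0 < lambda) (delta_gt0 : 0 < delta).
Variables (M K : R) (F : traj -> R) (ss : nat -> R) (vv zz : nat -> 'rV[R]_d).
Hypotheses (M0 : 0 <= M) (HR : regular_data M K F ss vv zz).
Variable mu : nat -> traj.
Hypothesis mu_Theta : forall n, Theta s delta (mu n).
Hypothesis mu_min : forall n, (0 < n)%N ->
  is_minimizer (Theta s delta) (f_n s lambda ss zz n) (mu n).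

Definition empirical_cost (u : traj) n := average (fun i => min_cost u (ss i) (zz i)) n.

Lemma mu_le (v : traj) n : (0 < n)%N -> Theta s delta v ->
  empirical_cost (mu n) n + penalty s lambda (mu n) <=
  empirical_cost v n + penalty s lambda v.
Proof. by move=> n0 hv; exact: (mu_min n0).2 hv. Qed.

Lemma empirical_cost_ge0 u n : 0 <= empirical_cost u n.
Proof. by apply: average_ge0 => i; exact: min_cost_ge0. Qed.

Lemma sqnorm2_ge0 (g : R -> 'rV[R]_d) : 0 <= sqnorm2 g.
Proof. by apply: Rintegral_ge0 => x _; exact: sqr_ge0. Qed.

Lemma mu_penalty_bound : exists (C : R) N, [/\ 0 <= C, (0 < N)%N &
  forall n, (N <= n)%N -> forall j, sqnorm2 (nderiv01 s (mu n j)) <= C].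
Proof.
have [D hD] := exists_nat_ge delta.
pose v : traj := fun j _ => far_point 0 D j.
have hv : Theta s delta v by exact: constant_Theta.
have [N HN] := rd_cost HR (sobolevk_admissible s_gt0 hv.1) (sobolevk_equicontinuous s_gt0 hv.1) ltr01.
have pv : penalty s lambda v = 0.
  by rewrite /penalty big1 ?mulr0// => j _; exact: (sobolev_cst s_gt0 _).2.
exists ((`|F v| + 1) / lambda), (maxn N 1); split.
- by rewrite divr_ge0 ?addr_ge0// ltW.
- by rewrite leq_max orbT.
move=> n; rewrite geq_max => /andP[Nn n0] j.
have := mu_le n0 hv; rewrite pv addr0; have := empirical_cost_ge0 (mu n) n.
have := HN n Nn; rewrite -/(empirical_cost v n) ler_norml => /andP[_ h1] h2 h3.
have h4 : lambda * sqnorm2 (nderiv01 s (mu n j)) <= penalty s lambda (mu n).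
  rewrite ler_wpM2l ?(ltW lambda_gt0)// (bigD1 j)//= lerDl sumr_ge0// => i _.
  exact: sqnorm2_ge0.
rewrite ler_pdivlMr// mulrC; have := ler_norm (F v); lra.
Qed.

Definition bounded01 (A : R) (u : traj) (j : 'I_k.+1) : bool :=
  `[< forall x, I01 x -> enorm (u j x) <= A >].

Lemma bounded01P A u j :
  reflect (forall x, I01 x -> enorm (u j x) <= A) (bounded01 A u j).
Proof. exact: asboolP. Qed.

(** The bounded trajectories may be different ones for each [n]; counting them allows an induction
    that keeps the whole sequence. *)
Definition many_bounded (m : nat) := exists (A : R) N, forall n, (N <= n)%N ->
  (m <= #|[pred j | bounded01 A (mu n) j]|)%N.

Lemma near_frequency a0 D : exists2 q : R, 0 < q & exists N, forall n, (N <= n)%N ->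
  forall l : 'I_k.+1, q <= average (fun i => (near_axis_point (a0 + l * D) (vv i))%:R) n.
Proof.
have H (l : 'I_k.+1) : exists z : R * nat, 0 < z.1 /\ forall n, (z.2 <= n)%N ->
    z.1 <= average (fun i => (near_axis_point (a0 + l * D) (vv i))%:R) n.
  by have [q q0 [N HN]] := rd_near HR (a0 + l * D); exists (q, N).
have [z hz] := choice H.
exists (\big[Num.min/1]_l (z l).1).
  elim/big_ind: _ => [|x y x0 y0|l _]; [exact: ltr01|by rewrite lt_min x0|exact: (hz l).1].
exists (\max_l (z l).2) => n Nn l.
have [_ hl] := hz l; apply: le_trans (hl n (leq_trans _ Nn)).
  exact: bigmin_le.
exact: (leq_bigmax (F := fun l => (z l).2)).
Qed.

(** Uniform in the tuple, as it must be for minimizers that depend on the sample: only the [m.+1]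
    cell frequencies have to be controlled. *)
Lemma small_cells_frequency (L : R) m : exists N, forall n, (N <= n)%N ->
  forall (u : traj) j, average (fun i => \sum_(a <- small_cells u L m j) \1_(cell m a) (ss i)) n <=
  (size (small_cells u L m j))%:R * (`|K| / m.+1%:R).
Proof.
have [N HN] := choice (rd_cell HR m).
exists (\max_(a < m.+1) N a) => n Nn u j.
rewrite average_sum -[X in _ <= X%:R * _]sum1_size natr_sum mulr_suml.
rewrite big_seq [leRHS]big_seq; apply: ler_sum => a.
rewrite mem_filter mem_iota/= add0n => /andP[_ am]; rewrite mul1r.
have Na : (N a <= n)%N.
  apply: leq_trans Nn; exact: (leq_bigmax (F := fun a : 'I_m.+1 => N a) (Ordinal am)).
by apply: le_trans (HN a n Na) _; rewrite ler_wpM2r// ler_norm.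
Qed.

Lemma exists_fine_mesh (a e : R) : 0 <= a -> 0 < e -> exists m : nat, a / m.+1%:R <= e.
Proof.
move=> a0 e0; have [m hm] := exists_nat_ge (a / e); exists m.
rewrite ler_pdivrMr// -ler_pdivrMl// mulrC; apply: le_trans hm _.
by rewrite ler_nat.
Qed.

(** The constants are fixed in the order [A], [D] and [a0], the gain [q], the tail radius [r], the
    cost [T] of a sample in a small cell, the mesh [h], and last the new bound [K'], which depends
    on the mesh. Each of the two losses is at most [q / 4], so the gain contradicts minimality. *)
Lemma many_bounded_step m : (m < k.+1)%N -> many_bounded m -> many_bounded m.+1.
Proof.
move=> mk [A1 [N1 HN1]].
have [C [N2 [C0' N20 HN2]]] := mu_penalty_bound.
have [A A0 A1A] : exists2 A : R, 0 <= A & A1 <= A.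
  by exists `|A1|; [exact: normr_ge0|exact: ler_norm].
have [D hD] := exists_nat_ge delta.
have [a0 ha0] := exists_nat_ge (A + delta + 2 * d%:R + 2 * M + 1).
pose C0 : R := (a0 + k * D)%:R.
pose B := 2 + 2 * (M + C0) ^+ 2.
have B0 : 0 < B by rewrite /B ltr_wpDr// mulr_ge0 ?sqr_ge0.
have [q q0 [N3 HN3]] := near_frequency a0 D.
have eB0 : 0 < q / (4 * B) by rewrite divr_gt0// mulr_gt0.
have [r1 [N4 HN4]] := rd_tail HR eB0.
pose r := Num.max r1 (C0 + d%:R).
pose T := B * (r ^+ 2 + 1) + 1.
have T0 : 0 < T by rewrite ltr_wpDl// mulr_ge0 ?(ltW B0)// addr_ge0// sqr_ge0.
pose S : R := (k.+1 * 2 ^ s)%:R * `|K|.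
have S0 : 0 <= S by rewrite mulr_ge0.
have [h hh] := exists_fine_mesh (mulr_ge0 (ltW T0) S0) (divr_gt0 q0 (ltr0n _ 4)).
pose L : R := 2 * r + 2 * M + C0 + 1.
have C00 : 0 <= C0 by [].
have rC : C0 + d%:R <= r by rewrite le_max lexx orbT.
have r0 : 0 <= r by apply: le_trans rC; rewrite addr_ge0.
have L0 : 0 <= L by rewrite /L !addr_ge0// mulr_ge0.
have [K' HK'] := @small_cells_size R k d s s_gt0 L C h L0 C0'.
have [N5 HN5] := small_cells_frequency L h.
exists (Num.max A K'), (maxn N1 (maxn N2 (maxn N3 (maxn N4 N5)))) => n.
rewrite !geq_max => /and5P[n1 n2 n3 n4 n5].
pose J := bounded01 A (mu n).
have JP j : reflect (forall x, I01 x -> enorm (mu n j x) <= A) (J j) := bounded01P A (mu n) j.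
have sJ : (m <= #|[pred j | J j]|)%N.
  apply: leq_trans (HN1 n n1) _; apply: subset_leq_card; apply/fintype.subsetP => j.
  move=> hj; have {}hj := bounded01P _ _ _ hj; suff : J j by []; apply/JP => x x01.
  exact: le_trans (hj x x01) A1A.
have sJ' : [pred j | J j] \subset [pred j | bounded01 (Num.max A K') (mu n) j].
  apply/fintype.subsetP => j; move=> hj; have {}hj := JP j hj.
  suff : bounded01 (Num.max A K') (mu n) j by []; apply/bounded01P => x x01.
  by rewrite le_max hj.
(* Either a trajectory outside [J] obeys the enlarged bound and the count grows, or [J] is
   everything, or all trajectories outside [J] have at most [2 ^ s] small cells and the comparison
   applies. *)
have [/existsP[j /andP[Jj bj]]|noJ] := boolP [exists j, ~~ J j && bounded01 (Num.max A K') (mu n) j].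
  apply: leq_ltn_trans sJ _; apply: proper_card; rewrite properE sJ'/=.
  by apply/fintype.subsetPn; exists j; [exact: bj|exact: Jj].
have [/forallP allJ|] := boolP [forall j, J j].
  apply: leq_trans (subset_leq_card sJ'); rewrite (_ : #|[pred j | J j]| = k.+1)//.
  rewrite -[RHS](card_ord k.+1); apply: eq_card => j; exact: allJ.
rewrite negb_forall => /existsP[l0 Jl0]; exfalso.
have szS j : ~~ J j -> (size (small_cells (mu n) L h j) <= 2 ^ s)%N.
  move=> Jj; rewrite leqNgt; apply/negP => sz.
  move/negP: noJ; apply; apply/existsP; exists j; rewrite Jj/=.
  apply/bounded01P => x x01; rewrite le_max; apply/orP; right.
  exact: (HK' _ j (mu_Theta n).1 (HN2 n n2 j) sz x x01).
pose w : traj := fun j => if J j then mu n j else fun=> far_point a0 D j.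
have n0 : (0 < n)%N by exact: leq_trans n2.
have hw : Theta s delta w.
  apply: (@replaced_Theta _ _ _ _ s_gt0 d_gt0 a0 D delta A) => //.
  - by have := ler0n R d; have := M0; lra.
  - by move=> j x /JP; apply.
have pw : penalty s lambda w <= penalty s lambda (mu n).
  exact: (sobolevk_replace s_gt0 (far_point a0 D) J (ltW lambda_gt0) (mu_Theta n).1).2.
have ew : empirical_cost (mu n) n <= empirical_cost w n.
  by have := mu_le n0 hw; lra.
pose x i : R := (near_axis_point (a0 + l0 * D) (vv i))%:R.
pose tl i : R := if r < enorm (vv i) then enorm (vv i) ^+ 2 + 1 else 0.
pose b i : R := \sum_(j | ~~ J j) \sum_(a <- small_cells (mu n) L h j) \1_(cell h a) (ss i).
have gap : empirical_cost w n + average x n <=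
    empirical_cost (mu n) n + B * average tl n + T * average b n.
  rewrite -!averageZ -!averageD; apply: average_le => i _.
  pose bad := [exists j, ~~ J j && has (fun a => `[< cell h a (ss i) >]) (small_cells (mu n) L h j)].
  have b0 j : 0 <= \sum_(a <- small_cells (mu n) L h j) (\1_(cell h a) (ss i) : R).
    by apply: sumr_ge0 => a _; have /andP[] := @indic_bounds R _ (cell h a) (ss i).
  have badb : bad%:R <= b i.
    have [/existsP[j /andP[Jj /hasP[a aS /asboolP ac]]]|_] := boolP bad; last exact: sumr_ge0.
    rewrite /b (bigD1 j)//= (big_rem a)//= indicE mem_set//= -addrA lerDl.
    rewrite addr_ge0//; last exact: sumr_ge0.
    by apply: sumr_ge0 => a' _; have /andP[] := @indic_bounds R _ (cell h a') (ss i).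
  have ha : A + 2 * d%:R + 2 * M + 1 <= a0%:R by have := delta_gt0; lra.
  have cg := @cost_gap R k d d_gt0 (mu n) J a0 D A L r M C0 B (ss i) (zz i) (vv i) l0 bad
    M0 A0 erefl erefl rC (lexx _) ha _ Jl0 (rd_noise HR i) _.
  apply: le_trans (cg _ _) _.
  - by move=> j /JP; apply; exact: (rd_time HR).
  - move=> nbad j Jj; rewrite leNgt; apply/negP => uL.
    have [a aS ac] := small_cells_mem h (rd_time HR i) (ltW uL).
    move/negP: nbad; apply; apply/existsP; exists j; rewrite Jj/=.
    by apply/hasP; exists a => //; apply/asboolP.
  - by rewrite lerD2l ler_wpM2l// ltW.
have xq : q <= average x n by exact: HN3.
have tq : B * average tl n <= q / 4.
  apply: (@le_trans _ _ (B * (q / (4 * B)))); last first.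
    have E (z : R) : 0 < z -> z * (q / (4 * z)) = q / 4.
      by move=> z0; field; exact: lt0r_neq0.
    by rewrite E.
  rewrite ler_wpM2l ?(ltW B0)//; apply: le_trans (HN4 n n4); apply: average_le => i _.
  rewrite /tl; case: ifP => [|_].
    by rewrite gt_max => /andP[-> _].
  by case: ifP => // _; rewrite addr_ge0// sqr_ge0.
have bq : T * average b n <= q / 4.
  apply: le_trans hh; rewrite -mulrA ler_wpM2l ?(ltW T0)// /b average_sum.
  apply: (@le_trans _ _ (\sum_(j | ~~ J j) (2 ^ s)%:R * (`|K| / h.+1%:R))).
    apply: ler_sum => j Jj; apply: le_trans (HN5 n n5 (mu n) j) _.
    by rewrite ler_wpM2r ?divr_ge0// ler_nat szS.
  apply: (@le_trans _ _ (\sum_(j < k.+1) (2 ^ s)%:R * (`|K| / h.+1%:R))).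
    by rewrite [leRHS](bigID (fun j => ~~ J j))/= lerDl sumr_ge0.
  by rewrite sumr_const card_ord -[X in X <= _]mulr_natl mulrA -natrM /S mulrA lexx.
lra.
Qed.

Lemma mu_bounded : exists (A : R) N, forall n, (N <= n)%N ->
  forall j x, I01 x -> enorm (mu n j x) <= A.
Proof.
have H m : (m <= k.+1)%N -> many_bounded m.
  elim: m => [_|m IH mk]; first by exists 0, 0%N.
  by apply: many_bounded_step => //; apply: IH; exact: ltnW.
have [A [N HN]] := H k.+1 (leqnn _).
exists A, N => n Nn j x x01; have := HN n Nn.
rewrite -[X in (X <= _)%N](card_ord k.+1) => h.
have : [pred j | bounded01 A (mu n) j] =i predT.
  by apply/subset_cardP; [apply/eqP; rewrite eqn_leq max_card|exact/fintype.subsetP].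
by move=> /(_ j) hj; exact: (bounded01P _ _ _ hj).
Qed.

Lemma mu_sobB_bound : exists (C : R) N, 0 <= C /\ forall n, (N <= n)%N ->
  sobB s (mu n) (mu n) <= C.
Proof.
have [A [N HN]] := mu_bounded; have [C [N' [C0 _ HN']]] := mu_penalty_bound.
have [K' HK'] := @sobB_bound R k d s s_gt0 _ _ (normr_ge0 A) C0.
exists `|K'|, (maxn N N'); split=> // n; rewrite geq_max => /andP[h1 h2].
apply: le_trans (ler_norm K'); apply: HK'; first exact: (mu_Theta n).1.
- by move=> j x x01; apply: le_trans (HN n h1 j x x01) _; exact: ler_norm.
- by move=> j; exact: HN'.
Qed.

Lemma mu_weakly_compact : weakly_compact s mu.
Proof.
move=> _ [h [hh ->]]; have [C [N [C0 HN]]] := mu_sobB_bound.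
have hn n : (n <= h n)%N by exact: homo_ge_id.
(* Shifted past the index from which the norms are bounded. *)
pose u n := mu (h (n + N)%N).
have [g [hg [v hv]]] := sobolevk_weak_compact s_gt0 (u := u) (fun n => (mu_Theta _).1)
  (fun n => HN _ (leq_trans (leq_addl n N) (hn (n + N)%N))).
exists (u \o g), v; split=> //; exists (fun n => (g n + N)%N); split=> // m n mn.
by rewrite ltn_add2r; exact: hg.
Qed.

Variables (h : nat -> nat) (v : traj).
Hypotheses (hh : {homo h : m n / (m < n)%N}) (hv : weak_cvg s (mu \o h) v).

Let hn n : (n <= h n)%N. Proof. exact: homo_ge_id. Qed.

Let pointwise j x l : I01 x -> mu (h n) j x ord0 l @[n --> \oo] --> v j x ord0 l.
Proof. by have := weak_cvg_pointwise s_gt0 hv; apply. Qed.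

Lemma limit_Theta : Theta s delta v.
Proof.
split; first exact: hv.1.
move=> x x01 j l jl; apply/ler_addgt0Pr => e e0.
pose e' := e / (2 * d.+1%:R).
have e'0 : 0 < e' by rewrite divr_gt0// mulr_gt0.
have H i : exists N, forall n, (N <= n)%N -> forall a : 'I_d,
    `|mu (h n) i x ord0 a - v i x ord0 a| <= e'.
  have cv a := (cvg_seqP _ _).1 (@pointwise i x a x01) e' e'0.
  have [N HN] := choice cv.
  exists (\max_a N a) => n Nn a; apply: HN; apply: leq_trans Nn.
  exact: (leq_bigmax (F := N)).
have Hn i : exists N, forall n, (N <= n)%N -> enorm (mu (h n) i x - v i x) <= e / 2.
  have [N HN] := H i; exists N => n Nn.
  apply: (@le_trans _ _ (d%:R * e')).
    by apply: enorm_le_sum => a; rewrite !mxE; exact: HN.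
  apply: (@le_trans _ _ (d.+1%:R * e')); first by rewrite ler_wpM2r ?(ltW e'0)// ler_nat.
  by rewrite /e' invfM mulrC -!mulrA mulVf ?pnatr_eq0// mulr1.
have [N1 HN1] := Hn j; have [N2 HN2] := Hn l.
pose n := maxn N1 N2.
have h1 := HN1 n (leq_maxl _ _); have h2 := HN2 n (leq_maxr _ _).
have h3 := (mu_Theta (h n)).2 x x01 j l jl.
have h4 := enorm_triB (mu (h n) j x) (v j x) (mu (h n) l x).
have h5 := enorm_triB (v j x) (v l x) (mu (h n) l x).
by rewrite (enormB (v l x)) in h5; lra.
Qed.

(** Pointwise convergence on a finite grid, and two Hoelder bounds with a common constant between
    the grid and [x]: three errors in each coordinate, whence the 3 in [e']. *)
Lemma limit_uniform (e : R) : 0 < e -> exists N, forall n, (N <= n)%N ->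
  forall j x, I01 x -> enorm (mu (h n) j x - v j x) <= e.
Proof.
move=> e0; have [C [N0 [C0 HN0]]] := mu_sobB_bound.
pose C1 := Num.sqrt (4 ^+ s * (C + sobB s v v)).
have sv := hv.1.
have v0 : 0 <= sobB s v v by exact: (sip_ge0 (sobolevk_sip s_gt0)).
pose e' := e / (3 * d.+1%:R).
have e'0 : 0 < e' by rewrite divr_gt0// mulr_gt0.
have C10 : 0 < C1 ^+ 2 + 1 by rewrite ltr_wpDl// sqr_ge0.
have [m hm] := exists_fine_mesh (ltW C10) (exprn_gt0 2 e'0).
have holder (u : traj) j l x x' : sobolevk s u -> sobB s u u <= C + sobB s v v ->
    I01 x -> I01 x' -> `|x - x'| <= m.+1%:R^-1 -> `|u j x ord0 l - u j x' ord0 l| <= e'.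
  move=> su uC x01 x01' xx'.
  apply: le_trans (sobolevk_holder s_gt0 j l su x01 x01') _.
  apply: (@le_trans _ _ (Num.sqrt (m.+1%:R^-1) * C1)).
    apply: ler_pM; rewrite ?sqrtr_ge0// ler_wsqrtr//.
    by rewrite ler_wpM2l// exprn_ge0.
  rewrite -[leRHS]ger0_norm ?(ltW e'0)// -[leRHS]sqrtr_sqr.
  rewrite -[X in _ * X]ger0_norm ?sqrtr_ge0// -[X in _ * X]sqrtr_sqr -sqrtrM ?invr_ge0//.
  apply: ler_wsqrtr; apply: le_trans hm.
  by rewrite mulrC ler_wpM2r// lerDl.
have cv (z : 'I_m.+1 * 'I_k.+1 * 'I_d) : exists N, forall n, (N <= n)%N ->
    `|mu (h n) z.1.2 (z.1.1%:R / m.+1%:R) ord0 z.2 - v z.1.2 (z.1.1%:R / m.+1%:R) ord0 z.2| <= e'.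
  have g01 : I01 (z.1.1%:R / m.+1%:R : R).
    apply/I01P; rewrite divr_ge0//= ler_pdivrMr// mul1r ler_nat; exact: ltnW.
  exact: (cvg_seqP _ _).1 (@pointwise z.1.2 _ z.2 g01) e' e'0.
have [N HN] := choice cv.
exists (maxn N0 (\max_z N z)) => n; rewrite geq_max => /andP[n0 n1] j x x01.
have /andP[x0 x1] : 0 <= x <= 1 by exact/I01P.
have [a xa] : exists a : 'I_m.+1, `|x - a%:R / m.+1%:R| <= m.+1%:R^-1.
  have z0 : 0 <= x * m.+1%:R by rewrite mulr_ge0.
  have /andP[a1 a2] := truncn_itv z0; set a := Num.truncn _ in a1 a2.
  have H b : b%:R <= x * m.+1%:R -> x * m.+1%:R <= b.+1%:R ->
      `|x - b%:R / m.+1%:R| <= m.+1%:R^-1.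
    move=> b1 b2; rewrite ger0_norm ?subr_ge0 ?ler_pdivrMr//.
    rewrite -(ler_pM2r (ltr0Sn R m)) mulrBl divfK ?pnatr_eq0// mulVf ?pnatr_eq0//.
    by rewrite lerBlDl natr1.
  have [am|am] := ltnP a m.+1; first by exists (Ordinal am); apply: H => //; exact: ltW.
  (* Only [x = 1] gets here; the last grid point is still within the mesh. *)
  exists ord_max; apply: H; first by apply: le_trans a1; rewrite ler_nat /= ltnW.
  by rewrite -[leRHS]mul1r ler_wpM2r.
have g01 : I01 (a%:R / m.+1%:R : R).
  by apply/I01P; rewrite divr_ge0//= ler_pdivrMr// mul1r ler_nat; exact: ltnW.
apply: (@le_trans _ _ (d%:R * (3 * e'))); last first.
  apply: (@le_trans _ _ (d.+1%:R * (3 * e'))).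
    by apply: ler_wpM2r; [apply: mulr_ge0 => //; exact: ltW|rewrite ler_nat].
  have E (z : R) : 0 < z -> z * (3 * (e / (3 * z))) = e.
    by move=> z0; field; exact: lt0r_neq0.
  by rewrite E.
apply: enorm_le_sum => l; rewrite !mxE.
have h1 : `|mu (h n) j x ord0 l - mu (h n) j (a%:R / m.+1%:R) ord0 l| <= e'.
  apply: holder => //; first exact: (mu_Theta _).1.
  by apply: le_trans (HN0 _ (leq_trans n0 (hn n))) _; rewrite lerDl.
have h2 : `|v j x ord0 l - v j (a%:R / m.+1%:R) ord0 l| <= e'.
  by apply: holder => //; rewrite lerDr.
have h3 := HN (a, j, l) n (leq_trans (leq_bigmax (F := N) (a, j, l)) n1).
move: h1 h2 h3 => /=; move: (mu (h n) j x ord0 l) (mu (h n) j _ ord0 l) => p1 p2.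
move: (v j x ord0 l) (v j _ ord0 l) => q1 q2.
rewrite !ler_norml => /andP[? ?] /andP[? ?] /andP[? ?]; apply/andP; split; lra.
Qed.

Hypothesis F_ge0 : forall u, 0 <= F u.

(** The tuple moves with [n], so [rd_cost] does not apply to it; it is applied to the fixed limit
    [v], and uniform convergence transfers the result. *)
Lemma limit_cost (e : R) : 0 < e -> exists N, forall n, (N <= n)%N ->
  `|empirical_cost (mu (h n)) (h n) - F v| <= e.
Proof.
move=> e0; have sv := hv.1.
have [p [r [p0 p1 r0 pr]]] := squeeze_precision (F_ge0 v) e0.
have c0 : 0 < (1 + p^-1) * r ^+ 2.
  by rewrite mulr_gt0 ?exprn_gt0// addr_gt0// invr_gt0.
have [N1 HN1] := rd_cost HR (sobolevk_admissible s_gt0 sv) (sobolevk_equicontinuous s_gt0 sv) c0.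
have [N2 HN2] := limit_uniform r0.
exists (maxn 1 (maxn N1 N2)) => n; rewrite !geq_max => /and3P[n0 n1 n2].
have hn0 : (0 < h n)%N by exact: leq_trans (hn n).
apply: le_trans pr; apply: (@squeeze_limit _ p _ _ (F v) _ (empirical_cost v (h n))) => //.
- exact: ltW.
- exact: empirical_cost_ge0.
- exact: empirical_cost_ge0.
- by rewrite mulrDl mul1r -addrA lerDl addr_ge0 ?(ltW c0)// mulr_ge0 ?(ltW p0).
- by rewrite mulrDl mul1r -addrA lerDl addr_ge0 ?(ltW c0)// mulr_ge0 ?(ltW p0).
- rewrite -averageZ -(average_cst ((1 + p^-1) * r ^+ 2) hn0) -averageD.
  by apply: average_le => i _; apply: min_cost_near => // j; apply: HN2 => //; exact: (rd_time HR).
- rewrite -averageZ -(average_cst ((1 + p^-1) * r ^+ 2) hn0) -averageD.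
  apply: average_le => i _; apply: min_cost_near => // j; rewrite enormB.
  by apply: HN2 => //; exact: (rd_time HR).
- by apply: HN1; exact: leq_trans (hn n).
Qed.

(** Minimality bounds the penalties by what the comparison with [w] leaves once both empirical costs
    are within [e / 2] of their limits; [weak_cvg_penalty] carries this bound to [v]. *)
Lemma limit_minimizes w : Theta s delta w ->
  F v + penalty s lambda v <= F w + penalty s lambda w.
Proof.
move=> hw; apply/ler_addgt0Pr => e e0.
have e20 : 0 < e / 2 by rewrite divr_gt0.
have [N1 HN1] := limit_cost e20.
have [N2 HN2] := rd_cost HR (sobolevk_admissible s_gt0 hw.1) (sobolevk_equicontinuous s_gt0 hw.1) e20.
have H n : (maxn 1 (maxn N1 N2) <= n)%N ->
    penalty s lambda ((mu \o h) n) <= F w + penalty s lambda w - F v + e.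
  rewrite !geq_max => /and3P[n0 n1 n2].
  have hn0 : (0 < h n)%N by exact: leq_trans (hn n).
  have := mu_le hn0 hw; have := HN1 n n1; have := HN2 (h n) (leq_trans n2 (hn n)).
  rewrite -/(empirical_cost w (h n)) !ler_norml => /andP[_ h1] /andP[h2 _] /= h3; lra.
have := weak_cvg_penalty s_gt0 lambda_gt0 (fun n => (mu_Theta (h n)).1) hv H.
lra.
Qed.

End minimizing_sequence.

Theorem theorem3p1 (R : realType) (s k d : nat) (lambda delta : R)
    (s_gt0 : (0 < s)%N) (d_gt0 : (0 < d)%N)
    (lambda_gt0 : 0 < lambda) (delta_gt0 : 0 < delta)
    (dO : measure_display) (Omega : measurableType dO) (P : probability Omega R)
    (mudag : 'I_k.+1 -> R -> 'rV[R]_d) (p : 'I_k.+1 -> R)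
    (phi0 : 'rV[R]_d -> R) (phiT : R -> R)
    (phi : nat -> {RV P >-> 'I_k.+1}) (eps : nat -> {RV P >-> 'rV[R]_d})
    (t : nat -> {RV P >-> R}) (y : nat -> Omega -> 'rV[R]_d) :
  assumption1 mudag p phi0 phiT phi eps t y ->
  assumption2 phi0 ->
  assumption3 phi0 ->
  {ae P, forall w, forall mu : nat -> 'I_k.+1 -> R -> 'rV[R]_d,
    (forall n, Theta s delta (mu n)) ->
    (forall n, (0 < n)%N ->
       is_minimizer (Theta s delta)
         (f_n s lambda (t^~ w) (y^~ w) n) (mu n)) ->
    weakly_compact s mu /\
    forall mu' muoo, is_subsequence mu mu' -> weak_cvg s mu' muoo ->
      is_minimizer (Theta s delta)
        (f_infty s lambda p mudag phi0 phiT) muoo}.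
Proof.
move=> A1 A2 A3; have [M [K [M0]]] := regular_data_ae A1 A2 A3.
apply: filterS => w HR mu muT mu_min; split.
  exact: (mu_weakly_compact s_gt0 d_gt0 lambda_gt0 delta_gt0 M0 HR muT mu_min).
move=> _ v [h [hh ->]] hv.
have F0 (u : 'I_k.+1 -> R -> 'rV[R]_d) : 0 <= expected_cost t y u.
  exact: expected_cost_ge0.
have vT := limit_Theta s_gt0 muT hv.
split=> // u uT.
(* Sobolev tuples have finite expected cost, so the comparison in [\bar R] is one of real
   numbers. *)
rewrite (f_inftyE A1 A2 s lambda (sobolevk_admissible s_gt0 vT.1)).
rewrite (f_inftyE A1 A2 s lambda (sobolevk_admissible s_gt0 uT.1)) lee_fin.
exact: (limit_minimizes s_gt0 d_gt0 lambda_gt0 delta_gt0 M0 HR muT mu_min hh hv F0).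
Qed.
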